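(* Let $f$ be a transcendental entire function, let $J(f)$ be its Julia set, and let $I^{+}(f)=\{z\in\mathbb{C}:(f^n(z))_{n\in\mathbb{N}}\text{ is unbounded}\}$. Then $$I^{+}(f)\neq\emptyset,\quad I^{+}(f)\cap J(f)\neq\emptyset,\quad J(f)=\overline{I^{+}(f)\cap J(f)},\quad J(f)=\partial I^{+}(f),$$ and $\overline{I^{+}(f)}$ has no bounded components. (Closures and boundaries are taken in $\mathbb{C}$.)
   Context: $f^n$ denotes the $n$th iterate of $f$. A transcendental entire function is an entire function that is not a polynomial. The Fatou set $F(f)$ is the set of points $z\in\mathbb{C}$ such that the family $\{f^n:n\in\mathbb{N}\}$ is normal in some neighbourhood of $z$ (as maps into the Riemann sphere), and the Julia set is $J(f)=\mathbb{C}\setminus F(f)$. *)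

(* Defs.v *)
From HB Require Import structures.
From mathcomp Require Import all_boot all_order all_algebra.
From mathcomp Require Import complex.
From mathcomp Require Import all_classical all_reals all_analysis.

Set Implicit Arguments.
Unset Strict Implicit.
Unset Printing Implicit Defensive.

Import Order.TTheory GRing.Theory Num.Theory.
Import numFieldNormedType.Exports.

Local Open Scope classical_set_scope.
Local Open Scope ring_scope.
Local Open Scope complex_scope.

(* The topology and norm of the plane are those that every numFieldType
   carries.  As a normed module over itself, R[i] makes [derivable f z 1]
   complex differentiability, and [bounded_set] uses the modulus. *)
#[warnings="-redundant-canonical-projection"]
HB.instance Definition _ (R : realType) := NormedModule.copy R[i] R[i]^o.

Section Definitions.
Variable R : realType.
Implicit Types (f : R[i] -> R[i]) (U : set R[i]).

Definition entire f := forall z, derivable f z 1.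

Definition transcendental_entire f :=
  entire f /\ ~ exists p : {poly R[i]}, forall z, f z = p.[z].

Definition riemann_sphere := one_point_compactification R[i].

(* Distance in the unit sphere of R^3 between stereographic preimages. *)
Definition chordal_dist (p q : riemann_sphere) : R :=
  let m (z : R[i]) : R := ComplexField.Normc.normc z in
  match p, q with
  | Some z, Some w =>
      2 * m (z - w) / (Num.sqrt (1 + m z ^+ 2) * Num.sqrt (1 + m w ^+ 2))
  | Some z, None | None, Some z => 2 / Num.sqrt (1 + m z ^+ 2)
  | None, None => 0
  end.

(* Only the restrictions to U of the maps involved matter, here and in
   [normal_on]. *)
Definition locally_uniform_cvg U (u : nat -> R[i] -> riemann_sphere)
    (g : R[i] -> riemann_sphere) :=
  forall K : set R[i], compact K -> K `<=` U ->
  forall e : R, 0 < e ->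
    \forall n \near \oo, forall z, K z -> chordal_dist (u n z) (g z) < e.

(* The limit may take the value infinity; in particular, it may be the
   constant map infinity. *)
Definition normal_on U (F : set (R[i] -> riemann_sphere)) :=
  forall u : nat -> R[i] -> riemann_sphere, (forall n, F (u n)) ->
  exists phi : nat -> nat, {homo phi : m n / (m < n)%N} /\
  exists g : R[i] -> riemann_sphere,
    locally_uniform_cvg U (fun n => u (phi n)) g.

(* The 0th iterate, the identity, is included; adding one map affects neither
   normality of the family nor boundedness of an orbit. *)
Definition iterates f : set (R[i] -> riemann_sphere) :=
  range (fun (n : nat) (z : R[i]) => Some (iter n f z)).

Definition fatou f : set R[i] :=
  [set z | exists U, [/\ open U, U z & normal_on U (iterates f)]].

Definition julia f : set R[i] := ~` fatou f.

Definition unbounded_orbit_set f : set R[i] :=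
  [set z | ~ bounded_set (range (fun n : nat => iter n f z))].

Definition boundary (A : set R[i]) : set R[i] := closure A `\` interior A.

End Definitions.

(* Main.v *)
(* Cauchy theory is reduced to Goursat's lemma on rectangles, from which the mean
   value property, the maximum principle, removable singularities and Schwarz's
   lemma follow.  Holomorphic functions omitting 0 and 1 are normal: 2^m-th roots
   of such functions omit a dense set of points of the unit circle, and Zalcman's
   rescaling then bounds their spherical derivative (Landau, Schottky, Montel).

   If K is the set of bounded orbits and I its complement, then the Fatou set is
   the union of the interior of I and of the set where the iterates are locally
   bounded, because K has two points: otherwise Picard's theorem fails for a
   quotient built from f.  The Julia set is unbounded, since near infinity f takes
   all values but one and its iterates grow.  By Montel, every disc about a Julia
   point contains preimages of Julia points of arbitrarily large modulus, and a
   nested sequence of discs converges to a point of I in the Julia set.  Blowing up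
   gives the closure and the boundary.  A bounded component of the closure of I
   would be surrounded by a compact set of uniformly bounded orbits, against the
   maximum principle. *)
Require Import Defs.
From mathcomp Require Import all_boot all_order all_algebra.
From mathcomp Require Import complex ring lra.
From mathcomp Require Import all_classical all_reals all_analysis.
Import Order.TTheory GRing.Theory Num.Theory.
Import numFieldNormedType.Exports.
Local Open Scope classical_set_scope.
Local Open Scope ring_scope.
Local Open Scope complex_scope.

(** Contour integration enters only through the mean value property. From there on the maximum
    principle does the work of integral formulas and power series: derivatives are bounded by
    comparing difference quotients on circles, and zeros are counted by splitting off linear factors
    and watching how many of them a bound on a large circle tolerates. Square roots are the only
    multivalued functions involved. Passing to [2 ^ m]-th roots costs a factor [2 ^+ m] in the
    spherical derivative, which is harmless because [m] is fixed once and for all by the length of a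
    chain of discs. Montel's theorem asks for two omitted values. On an open set of bounded orbits,
    a point of I and its image serve, since an unbounded orbit contains no fixed point. On an open
    set of unbounded orbits they have to be two points of K, and this is the obstacle that the
    results on fixed points and omitted values of quotients overcome. Once it is removed, membership
    in the Fatou set can be read off from the size of nearby orbits alone, and its invariance under
    images and preimages reduces to openness and continuity of f. *)

Local Notation Re := complex.Re.
Local Notation Im := complex.Im.

Local Set Implicit Arguments.
Local Unset Strict Implicit.

(** * Modulus, continuity, compactness and differentiability in the plane *)

Section Basics.
Context {R : realType}.
Notation C := R[i].
Implicit Types (z w a b : C) (f g : C -> C) (A X : set C).

(** The norm of [R[i]] takes its values in [R[i]], whose order is partial; a real-valued modulus
    makes the estimates accessible to [lra] and [nra]. *)
Definition N z : R := ComplexField.Normc.normc z.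

Lemma normE z : `|z| = (N z)%:C. Proof. by []. Qed.
Lemma N0 : N 0 = 0. Proof. exact: ComplexField.Normc.normc0. Qed.
Lemma N1 : N 1 = 1. Proof. exact: ComplexField.Normc.normc1. Qed.
Lemma N_ge0 z : 0 <= N z. Proof. by case: z => x y; rewrite /N /= sqrtr_ge0. Qed.
Lemma N_eq0 z : (N z == 0) = (z == 0).
Proof.
apply/eqP/eqP => [|->]; last exact: N0; exact: ComplexField.Normc.eq0_normc.
Qed.
Lemma N_gt0 z : (0 < N z) = (z != 0).
Proof. by rewrite lt_def N_ge0 N_eq0 andbT. Qed.
Lemma NM z w : N (z * w) = N z * N w. Proof. exact: ComplexField.Normc.normcM. Qed.
Lemma NV z : N z^-1 = (N z)^-1. Proof. exact: ComplexField.Normc.normcV. Qed.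
Lemma NX z n : N (z ^+ n) = N z ^+ n.
Proof. by elim: n => [|n IH]; rewrite ?expr0 ?N1 // !exprS NM IH. Qed.
Lemma NN z : N (- z) = N z. Proof. exact: normcN. Qed.
Lemma N_triangle z w : N (z + w) <= N z + N w. Proof. exact: le_normcD. Qed.
Lemma NB z w : N (z - w) = N (w - z). Proof. by rewrite -NN opprB. Qed.
Lemma N_dist z w t : N (z - t) <= N (z - w) + N (w - t).
Proof. by have := N_triangle (z - w) (w - t); rewrite addrA subrK. Qed.
Lemma N_sub z w : N z - N w <= N (z - w).
Proof. by have := N_triangle (z - w) w; rewrite subrK; lra. Qed.
Lemma NC (x : R) : N x%:C = `|x|.
Proof. by rewrite /N /= expr0n addr0 sqrtr_sqr. Qed.
Lemma Ni : N 'i = 1.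
Proof. by rewrite /N /= expr0n expr1n add0r sqrtr1. Qed.
Lemma Nsq z : N z ^+ 2 = Re z ^+ 2 + Im z ^+ 2.
Proof. by case: z => x y; rewrite /N /= sqr_sqrtr // addr_ge0 // sqr_ge0. Qed.
Lemma Re_le z : `|Re z| <= N z.
Proof.
rewrite -ler_sqr ?nnegrE ?N_ge0 // Nsq real_normK ?num_real // lerDl sqr_ge0 //.
Qed.
Lemma Im_le z : `|Im z| <= N z.
Proof.
rewrite -ler_sqr ?nnegrE ?N_ge0 // Nsq real_normK ?num_real // lerDr sqr_ge0 //.
Qed.
Lemma N_ReIm z : N z <= `|Re z| + `|Im z|.
Proof.
have {1}-> : z = (Re z)%:C + 'i * (Im z)%:C by exact: complexE.
by apply: le_trans (N_triangle _ _) _; rewrite NM Ni !NC mul1r.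
Qed.
Lemma cReD z w : Re (z + w) = Re z + Re w. Proof. by case: z; case: w. Qed.
Lemma cImD z w : Im (z + w) = Im z + Im w. Proof. by case: z; case: w. Qed.
Lemma cReN z : Re (- z) = - Re z. Proof. by case: z. Qed.
Lemma cImN z : Im (- z) = - Im z. Proof. by case: z. Qed.
Lemma cReM z w : Re (z * w) = Re z * Re w - Im z * Im w. Proof. by case: z; case: w. Qed.
Lemma cImM z w : Im (z * w) = Re z * Im w + Im z * Re w. Proof. by case: z => ? ?; case: w. Qed.
Lemma complexP z w : Re z = Re w -> Im z = Im w -> z = w.
Proof. by case: z w => [a b] [c d] /= -> ->. Qed.

Lemma nbhs_N a A : nbhs a A <-> exists2 e : R, 0 < e & forall z, N (z - a) < e -> A z.
Proof.
split => [/nbhs_ballP[e /= e0 H]|[e e0 H]].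
  exists (Re e).
    by move: e0; rewrite ltcE => /andP[].
  move=> z zN; apply: H; rewrite -ball_normE /= distrC normE.
  move: e0 zN; case: e => x y; rewrite !ltcE /= => /andP[/eqP -> _] ->.
  by rewrite eqxx.
apply/nbhs_ballP; exists e%:C => /=; first by rewrite ltcE /= eqxx.
move=> z; rewrite -ball_normE /= distrC normE ltcR; exact: H.
Qed.

Definition cont f a := forall e : R, 0 < e ->
  exists2 d : R, 0 < d & forall z, N (z - a) < d -> N (f z - f a) < e.

Lemma cont_cst (c : C) a : cont (fun=> c) a.
Proof. by move=> e e0; exists 1 => // z _; rewrite subrr N0. Qed.
Lemma cont_id a : cont id a.
Proof. by move=> e e0; exists e. Qed.
Lemma contD f g a : cont f a -> cont g a -> cont (fun z => f z + g z) a.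
Proof.
move=> cf cg e e0; have e2 : 0 < e / 2 by lra.
have [r r0 rH] := cf _ e2; have [s s0 sH] := cg _ e2.
exists (Num.min r s); first by rewrite lt_min r0.
move=> z; rewrite lt_min => /andP[/rH h1 /sH h2];
have -> : f z + g z - (f a + g a) = (f z - f a) + (g z - g a) by ring.
have := N_triangle (f z - f a) (g z - g a); lra.
Qed.
Lemma contN f a : cont f a -> cont (fun z => - f z) a.
Proof.
by move=> cf e /cf[d d0 H]; exists d => // z /H; rewrite -opprD NN.
Qed.
Lemma contB f g a : cont f a -> cont g a -> cont (fun z => f z - g z) a.
Proof. by move=> hf hg; apply: contD => //; exact: contN. Qed.
Lemma cont_bound f a : cont f a ->
  exists2 d : R, 0 < d & forall z, N (z - a) < d -> N (f z) < N (f a) + 1.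
Proof.
move=> /(_ 1 ltr01)[d d0 H]; exists d => // z /H; have := N_sub (f z) (f a); lra.
Qed.
Lemma contM f g a : cont f a -> cont g a -> cont (fun z => f z * g z) a.
Proof.
move=> cf cg e e0.
have [d d0 dH] := cont_bound cf.
have f1 : 0 < N (f a) + 1 by have := N_ge0 (f a); lra.
have g1 : 0 < N (g a) + 1 by have := N_ge0 (g a); lra.
have [r r0 rH] := cf _ (divr_gt0 (divr_gt0 e0 (ltr0Sn _ 1)) g1).
have [s s0 sH] := cg _ (divr_gt0 (divr_gt0 e0 (ltr0Sn _ 1)) f1).
exists (Num.min d (Num.min r s)); first by rewrite !lt_min d0 r0.
move=> z; rewrite !lt_min => /and3P[/dH h0 /rH h1 /sH h2].
have -> : f z * g z - f a * g a = f z * (g z - g a) + g a * (f z - f a) by ring.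
apply: le_lt_trans (N_triangle _ _) _; rewrite !NM.
rewrite ltr_pdivlMr // in h1; rewrite ltr_pdivlMr // in h2.
have := N_ge0 (f z); have := N_ge0 (g a); have := N_ge0 (g z - g a); have := N_ge0 (f z - f a).
nra.
Qed.
Lemma contV f a : f a != 0 -> cont f a -> cont (fun z => (f z)^-1) a.
Proof.
move=> fa cf e e0; have n0 : 0 < N (f a) by rewrite N_gt0.
have n2 : 0 < N (f a) / 2 by lra.
have n3 : 0 < e * (N (f a) ^+ 2 / 2) by rewrite mulr_gt0 // divr_gt0 // exprn_gt0.
have [r r0 rH] := cf _ n2; have [s s0 sH] := cf _ n3.
exists (Num.min r s); first by rewrite lt_min r0.
move=> z; rewrite lt_min => /andP[/rH h1 /sH h2].
have h3 : N (f a) / 2 < N (f z) by have := N_sub (f a) (f z); rewrite NB; lra.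
have fz : f z != 0 by rewrite -N_gt0; lra.
have -> : (f z)^-1 - (f a)^-1 = (f a - f z) / (f z * f a) by field; rewrite fz fa.
rewrite NM NV NM NB ltr_pdivrMr ?mulr_gt0 ?N_gt0 //; apply: lt_le_trans h2 _.
by rewrite ler_wpM2l ?(ltW e0) //; nra.
Qed.
Lemma cont_comp f g a : cont g a -> cont f (g a) -> cont (fun z => f (g z)) a.
Proof.
move=> cg cf e /cf[d d0 dH]; have [r r0 rH] := cg d d0; exists r => // z /rH; exact: dH.
Qed.

Lemma cont_near f g a (d : R) : 0 < d -> (forall z, N (z - a) < d -> f z = g z) ->
  cont f a -> cont g a.
Proof.
move=> d0 fg fa e e0; have [r r0 rH] := fa e e0.
exists (Num.min d r); first by rewrite lt_min d0.
move=> z; rewrite lt_min => /andP[zd zr]; rewrite -!fg ?subrr ?N0 //; exact: rH.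
Qed.

Definition rcont (q : C -> R) a :=
  forall e : R, 0 < e -> exists2 d : R, 0 < d & forall z, N (z - a) < d -> `|q z - q a| < e.

Lemma rcontE (q : C -> R) a : rcont q a <-> {for a, continuous q}.
Proof.
split => [H A /nbhs_ballP[e /= e0 eA]|H e e0].
  have [d d0 dH] := H e e0; apply/nbhs_N; exists d => // z /dH hz; apply: eA.
  by rewrite /ball /= distrC.
have : nbhs (q a) (ball (q a) e) by apply/nbhs_ballP; exists e.
by move=> /H /nbhs_N [d d0 dH]; exists d => // z /dH; rewrite /= /ball /= distrC.
Qed.

Lemma rcont_N f a : cont f a -> rcont (fun z => N (f z)) a.
Proof.
move=>  H e /H[d d0 dH]; exists d => // z /dH; apply: le_lt_trans.
by rewrite ler_norml; have := N_sub (f z) (f a); have := N_sub (f a) (f z); rewrite (NB (f a)); lra.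
Qed.
Lemma rcont_Re f a : cont f a -> rcont (fun z => Re (f z)) a.
Proof.
move=>  H e /H[d d0 dH]; exists d => // z /dH; apply: le_lt_trans.
by rewrite -cReN -cReD Re_le.
Qed.

Lemma evt_max X (q : C -> R) : X !=set0 -> compact X -> (forall a, X a -> rcont q a) ->
  exists2 a, X a & forall z, X z -> q z <= q a.
Proof.
move=> X0 cX qX; have [] := @compact_EVT_max C R q X X0 cX.
  by apply: continuous_in_subspaceT => a; rewrite inE => /qX /rcontE.
move=> c; rewrite inE => cX' H; exists c => // z Xz; apply: H; by rewrite inE.
Qed.

Definition cdisc a (r : R) : set C := [set z | N (z - a) <= r].

Lemma cont_cplx : continuous (fun p : R * R => p.1 +i* p.2 : C).
Proof.
move=> [x y] A /nbhs_N[e e0 eA].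
have e2 : 0 < e / 2 by lra.
exists (ball x (e / 2), ball y (e / 2)) => /=.
  by split; exact: nbhsx_ballx.
move=> [u v] /= [hu hv]; apply: eA; apply: le_lt_trans (N_ReIm _) _ => /=.
by move: hu hv; rewrite /ball /= distrC (distrC y); lra.
Qed.

Lemma compact_cdisc a (r : R) : compact (cdisc a r).
Proof.
pose Q := (fun p : R * R => p.1 +i* p.2 : C) @` (`[Re a - r, Re a + r] `*` `[Im a - r, Im a + r]).
have cQ : compact Q.
  apply: continuous_compact; last by apply: compact_setX; exact: segment_compact.
  by apply: continuous_subspaceT; exact: cont_cplx.
apply: (subclosed_compact _ cQ).
  move=> z cz; rewrite /cdisc /= leNgt; apply/negP => zr.
  have : nbhs z [set w | N (w - z) < N (z - a) - r].
    by apply/nbhs_N; exists (N (z - a) - r) => //; rewrite subr_gt0.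
  move=> /cz [w [/= wr wz]]; have := N_dist z w a; rewrite (NB z w); move: wr wz; rewrite /cdisc /=; lra.
move=> z; rewrite /cdisc /= => zr; exists (Re z, Im z) => /=; last by case: (z) (zr).
have := Re_le (z - a); have := Im_le (z - a); rewrite cReD cImD cReN cImN !ler_norml => h1 h2.
by split; rewrite in_itv /=; lra.
Qed.

Lemma compact_circle a (r : R) : compact [set z | N (z - a) = r].
Proof.
apply: (subclosed_compact _ (@compact_cdisc a r)); last by move=> z /= zr; rewrite /cdisc /= zr.
move=> z cz /=; apply/eqP; rewrite eq_le !leNgt; apply/andP; split; apply/negP => h.
  have : nbhs z [set w | N (w - z) < N (z - a) - r].
    by apply/nbhs_N; exists (N (z - a) - r) => //; rewrite subr_gt0.
  by move=> /cz [w [/= wr wz]]; have := N_dist z w a; rewrite (NB z w) wr; lra.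
have : nbhs z [set w | N (w - z) < r - N (z - a)].
  by apply/nbhs_N; exists (r - N (z - a)) => //; rewrite subr_gt0.
by move=> /cz [w [/= wr wz]]; have := N_dist w z a; rewrite wr; lra.
Qed.

(* Caratheodory's form of differentiability: the difference quotient extends
   continuously to a. *)
Definition cdiff f a := exists2 p : C -> C, cont p a & forall z, f z = f a + p z * (z - a).

Lemma cont_off_eq f g a : cont f a -> cont g a -> (forall z, z != a -> f z = g z) -> f a = g a.
Proof.
move=> cf cg fg; apply/eqP; rewrite -subr_eq0 -N_eq0 eq_le N_ge0 andbT.
apply/ler_addgt0Pl => e e0; rewrite addr0; have e2 : 0 < e / 2 by lra.
have [d d0 dH] := cf _ e2; have [d' d'0 dH'] := cg _ e2.
pose b := a + (Num.min d d' / 2)%:C.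
have m0 : 0 < Num.min d d' by rewrite lt_min d0.
have bE : N (b - a) = Num.min d d' / 2 by rewrite /b addrC addKr NC ger0_norm; lra.
have b0 : b != a by rewrite -subr_eq0 -N_gt0 bE; lra.
have m1 : Num.min d d' <= d by rewrite ge_min lexx.
have m2 : Num.min d d' <= d' by rewrite ge_min lexx orbT.
have h1 : N (f b - f a) < e / 2 by apply: dH; rewrite bE; lra.
have h2 : N (g b - g a) < e / 2 by apply: dH'; rewrite bE; lra.
by rewrite (fg b b0) in h1; have := N_dist (f a) (g b) (g a); rewrite (NB (f a) (g b)); lra.
Qed.

Lemma cdiff_quot_inj f p q a : cont p a -> cont q a ->
  (forall z, f z = f a + p z * (z - a)) -> (forall z, f z = f a + q z * (z - a)) -> p =1 q.
Proof.
move=> cp cq pE qE; have off z : z != a -> p z = q z.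
  move=> za; apply: (@mulIf _ (z - a)); first by rewrite subr_eq0.
  by apply: (addrI (f a)); rewrite -pE -qE.
by move=> z; have [->|/off //] := eqVneq z a; exact: cont_off_eq.
Qed.

Lemma cdiff_cont f a : cdiff f a -> cont f a.
Proof.
move=> [p cp fE]; rewrite (_ : f = fun z => f a + p z * (z - a)); last first.
  exact/funext.
apply: contD; first exact: cont_cst.
by apply: contM => //; apply: contB; [exact: cont_id|exact: cont_cst].
Qed.

Lemma cdiff_ext f g a : f =1 g -> cdiff f a -> cdiff g a.
Proof. by move=> /funext ->. Qed.

(** The identity in [cdiff] is required on the whole plane, but off [a] the quotient can always be
    defined by it; differentiability is therefore local. *)
Lemma cdiff_near f g a (d : R) : 0 < d -> (forall z, N (z - a) < d -> f z = g z) ->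
  cdiff f a -> cdiff g a.
Proof.
move=> d0 fg [p cp fE].
exists (fun z => if z == a then p a else (g z - g a) / (z - a)).
  apply: (@cont_near p _ a d) => // z zd; case: eqP => [->//|/eqP za].
  rewrite -!fg ?subrr ?N0 // fE addrAC subrr add0r mulfK // subr_eq0 //.
move=> z; case: eqP => [->|/eqP za]; first by rewrite subrr mulr0 addr0.
by rewrite divfK ?subr_eq0 // addrC subrK.
Qed.

Lemma cdiff_cst (c : C) a : cdiff (fun=> c) a.
Proof. by exists (fun=> 0); [exact: cont_cst|move=> z; rewrite mul0r addr0]. Qed.
Lemma cdiff_id a : cdiff id a.
Proof. by exists (fun=> 1); [exact: cont_cst|move=> z; rewrite mul1r addrC subrK]. Qed.
Lemma cdiffD f g a : cdiff f a -> cdiff g a -> cdiff (fun z => f z + g z) a.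
Proof.
move=> [p cp fE] [q cq gE]; exists (fun z => p z + q z); first exact: contD.
by move=> z; rewrite fE gE; ring.
Qed.
Lemma cdiffM f g a : cdiff f a -> cdiff g a -> cdiff (fun z => f z * g z) a.
Proof.
move=> df dg; have cf := cdiff_cont df; move: df dg => [p cp fE] [q cq gE].
exists (fun z => p z * g a + f z * q z).
  by apply: contD; apply: contM => //; exact: cont_cst.
by move=> z; rewrite gE mulrDr {1}fE; ring.
Qed.
Lemma cdiffN f a : cdiff f a -> cdiff (fun z => - f z) a.
Proof.
by move=> [p cp fE]; exists (fun z => - p z); [exact: contN|move=> z; rewrite fE; ring].
Qed.
Lemma cdiffB f g a : cdiff f a -> cdiff g a -> cdiff (fun z => f z - g z) a.
Proof. by move=> df dg; apply: cdiffD => //; exact: cdiffN. Qed.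
Lemma cdiffX f n a : cdiff f a -> cdiff (fun z => f z ^+ n) a.
Proof.
move=> df; elim: n => [|n IH].
  by apply: cdiff_ext (cdiff_cst 1 a) => z; rewrite expr0.
by apply: cdiff_ext (cdiffM df IH) => z; rewrite exprS.
Qed.
Lemma cdiff_comp f g a : cdiff g a -> cdiff f (g a) -> cdiff (fun z => f (g z)) a.
Proof.
move=> dg; have cg := cdiff_cont dg; case: dg => [q cq gE] [p cp fE].
exists (fun z => p (g z) * q z); first by apply: contM => //; exact: cont_comp.
by move=> z; rewrite fE -mulrA; congr (_ + _ * _); rewrite (gE z); ring.
Qed.
Lemma cdiff_inv a : a != 0 -> cdiff GRing.inv a.
Proof.
move=> a0; apply: (@cdiff_near (fun z => if z == 0 then 0 else z^-1) _ a (N a)).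
- by rewrite N_gt0.
- by move=> z _; case: eqP => // ->; rewrite invr0.
(* At [z = 0], where the function has value 0, the identity forces this value of the quotient. *)
exists (fun z => if z == 0 then a^-1 ^+ 2 else - (z * a)^-1).
  apply: (@cont_near (fun z => - (z * a)^-1) _ a (N a)); first by rewrite N_gt0.
    by move=> z; case: eqP => // ->; rewrite sub0r NN ltxx.
  by apply: contN; apply: contV; rewrite ?mulf_neq0 //; apply: contM; [exact: cont_id|exact: cont_cst].
move=> z; rewrite (negPf a0); case: eqP => [->|/eqP z0]; first by field.
by field; rewrite z0 a0.
Qed.
Lemma cdiffV f a : f a != 0 -> cdiff f a -> cdiff (fun z => (f z)^-1) a.
Proof. by move=> fa df; apply: (cdiff_comp df); exact: cdiff_inv. Qed.
Lemma cdiff_div f g a : g a != 0 -> cdiff f a -> cdiff g a -> cdiff (fun z => f z / g z) a.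
Proof. by move=> ga df dg; apply: cdiffM => //; exact: cdiffV. Qed.

Lemma derivable_cdiff f a : derivable f a 1 -> cdiff f a.
Proof.
move=> df; pose l := lim ((h^-1 *: ((f \o shift a) (h *: 1) - f a) : C) @[h --> (0:C)^']).
exists (fun z => if z == a then l else (f z - f a) / (z - a)); last first.
  move=> z; case: eqP => [->|/eqP za]; first by rewrite subrr mulr0 addr0.
  by rewrite divfK ?subr_eq0 // addrC subrK.
move=> e e0; rewrite eqxx.
have : nbhs l [set w | N (w - l) < e] by apply/nbhs_N; exists e.
move=> /df; rewrite /dnbhs /within /= => /nbhs_N[d d0 dH]; exists d => // z zd.
case: eqP => [_|/eqP za]; first by rewrite subrr N0.
have := dH (z - a); rewrite subr0 => /(_ zd); rewrite subr_eq0 => /(_ za) /=.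
by rewrite /GRing.scale /= mulr1 subrK mulrC.
Qed.
End Basics.

(** * Primitives and integrals over real intervals *)

Section Integral.
Context {R : realType}.
Notation C := R[i].
Implicit Types (f phi psi P : R -> R).

Lemma rd_cont f x (l : R) : is_derive x (1:R) f l -> {for x, continuous f}.
Proof. by move=> fl; apply/differentiable_continuous/derivable1_diffP; exact: ex_derive. Qed.

Lemma rd_within f (df : R -> R) (a b : R) :
  (forall x, x \in `[a, b] -> is_derive x (1:R) f (df x)) -> {within `[a, b], continuous f}.
Proof.
move=> H; apply: continuous_in_subspaceT => x /set_mem xab.
exact: (rd_cont (H x _)).
Qed.

Lemma mvt_le f (df : R -> R) (a b K : R) : a <= b ->
  (forall x, a <= x <= b -> is_derive x (1:R) f (df x)) ->
  (forall x, a <= x <= b -> df x <= K) -> f b - f a <= K * (b - a).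
Proof.
move=> ab dH dK; have H x : x \in `[a, b] -> is_derive x (1:R) f (df x).
  by rewrite in_itv /=; exact: dH.
have cf : {within `[a, b], continuous f} by exact: rd_within H.
have H' x : x \in `]a, b[ -> is_derive x (1:R) f (df x).
  by rewrite in_itv /= => /andP[ax xb]; apply: dH; rewrite !ltW.
have [c cab ->] := MVT_segment ab H' cf.
by rewrite ler_wpM2r ?subr_ge0 //; apply: dK; move: cab; rewrite in_itv.
Qed.

Lemma primitive_right phi (a : R) : continuous phi ->
  exists P, forall x, a < x -> is_derive x (1:R) P (phi x).
Proof.
move=> cphi; exists (fun x => \int[lebesgue_measure]_(t in [set` `[a, x]]) phi t) => x ax.
have xu : x < x + 1 by rewrite ltrDl.
have ci : lebesgue_measure.-integrable `[a, x + 1] (EFin \o phi).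
  apply: continuous_compact_integrable; first exact: segment_compact.
  exact: continuous_subspaceT.
have [d1 d2] := @continuous_FTC1_closed R phi a x (x + 1) xu ci ax (cphi x).
by apply: (DeriveDef d1); rewrite -derive1E; exact: d2.
Qed.

(** The integral from -1 is a primitive to the right of -1 only; reflection yields one to the left
    of 1. Normalised at 0, the two agree on the overlap and are glued at -1/2. *)
Lemma primitive phi : continuous phi -> exists P, forall x, is_derive x (1:R) P (phi x).
Proof.
move=> cphi.
have [P Pd] := @primitive_right phi (-1) cphi.
have cn : continuous (fun x => phi (- x)).
  move=> x; apply: (@continuous_comp _ _ _ -%R phi); last exact: cphi.
  exact: (cvgN cvg_id).
have [Q Qd] := @primitive_right (fun x => phi (- x)) (-1) cn.
have dP (x : R) : -1 < x -> is_derive x (1:R) (fun x => P x - P 0) (phi x).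
  by move=> /Pd h; have := is_deriveB h (is_derive_cst (P 0) x 1); rewrite subr0.
have dQ (x : R) : x < 1 -> is_derive x (1:R) (fun x => - (Q (- x) - Q 0)) (phi x).
  move=> x1; have h : is_derive (- x) (1:R) Q (phi x).
    by have := Qd (- x); rewrite opprK; apply; lra.
  have h1 := is_derive1_comp h (is_deriveNid x (1:R)).
  have := is_deriveN (is_deriveB h1 (is_derive_cst (Q 0) x 1)).
  by rewrite subr0 mulrN1 opprK.
have eqPQ (x : R) : -1 < x < 1 -> P x - P 0 = - (Q (- x) - Q 0).
  move=> /andP[x1 x2]; apply/eqP; rewrite -subr_eq0; apply/eqP.
  pose D y := (P y - P 0) - - (Q (- y) - Q 0).
  have dD (y : R) : -1 < y < 1 -> is_derive y (1:R) D 0.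
    move=> /andP[y1 y2]; have := is_deriveB (dP y y1) (dQ y y2); by rewrite subrr.
  have D0 : D 0 = 0 by rewrite /D !(oppr0, subrr, subr0).
  have dN (y : R) : -1 < y < 1 -> is_derive y (1:R) (fun y => - D y) 0.
    by move=> /dD h; have := is_deriveN h; rewrite oppr0.
  have [x0|x0] := leP 0 x.
    have h1 := @mvt_le D (fun=> 0) 0 x 0 x0.
    have h2 := @mvt_le (fun y => - D y) (fun=> 0) 0 x 0 x0.
    apply/eqP; rewrite eq_le; apply/andP; split.
      have := h1 _ _; rewrite mul0r D0 subr0; apply => // y /andP[y0 yx]; apply: dD; clear -x2 y0 yx; lra.
    have := h2 _ _; rewrite mul0r D0 oppr0 subr0 oppr_le0; apply => // y /andP[y0 yx]; apply: dN; clear -x2 y0 yx; lra.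
  have h1 := @mvt_le D (fun=> 0) x 0 0 (ltW x0).
  have h2 := @mvt_le (fun y => - D y) (fun=> 0) x 0 0 (ltW x0).
  apply/eqP; rewrite eq_le; apply/andP; split.
    have := h2 _ _; rewrite mul0r D0 oppr0 add0r opprK; apply => // y /andP[y0 yx]; apply: dN; clear -x1 y0 yx; lra.
  have := h1 _ _; rewrite mul0r D0 add0r oppr_le0; apply => // y /andP[y0 yx]; apply: dD; clear -x1 y0 yx; lra.
exists (fun x => if -1/2 < x then P x - P 0 else - (Q (- x) - Q 0)) => x.
have [x1|x1] := ltP (-1/2) x.
  apply: near_eq_is_derive (dP x _); rewrite ?oner_neq0 //; last lra.
  near=> y; case: ltP => // y1; exfalso; move: y1; apply/negP; rewrite -ltNge.
  by near: y; exact: lt_nbhsr.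
apply: near_eq_is_derive (dQ x _); rewrite ?oner_neq0 //; last lra.
near=> y; case: ltP => // y1; rewrite eqPQ //; apply/andP; split; first lra.
near: y; apply: lt_nbhsl; lra.
Unshelve. all: by end_near. Qed.

(** With the integral defined as the increment of a primitive, additivity over intervals is an
    identity for endpoints in any order, and bounds come from the mean value theorem. *)
Definition prim phi := xget (fun=> 0) [set P | forall x, is_derive x (1:R) P (phi x)].
Definition intR phi (a b : R) := prim phi b - prim phi a.

Lemma primP phi : continuous phi -> forall x, is_derive x (1:R) (prim phi) (phi x).
Proof. by move=> /primitive[P HP]; rewrite /prim; case: xgetP => // /(_ P) []. Qed.

Lemma intR_le phi (a b K : R) : continuous phi -> a <= b ->
  (forall x, a <= x <= b -> phi x <= K) -> intR phi a b <= K * (b - a).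
Proof. by move=> /primP H ab; apply: mvt_le. Qed.

Lemma intR_unique phi P (a b : R) : continuous phi ->
  (forall x, is_derive x (1:R) P (phi x)) -> intR phi a b = P b - P a.
Proof.
move=> /primP H HP; pose D x := prim phi x - P x.
have d0 x : is_derive x (1:R) D 0.
  by have := is_deriveB (H x) (HP x); rewrite subrr.
by have := is_derive_0_is_cst b a d0; rewrite /intR /D; lra.
Qed.

Lemma intR_lin (k : R) phi psi (a b : R) : continuous phi -> continuous psi ->
  intR (fun x => k * phi x + psi x) a b = k * intR phi a b + intR psi a b.
Proof.
move=> cp cs; have dP x : is_derive x (1:R) (fun x => k * prim phi x + prim psi x) (k * phi x + psi x).
  exact: is_deriveD (is_deriveZ k (primP cp x)) (primP cs x).
have c x : {for x, continuous (fun x => k * phi x + psi x)}.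
  by apply: cvgD; last exact: cs; apply: cvgM; [exact: cvg_cst|exact: cp].
by rewrite (intR_unique _ _ c dP) /intR; ring.
Qed.

Lemma intR_cst (k a b : R) : intR (fun=> k) a b = k * (b - a).
Proof.
have c x : {for x, continuous (fun _ : R => k)} by exact: cvg_cst.
have dP x : is_derive x (1:R) (fun x => k * x) k.
  by have := is_deriveZ k (is_derive_id x (1:R)); rewrite /GRing.scale /= mulr1.
by rewrite (intR_unique _ _ c dP); ring.
Qed.

Lemma intR_chasles phi (a b c : R) : intR phi a c = intR phi a b + intR phi b c.
Proof. by rewrite /intR; ring. Qed.

Definition ccont (phi : R -> C) := forall x (e : R), 0 < e ->
  exists2 d : R, 0 < d & forall y, `|y - x| < d -> N (phi y - phi x) < e.

Lemma ccont_comp f (g : C -> C) (h : R -> C) :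
  ccont h -> (forall z, cont g z) -> ccont (fun x => g (h x)).
Proof. by move=> ch cg x e /(cg (h x))[d d0 dH]; have [r r0 rH] := ch x d d0; exists r => // y /rH /dH. Qed.

Lemma ccontB (g h : R -> C) : ccont h -> ccont g -> ccont (fun x => h x - g x).
Proof.
move=> ch cg x e e0; have e2 : 0 < e / 2 by lra.
have [r r0 rH] := ch x _ e2; have [s s0 sH] := cg x _ e2.
exists (Num.min r s); first by rewrite lt_min r0.
move=> z; rewrite lt_min => /andP[/rH h1 /sH h2].
have -> : h z - g z - (h x - g x) = (h z - h x) + - (g z - g x) by ring.
have := N_triangle (h z - h x) (- (g z - g x)); rewrite NN; lra.
Qed.

Lemma ccont_Re (g : R -> C) : ccont g -> continuous (fun x => Re (g x)).
Proof.
move=> cg x A /nbhs_ballP[e /= e0 eA]; have [d d0 dH] := cg x e e0.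
apply/nbhs_ballP; exists d => //= y; rewrite /ball /= distrC => /dH h; apply: eA.
by rewrite /ball /= distrC -cReN -cReD; apply: le_lt_trans (Re_le _) h.
Qed.
Lemma ccont_Im (g : R -> C) : ccont g -> continuous (fun x => Im (g x)).
Proof.
move=> cg x A /nbhs_ballP[e /= e0 eA]; have [d d0 dH] := cg x e e0.
apply/nbhs_ballP; exists d => //= y; rewrite /ball /= distrC => /dH h; apply: eA.
by rewrite /ball /= distrC -cImN -cImD; apply: le_lt_trans (Im_le _) h.
Qed.

Definition intC (g : R -> C) (a b : R) : C :=
  intR (fun x => Re (g x)) a b +i* intR (fun x => Im (g x)) a b.

Lemma intC_chasles g (a b c : R) : intC g a c = intC g a b + intC g b c.
Proof. by apply: complexP; rewrite ?cReD ?cImD; exact: intR_chasles. Qed.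

Lemma intC_cst (k : C) (a b : R) : intC (fun=> k) a b = k * (b - a)%:C.
Proof.
have kE : k * (b - a)%:C = Re k * (b - a) +i* (Im k * (b - a)).
  by case: k => x y; apply: complexP; rewrite ?cReM ?cImM /=; ring.
by rewrite kE /intC !intR_cst.
Qed.

Lemma intCD (g h : R -> C) (a b : R) : ccont g -> ccont h ->
  intC (fun x => g x + h x) a b = intC g a b + intC h a b.
Proof.
move=> cg ch; apply: complexP; rewrite ?cReD ?cImD /=.
  have := intR_lin 1 a b (ccont_Re cg) (ccont_Re ch); rewrite mul1r => <-.
  by congr (intR _ a b); apply/funext => x; rewrite cReD mul1r.
have := intR_lin 1 a b (ccont_Im cg) (ccont_Im ch); rewrite mul1r => <-.
by congr (intR _ a b); apply/funext => x; rewrite cImD mul1r.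
Qed.

Lemma intR_abs phi (a b K : R) : continuous phi -> a <= b ->
  (forall x, a <= x <= b -> `|phi x| <= K) -> `|intR phi a b| <= K * (b - a).
Proof.
move=> cp ab H; rewrite ler_norml; apply/andP; split; last first.
  by apply: intR_le => // x /H; rewrite ler_norml => /andP[].
have cn : continuous (fun x => -1 * phi x + 0).
  by move=> x; apply: cvgD; [apply: cvgM; [exact: cvg_cst|exact: cp]|exact: cvg_cst].
have := @intR_le (fun x => -1 * phi x + 0) a b K cn ab.
rewrite intR_lin //; last by move=> x; exact: cvg_cst.
rewrite intR_cst mul0r addr0 mulN1r lerNl => h; apply: h => x /H.
by rewrite ler_norml; lra.
Qed.

(** The factor 2 comes from bounding real and imaginary parts separately; Goursat's argument
    tolerates any constant here. *)
Lemma intC_bound g (a b K : R) : ccont g -> a <= b ->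
  (forall x, a <= x <= b -> N (g x) <= K) -> N (intC g a b) <= 2 * K * (b - a).
Proof.
move=> cg ab H; apply: le_trans (N_ReIm _) _ => /=.
have h1 := @intR_abs _ a b K (ccont_Re cg) ab.
have h2 := @intR_abs _ a b K (ccont_Im cg) ab.
have := h1 (fun x hx => le_trans (Re_le _) (H x hx)).
have := h2 (fun x hx => le_trans (Im_le _) (H x hx)); lra.
Qed.
End Integral.

(** * Goursat's lemma on rectangles *)

Section Goursat.
Context {R : realType}.
Notation C := R[i].
Implicit Types (z w a b c : C) (x y p q s t : R) (G f g : C -> C).

Lemma cplx_sub x y s t : (x +i* y) - (s +i* t) = (x - s) +i* (y - t) :> C.
Proof. by []. Qed.

Lemma N_cplx x y : N (x +i* y : C) <= `|x| + `|y|.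
Proof. exact: N_ReIm. Qed.

Lemma ccont_h y : ccont (fun t => t +i* y : C).
Proof.
move=> t e e0; exists e => // s st; rewrite cplx_sub.
by apply: le_lt_trans (N_cplx _ _) _; rewrite subrr normr0 addr0.
Qed.
Lemma ccont_v x : ccont (fun t => x +i* t : C).
Proof.
move=> t e e0; exists e => // s st; rewrite cplx_sub.
by apply: le_lt_trans (N_cplx _ _) _; rewrite subrr normr0 add0r.
Qed.

(** The counterclockwise contour integral along the boundary of the rectangle with lower left corner
    [x +i* y] and sides [p] and [q]; opposite sides are paired under one integral sign. *)
Definition rectI G x y p q : C :=
  intC (fun t => G (t +i* y) - G (t +i* (y + q))) x (x + p) +
  'i * intC (fun t => G ((x + p) +i* t) - G (x +i* t)) y (y + q).

Lemma ccont_hG G y y' : (forall z, cont G z) -> ccont (fun t => G (t +i* y) - G (t +i* y')).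
Proof. by move=> cG; apply: ccontB; apply: ccont_comp => //; exact: ccont_h. Qed.
Lemma ccont_vG G y y' : (forall z, cont G z) -> ccont (fun t => G (y +i* t) - G (y' +i* t)).
Proof. by move=> cG; apply: ccontB; apply: ccont_comp => //; exact: ccont_v. Qed.

Lemma rectI_h G x y p p' q : (forall z, cont G z) ->
  rectI G x y (p + p') q = rectI G x y p q + rectI G (x + p) y p' q.
Proof.
move=> cG; rewrite /rectI addrA (intC_chasles _ x (x + p)).
have -> : (fun t => G ((x + p + p') +i* t) - G (x +i* t)) =
  fun t => (G ((x + p + p') +i* t) - G ((x + p) +i* t)) + (G ((x + p) +i* t) - G (x +i* t)).
  by apply/funext => t; rewrite addrA subrK.
rewrite (intCD y (y + q) (ccont_vG (x + p + p') (x + p) cG) (ccont_vG (x + p) x cG)).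
by rewrite mulrDr; ring.
Qed.

Lemma rectI_v G x y p q q' : (forall z, cont G z) ->
  rectI G x y p (q + q') = rectI G x y p q + rectI G x (y + q) p q'.
Proof.
move=> cG; rewrite /rectI addrA (intC_chasles _ y (y + q)).
have -> : (fun t => G (t +i* y) - G (t +i* (y + q + q'))) =
  fun t => (G (t +i* y) - G (t +i* (y + q))) + (G (t +i* (y + q)) - G (t +i* (y + q + q'))).
  by apply/funext => t; rewrite addrA subrK.
rewrite (intCD x (x + p) (ccont_hG y (y + q) cG) (ccont_hG (y + q) (y + q + q') cG)).
by rewrite mulrDr; ring.
Qed.

Definition rect x y p q : set C := [set z | x <= Re z <= x + p /\ y <= Im z <= y + q].

(** The affine part contributes nothing: its increments between opposite sides are constants, and
    the two resulting terms cancel. Only [g] remains, and it is bounded side by side. *)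
Lemma rectI_affine G g (c d : C) x y p q (e : R) : 0 <= p -> 0 <= q ->
  (forall z, cont g z) -> (forall z, G z = c + d * z + g z) ->
  (forall z, rect x y p q z -> N (g z) <= e) -> N (rectI G x y p q) <= 4 * e * (p + q).
Proof.
move=> p0 q0 cg GE gle.
have -> : rectI G x y p q = rectI g x y p q.
  rewrite /rectI.
  have -> : (fun t => G (t +i* y) - G (t +i* (y + q))) =
    (fun t => d * ('i * (- q)%:C) + (g (t +i* y) - g (t +i* (y + q)))).
    apply/funext => t; rewrite !GE.
    have -> : t +i* (y + q) = (t +i* y) + 'i * q%:C by apply: complexP; rewrite ?cReD ?cImD ?cReM ?cImM /=; ring.
    by rewrite rmorphN /=; ring.
  have -> : (fun t => G ((x + p) +i* t) - G (x +i* t)) =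
    (fun t => d * p%:C + (g ((x + p) +i* t) - g (x +i* t))).
    apply/funext => t; rewrite !GE.
    have -> : (x + p) +i* t = (x +i* t) + p%:C by apply: complexP; rewrite ?cReD ?cImD /=; ring.
    by ring.
  have cc (k : C) : ccont (fun=> k : C) by move=> t r r0; exists 1 => // s _; rewrite subrr N0.
  rewrite (intCD x (x + p) (cc _) (ccont_hG y (y + q) cg)).
  rewrite (intCD y (y + q) (cc _) (ccont_vG (x + p) x cg)).
  by rewrite !intC_cst !(addrC x) !(addrC y) !addrK rmorphN /=; ring.
apply: le_trans (N_triangle _ _) _; rewrite NM Ni mul1r.
have h1 : N (intC (fun t => g (t +i* y) - g (t +i* (y + q))) x (x + p)) <= 2 * (2 * e) * (x + p - x).
  apply: intC_bound; [exact: ccont_hG|by rewrite lerDl|].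
  move=> t /andP[t1 t2]; apply: le_trans (N_triangle _ _) _; rewrite NN.
  have := gle (t +i* y); have := gle (t +i* (y + q)); rewrite /rect /=.
  move=> h1 h2; have {h1} := h1 _; have {h2} := h2 _; rewrite t1 t2 !lexx !lerDl q0 /=.
  by move=> /(_ (conj isT isT)) h2 /(_ (conj isT isT)); lra.
have h2 : N (intC (fun t => g ((x + p) +i* t) - g (x +i* t)) y (y + q)) <= 2 * (2 * e) * (y + q - y).
  apply: intC_bound; [exact: ccont_vG|by rewrite lerDl|].
  move=> t /andP[t1 t2]; apply: le_trans (N_triangle _ _) _; rewrite NN.
  have := gle (x +i* t); have := gle ((x + p) +i* t); rewrite /rect /=.
  move=> h2 h3; have {h2} := h2 _; have {h3} := h3 _; rewrite t1 t2 !lexx !lerDl p0 /=.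
  by move=> /(_ (conj isT isT)) h2 /(_ (conj isT isT)); lra.
lra.
Qed.

Lemma rect_step G x y p q : (forall z, cont G z) ->
  exists r : R * R, [/\ r.1 = x \/ r.1 = x + p / 2, r.2 = y \/ r.2 = y + q / 2 &
    N (rectI G x y p q) <= 4 * N (rectI G r.1 r.2 (p / 2) (q / 2))].
Proof.
move=> cG; apply: contrapT => /forallNP H.
have E : rectI G x y p q = rectI G x y (p / 2) (q / 2) + rectI G x (y + q / 2) (p / 2) (q / 2)
   + (rectI G (x + p / 2) y (p / 2) (q / 2) + rectI G (x + p / 2) (y + q / 2) (p / 2) (q / 2)).
  by rewrite -!rectI_v // -rectI_h //; congr rectI; field.
have K u v : u = x \/ u = x + p / 2 -> v = y \/ v = y + q / 2 ->
    4 * N (rectI G u v (p / 2) (q / 2)) < N (rectI G x y p q).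
  by move=> hu hv; rewrite ltNge; apply/negP => h; apply: (H (u, v)).
have h1 := K _ _ (or_introl erefl) (or_introl erefl).
have h2 := K _ _ (or_introl erefl) (or_intror erefl).
have h3 := K _ _ (or_intror erefl) (or_introl erefl).
have h4 := K _ _ (or_intror erefl) (or_intror erefl).
have := N_triangle (rectI G x y (p / 2) (q / 2) + rectI G x (y + q / 2) (p / 2) (q / 2))
  (rectI G (x + p / 2) y (p / 2) (q / 2) + rectI G (x + p / 2) (y + q / 2) (p / 2) (q / 2)).
have := N_triangle (rectI G x y (p / 2) (q / 2)) (rectI G x (y + q / 2) (p / 2) (q / 2)).
have := N_triangle (rectI G (x + p / 2) y (p / 2) (q / 2)) (rectI G (x + p / 2) (y + q / 2) (p / 2) (q / 2)).
by rewrite -E; lra.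
Qed.

Lemma nested_point (u : nat -> R) p : 0 <= p ->
  (forall n, u n.+1 = u n \/ u n.+1 = u n + p / 2 ^+ n / 2) ->
  exists X, forall n, u n <= X <= u n + p / 2 ^+ n.
Proof.
move=> p0 uS; pose e n := p / 2 ^+ n.
have eS n : e n.+1 = e n / 2 by rewrite /e exprS; field; rewrite expf_eq0 pnatr_eq0 andbF.
have e0 n : 0 <= e n by rewrite divr_ge0 // exprn_ge0.
have st n : u n <= u n.+1 /\ u n.+1 + e n.+1 <= u n + e n.
  by rewrite eS; have := e0 n; case: (uS n) => ->; rewrite -?/(e n); lra.
have mono m n : u m <= u (m + n)%N /\ u (m + n)%N + e (m + n)%N <= u m + e m.
  elim: n => [|n [h1 h2]]; rewrite ?addn0 // addnS.
  by have [] := st (m + n)%N; lra.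
have cross m n : u m <= u n + e n.
  have := e0 (n + m)%N; have [] := mono n m; have [] := mono m n; rewrite addnC; lra.
have ne : range u !=set0 by exists (u 0%N); exists 0%N.
exists (sup (range u)) => n; apply/andP; split.
  apply: sup_upper_bound; last by exists n.
  by split => //; exists (u 0%N + e 0%N) => _ [m _ <-].
by apply: ge_sup => // _ [m _ <-].
Qed.

Theorem goursat G x y p q : 0 < p -> 0 < q -> (forall z, cont G z) ->
  (forall z, rect x y p q z -> cdiff G z) -> rectI G x y p q = 0.
Proof.
move=> p0 q0 cG dG; apply/eqP; rewrite -N_eq0 eq_le N_ge0 andbT.
have /choice[S HS] : forall r : R * R * (R * R), exists r' : R * R,
    [/\ r'.1 = r.1.1 \/ r'.1 = r.1.1 + r.2.1 / 2, r'.2 = r.1.2 \/ r'.2 = r.1.2 + r.2.2 / 2 &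
    N (rectI G r.1.1 r.1.2 r.2.1 r.2.2) <= 4 * N (rectI G r'.1 r'.2 (r.2.1 / 2) (r.2.2 / 2))].
  by move=> r; exact: rect_step.
pose U := fix U n : R * R := if n is m.+1 then S (U m, (p / 2 ^+ m, q / 2 ^+ m)) else (x, y).
have [X HX] : exists X, forall n, (U n).1 <= X <= (U n).1 + p / 2 ^+ n.
  by apply: (nested_point (u := fun n => (U n).1)); [exact: ltW|move=> n; have [] := HS (U n, (p / 2 ^+ n, q / 2 ^+ n))].
have [Y HY] : exists Y, forall n, (U n).2 <= Y <= (U n).2 + q / 2 ^+ n.
  by apply: (nested_point (u := fun n => (U n).2)); [exact: ltW|move=> n; have [] := HS (U n, (p / 2 ^+ n, q / 2 ^+ n))].
have IU n : N (rectI G x y p q) <= 4 ^+ n * N (rectI G (U n).1 (U n).2 (p / 2 ^+ n) (q / 2 ^+ n)).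
  elim: n => [|n IH]; first by rewrite !expr0 !divr1 mul1r.
  have [_ _] := HS (U n, (p / 2 ^+ n, q / 2 ^+ n)) => /= h.
  have eqh (r : R) : r / 2 ^+ n.+1 = r / 2 ^+ n / 2.
    by rewrite exprS; field; rewrite expf_eq0 pnatr_eq0 andbF.
  rewrite !eqh; apply: le_trans IH _; rewrite exprS -mulrA mulrCA ler_wpM2l ?exprn_ge0 //.
have w0 : rect x y p q (X +i* Y).
  by have := HX 0%N; have := HY 0%N; rewrite /= !expr0 !divr1.
have [P cP GE] := dG _ w0.
apply/ler_addgt0Pl => e e0; rewrite addr0.
have pq0 : 0 < p + q by lra.
(* Chosen so that [4 ^+ n] times the bound [4 * e1 * ((p + q) / 2 ^+ n) ^+ 2] on the [n]-th
   rectangle is exactly [e]. *)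
pose e1 := e / (4 * (p + q) ^+ 2).
have e10 : 0 < e1 by rewrite divr_gt0 // mulr_gt0 // exprn_gt0.
have [d d0 dH] := cP _ e10.
have [n hn] : exists n, (p + q) / 2 ^+ n < d.
  have [n hn] : exists n : nat, (p + q) / d < n%:R.
    by exists (Num.truncn ((p + q) / d)).+1; rewrite truncnS_gt.
  exists n; rewrite ltr_pdivrMr ?exprn_gt0 // -ltr_pdivrMl // mulrC.
  by apply: lt_le_trans hn _; rewrite -natrX ler_nat ltnW // ltn_expl.
apply: le_trans (IU n) _.
pose pn := p / 2 ^+ n; pose qn := q / 2 ^+ n; rewrite -/pn -/qn.
have pqn : pn + qn = (p + q) / 2 ^+ n by rewrite mulrDl.
have pn0 : 0 <= pn by rewrite divr_ge0 ?ltW // exprn_gt0.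
have qn0 : 0 <= qn by rewrite divr_ge0 ?ltW // exprn_gt0.
set w := X +i* Y in GE dH cP w0.
have hb : N (rectI G (U n).1 (U n).2 pn qn) <= 4 * (e1 * (pn + qn)) * (pn + qn).
  apply: (@rectI_affine G (fun z => (P z - P w) * (z - w)) (G w - P w * w) (P w)) => //.
  - move=> z; have -> : (fun z => (P z - P w) * (z - w)) = fun z => G z - (G w + P w * (z - w)).
      by apply/funext => v; rewrite (GE v); ring.
    apply: contB => //; apply: contD; first exact: cont_cst.
    by apply: contM; [exact: cont_cst|apply: contB; [exact: cont_id|exact: cont_cst]].
  - by move=> z; rewrite (GE z); ring.
  move=> z [/= z1 z2]; rewrite NM.
  have zw : N (z - w) <= pn + qn.
    apply: le_trans (N_ReIm _) _; rewrite cReD cImD cReN cImN /=.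
    have := HX n; have := HY n; rewrite -/pn -/qn => hy hx.
    by apply: lerD; rewrite ler_norml; clear -hx hy z1 z2; lra.
  apply: ler_pM => //; rewrite ?N_ge0 //; apply/ltW/dH; rewrite (le_lt_trans zw) // pqn //.
have -> : e = 4 ^+ n * (4 * (e1 * (pn + qn)) * (pn + qn)).
  rewrite pqn /e1; have -> : 4 ^+ n = 2 ^+ n * 2 ^+ n :> R by rewrite -exprMn -natrM.
  have : 2 ^+ n != 0 :> R by rewrite expf_neq0 // pnatr_eq0.
  move: (2 ^+ n) => t t0; field; rewrite t0 /=; clear -p0 q0; lra.
by rewrite ler_wpM2l ?exprn_ge0.
Qed.

End Goursat.

(** * Exponential function, mean value property and maximum principle *)

Section MaxPrinciple.
Context {R : realType}.
Notation C := R[i].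
Implicit Types (z w a b c v : C) (x y p q s t : R) (G f g : C -> C) (X B : set C).

Lemma is_derive_eps (f : R -> R) x (l : R) : is_derive x (1:R) f l -> forall e : R, 0 < e ->
  exists2 d : R, 0 < d & forall h, `|h| < d -> `|f (x + h) - f x - l * h| <= e * `|h|.
Proof.
move=> [df dl] e e0.
have : nbhs l (ball l e) by exact: nbhsx_ballx.
rewrite -{1}dl => /df; rewrite /dnbhs /within /= => /nbhs_ballP[d /= d0 dH].
exists d => // h hd; have [->|h0] := eqVneq h 0.
  by rewrite addr0 mulr0 subrr subr0 normr0 mulr0.
have := dH h; rewrite /ball /= sub0r normrN => /(_ hd h0).
rewrite /GRing.scale /= mulr1 (addrC h) => hh.
have -> : f (x + h) - f x - l * h = - (l - h^-1 * (f (x + h) - f x)) * h by field.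
by rewrite normrM normrN ler_wpM2r // ltW.
Qed.

Definition cexp z : C := expR (Re z) * cos (Im z) +i* (expR (Re z) * sin (Im z)).

Lemma cexpD z w : cexp (z + w) = cexp z * cexp w.
Proof.
rewrite /cexp cReD cImD expRD cosD sinD; apply: complexP; rewrite ?cReM ?cImM /=; ring.
Qed.

Lemma N_cexp z : N (cexp z) = expR (Re z).
Proof.
apply/eqP; rewrite -(@eqrXn2 _ 2) ?N_ge0 ?expR_ge0 // Nsq /= !exprMn -mulrDr.
by rewrite cos2Dsin2 mulr1.
Qed.

(** The law [cexpD] transports differentiability from 0 to every point, so the real derivatives of
    the exponential, sine and cosine are combined here only. *)
Lemma cexp_cdiff0 : cdiff cexp 0.
Proof.
have c0 : cexp 0 = 1 by rewrite /cexp /= expR0 cos0 sin0 mulr0 mul1r.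
exists (fun z => if z == 0 then 1 else (cexp z - 1) / z); last first.
  move=> z; rewrite c0 subr0; case: eqP => [->|/eqP z0]; first by rewrite mulr0 addr0 c0.
  by rewrite divfK // addrC subrK.
move=> e e0; rewrite eqxx.
(* The errors in the real and imaginary parts will add up to at most [7 * e1 * N z]. *)
pose e1 := Num.min (e / 20) 1.
have e10 : 0 < e1 by rewrite lt_min; apply/andP; split; lra.
have e11 : e1 <= 1 by rewrite ge_min lexx orbT.
have e1e : e1 <= e / 20 by rewrite ge_min lexx.
have [d1 d10 H1] := is_derive_eps (is_derive_expR (0 : R)) e10.
have [d2 d20 H2] := is_derive_eps (is_derive_cos (0 : R)) e10.
have [d3 d30 H3] := is_derive_eps (is_derive_sin (0 : R)) e10.
exists (Num.min (Num.min d1 d2) (Num.min d3 (e1 / 2))).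
  by rewrite !lt_min d10 d20 d30 /=; lra.
move=> z; rewrite subr0 !lt_min => /andP[/andP[z1 z2] /andP[z3 z4]].
case: eqP => [_|/eqP z0]; first by rewrite subrr N0.
have n0 : 0 < N z by rewrite N_gt0.
have -> : (cexp z - 1) / z - 1 = (cexp z - 1 - z) / z by field.
rewrite NM NV ltr_pdivrMr //.
have xz := Re_le z; have yz := Im_le z.
have := H1 (Re z) (le_lt_trans xz z1); have := H2 (Im z) (le_lt_trans yz z2).
have := H3 (Im z) (le_lt_trans yz z3).
rewrite !add0r expR0 cos0 sin0 oppr0 mul0r !subr0 ?addr0 !mul1r => h3 h2 h1.
apply: le_lt_trans (N_ReIm _) _; rewrite /cexp !cReD !cImD !cReN !cImN /= oppr0 addr0.
move: xz yz h1 h2 h3 z4; set x := Re z; set y := Im z => xz yz h1 h2 h3 z4.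
have E1 : expR x * cos y - 1 - x = (expR x - 1 - x) * cos y + (1 + x) * (cos y - 1) by ring.
have E2 : expR x * sin y - y = expR x * (sin y - y) + (expR x - 1) * y by ring.
have cy : `|cos y| <= 1 by rewrite ler_norml cos_geN1 cos_le1.
have ex : `|expR x - 1| <= 1.
  have -> : expR x - 1 = (expR x - 1 - x) + x by ring.
  apply: le_trans (ler_normD _ _) _; nra.
have ex1 : `|expR x - 1| <= 2 * e1.
  have -> : expR x - 1 = (expR x - 1 - x) + x by ring.
  apply: le_trans (ler_normD _ _) _; nra.
have ex2 : `|expR x| <= 2.
  have -> : expR x = (expR x - 1) + 1 by ring.
  apply: le_trans (ler_normD _ _) _; rewrite normr1; clear -ex; lra.
have x1 : `|1 + x| <= 2.
  apply: le_trans (ler_normD _ _) _; rewrite normr1; clear -e11 xz z4; lra.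
have b1 : `|expR x * cos y - 1 - x| <= 3 * e1 * N z.
  rewrite E1; apply: le_trans (ler_normD _ _) _; rewrite !normrM.
  have := ler_pM (normr_ge0 _) (normr_ge0 _) h1 cy; have := ler_pM (normr_ge0 _) (normr_ge0 _) x1 h2.
  have := ler_wpM2l (ltW e10) xz; have := ler_wpM2l (ltW e10) yz; clear; lra.
have b2 : `|expR x * sin y - y| <= 4 * e1 * N z.
  rewrite E2; apply: le_trans (ler_normD _ _) _; rewrite !normrM.
  have := ler_pM (normr_ge0 _) (normr_ge0 _) ex2 h3; have := ler_pM (normr_ge0 _) (normr_ge0 _) ex1 yz.
  have := ler_wpM2l (ltW e10) xz; have := ler_wpM2l (ltW e10) yz; clear; lra.
have := ler_wpM2r (ltW n0) e1e; have := mulr_gt0 e0 n0; clear -b1 b2; lra.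
Qed.

Lemma cexp_cdiff a : cdiff cexp a.
Proof.
apply: (@cdiff_ext _ (fun z => cexp a * cexp (z - a))).
  by move=> z; rewrite -cexpD addrC subrK.
apply: cdiffM; first exact: cdiff_cst.
apply: (@cdiff_comp _ cexp (fun z => z - a)).
  by apply: cdiffB; [exact: cdiff_id|exact: cdiff_cst].
by rewrite subrr; exact: cexp_cdiff0.
Qed.

Lemma clamp_le s x y : `|Num.min x s - Num.min y s| <= `|x - y|.
Proof. by rewrite ler_norml; have := ler_norm (x - y); have := ler_norm (y - x); rewrite distrC; case: (leP x s); case: (leP y s); lra. Qed.

(* Goursat for w |-> f (a + exp w) on a long rectangle of height 2 pi shows
   that the mean of f over a circle about a is f a.  The real part of w is
   clamped so that the integrand is continuous on the whole plane. *)
Lemma mean_value f a (r rho k : R) : 0 < rho < r -> 0 < k ->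
  (forall z, N (z - a) < r -> cont f z) ->
  (forall z, 0 < N (z - a) < r -> cdiff f z) ->
  ~ (forall v, N v = rho -> Re (f (a + v)) <= Re (f a) - k).
Proof.
move=> /andP[rho0 rhor] k0 cf df H.
pose r1 := (rho + r) / 2; have r10 : 0 < r1 by rewrite /r1; lra.
pose s1 := ln r1; pose s := ln rho.
have ss1 : s < s1 by rewrite ltr_ln ?posrE // /r1; lra.
have es1 : expR s1 = r1 by rewrite lnK ?posrE.
pose cl z : C := Num.min (Re z) s1 +i* Im z.
pose G z := f (a + cexp (cl z)).
have ccl z : cont cl z.
  move=> e e0; exists (e / 2); first by lra.
  move=> w we; rewrite /cl cplx_sub; apply: le_lt_trans (N_cplx _ _) _.
  have := clamp_le s1 (Re w) (Re z); have := Re_le (w - z); have := Im_le (w - z).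
  rewrite cReD cImD cReN cImN; lra.
have ce z : cont cexp z by apply: cdiff_cont; exact: cexp_cdiff.
have Ncl z : N (cexp (cl z)) <= r1.
  by rewrite N_cexp /= -es1 ler_expR ge_min lexx orbT.
have cG z : cont G z.
  apply: (@cont_comp _ f (fun z => a + cexp (cl z))).
    by apply: contD; [exact: cont_cst|exact: cont_comp].
  apply: cf; rewrite addrC addKr; apply: le_lt_trans (Ncl z) _; rewrite /r1; lra.
have dG z : Re z < s1 -> cdiff G z.
  move=> zs; have z0 : 0 < s1 - Re z by lra.
  apply: (@cdiff_near _ (fun z => f (a + cexp z)) _ z _ z0).
    move=> w wz; rewrite /G; congr (f (a + cexp _)); rewrite /cl.
    have := Re_le (w - z); rewrite cReD cReN ler_norml => wz'.
    rewrite min_l; [by case: (w)|lra].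
  apply: (@cdiff_comp _ f (fun z => a + cexp z)).
    by apply: cdiffD; [exact: cdiff_cst|exact: cexp_cdiff].
  apply: df; rewrite addrC addKr N_cexp expR_gt0 /=.
  apply: (@lt_trans _ _ r1); last by rewrite /r1; lra.
  by rewrite -es1 ltr_expR.
have [d d0 dH] : exists2 d : R, 0 < d & forall z, N (z - a) < d -> N (f z - f a) < k / 2.
  apply: cf; first by rewrite subrr N0; lra.
  by lra.
pose s0 := Num.min (s - 1) (ln (d / 2)).
have s0s : s0 < s by rewrite gt_min; apply/orP; left; lra.
have es0 : expR s0 < d.
  apply: (@le_lt_trans _ _ (d / 2)); last lra.
  have d2 : expR (ln (d / 2)) = d / 2 by rewrite lnK // posrE; lra.
  by rewrite -[leRHS]d2 ler_expR ge_min lexx orbT.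
have pi0 := pi_gt0 R.
have pp0 : 0 < pi *+ 2 :> R by rewrite mulr2n; lra.
have I0 : rectI G s0 0 (s - s0) (pi *+ 2) = 0.
  apply: goursat => //; first by lra.
  by move=> z [/andP[_ z1] _]; apply: dG; lra.
(* The horizontal sides cancel by periodicity, so the means of [f] over the circles of radii [rho]
   and [expR s0] agree. On the first the real part is at most [Re (f a) - k], on the second at least
   [Re (f a) - k / 2]. *)
move: I0; rewrite /rectI.
have -> : (fun t => G (t +i* 0) - G (t +i* (0 + pi *+ 2))) = (fun=> 0).
  apply/funext => t; rewrite /G /cl /= add0r /cexp /= cos2pi sin2pi cos0 sin0.
  by rewrite subrr.
rewrite intC_cst mul0r add0r (addrC s0) subrK => /eqP.
rewrite mulf_eq0 => /orP[/eqP [] /eqP|/eqP []]; first by rewrite oner_eq0.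
have cGG : ccont (fun t => G (s +i* t) - G (s0 +i* t)) by exact: ccont_vG.
have := @intR_le _ _ 0 (0 + pi *+ 2) (- (k / 2)) (ccont_Re cGG).
rewrite add0r => hle h0 _; move: hle; rewrite h0 subr0 => /(_ (ltW pp0)) hle.
suff: 0 <= - (k / 2) * pi *+ 2 by rewrite -mulrnAr; nra.
rewrite -mulrnAr; apply: hle => t _; rewrite cReD cReN.
have e1 : expR s = rho by rewrite lnK ?posrE.
have h1 : Re (G (s +i* t)) <= Re (f a) - k.
  apply: H; rewrite N_cexp /= min_l ?ltW //.
have h2 : `|Re (G (s0 +i* t)) - Re (f a)| <= k / 2.
  apply: le_trans (ltW (dH (a + cexp (cl (s0 +i* t))) _)).
    by rewrite -cReN -cReD Re_le.
  rewrite addrC addKr N_cexp /= min_l // ltW //; exact: lt_trans s0s ss1.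
move: h2; rewrite ler_norml; clear -h1; lra.
Qed.

Lemma conj_N z : z * z^*%C = (N z ^+ 2)%:C.
Proof. by rewrite Nsq; case: z => x y; apply: complexP; rewrite ?cReM ?cImM /=; ring. Qed.

Lemma N_conj z : N z^*%C = N z.
Proof. by rewrite /N; case: z => x y /=; rewrite sqrrN. Qed.

Lemma phase z : exists2 l : C, N l = 1 & l * z = (N z)%:C.
Proof.
have [->|z0] := eqVneq z 0.
  by exists 1; rewrite ?N1 // mulr0 N0.
have n0 : 0 < N z by rewrite N_gt0.
have nC : (N z)%:C != 0 :> C by rewrite -N_gt0 NC normr_gt0 gt_eqF.
exists (z^*%C / (N z)%:C).
  by rewrite NM NV N_conj NC ger0_norm ?N_ge0 // divff // gt_eqF.
by rewrite mulrAC (mulrC _ z) conj_N rmorphXn /=; field.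
Qed.

Lemma Nsq_add z w : N (z + w) ^+ 2 = N z ^+ 2 + N w ^+ 2 + 2 * Re (z^*%C * w).
Proof. by rewrite !Nsq cReD cImD; case: z w => [x y] [u v] /=; ring. Qed.

(* Perturbing by eps |z|^2 makes the mean over small circles strictly exceed
   the central value, so an interior maximum is impossible. *)
Theorem max_principle X B f (M : R) : compact X ->
  (forall a, X a -> cont f a) ->
  (forall a, X a -> ~ B a -> exists2 r : R, 0 < r &
     forall z, N (z - a) < r -> X z /\ (z != a -> cdiff f z)) ->
  (forall a, X a -> B a -> N (f a) <= M) ->
  forall a, X a -> N (f a) <= M.
Proof.
move=> cX cf df fB z0 Xz0; rewrite leNgt; apply/negP => Mz0.
have X0 : X !=set0 by exists z0.
have [z1 Xz1 Hz1] := @evt_max _ X (fun z => N z) X0 cX (fun a _ => rcont_N (@cont_id _ a)).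
pose rho := N z1; have [l Nl lz0] := phase (f z0).
have rho0 : 0 <= rho by exact: N_ge0.
pose e := (N (f z0) - M) / (2 * (rho ^+ 2 + 1)).
have r1 : 0 < rho ^+ 2 + 1 by rewrite ltr_wpDl // exprn_ge0.
have e0 : 0 < e by rewrite divr_gt0 ?subr_gt0 // mulr_gt0.
have er : e * rho ^+ 2 < N (f z0) - M.
  have -> : N (f z0) - M = e * rho ^+ 2 + e * (rho ^+ 2 + 2).
    by rewrite /e; field; rewrite gt_eqF.
  by rewrite ltrDl mulr_gt0 // ltr_wpDl // exprn_ge0.
pose q z := Re (l * f z) + e * N z ^+ 2.
have clf z : cont f z -> cont (fun z => l * f z) z by move=> h; apply: contM => //; exact: cont_cst.
have cq a : X a -> rcont q a.
  move=> Xa; have h1 := rcont_Re (clf a (cf a Xa)).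
  have h2 : rcont (fun z => Re (e%:C * (z * z^*%C))) a.
    apply: rcont_Re; apply: contM; first exact: cont_cst.
    apply: contM; first exact: cont_id.
    by move=> d d0; exists d => // z; rewrite -rmorphB N_conj.
  move=> d d0; have d2 : 0 < d / 2 by lra.
  have [r r0 rH] := h1 _ d2; have [s s0 sH] := h2 _ d2.
  exists (Num.min r s); first by rewrite lt_min r0.
  have hE w : Re (e%:C * (w * w^*%C)) = e * N w ^+ 2.
    by rewrite conj_N cReM /= mul0r subr0.
  move=> z; rewrite lt_min => /andP[/rH + /sH]; rewrite /q !hE.
  move: (Re (l * f z)) (Re (l * f a)) (e * N z ^+ 2) (e * N a ^+ 2) => u1 u2 u3 u4.
  rewrite !ltr_norml; clear; lra.
have [a Xa qa] := evt_max X0 cX cq.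
have qz0 : N (f z0) <= q a.
  by apply: le_trans (qa _ Xz0); rewrite /q lz0 /= lerDl mulr_ge0 ?exprn_ge0 ?N_ge0 ?ltW.
have Nlf z : Re (l * f z) <= N (f z).
  by rewrite -[N (f z)]mul1r -Nl -NM; apply: le_trans (ler_norm _) (Re_le _).
have nB : ~ B a.
  move=> Ba; have := fB a Xa Ba; have := Nlf a.
  have := ler_wpM2l (ltW e0) (_ : N a ^+ 2 <= rho ^+ 2).
  rewrite ler_sqr ?nnegrE ?N_ge0 // => /(_ (Hz1 a Xa)).
  by move: qz0 er; rewrite /q; lra.
have [r r0 rH] := df a Xa nB.
(* The cross term of [e * N (a + v) ^+ 2] is the real part of a linear function of [v]. Absorbed
   into the holomorphic function, it leaves a strict loss of [e * N v ^+ 2] on circles about the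
   maximum [a]. *)
pose phi z := l * f z + (2 * e)%:C * (a^*%C * (z - a)).
have dlin z : cdiff (fun z => (2 * e)%:C * (a^*%C * (z - a))) z.
  apply: cdiffM; first exact: cdiff_cst.
  apply: cdiffM; first exact: cdiff_cst.
  by apply: cdiffB; [exact: cdiff_id|exact: cdiff_cst].
have k0 : 0 < e * (r / 2) ^+ 2 by rewrite mulr_gt0 // exprn_gt0 // divr_gt0.
apply: (@mean_value phi a r (r / 2) _ _ k0).
- by apply/andP; split; lra.
- move=> z /rH[Xz _]; apply: contD; first by apply: clf; exact: cf.
  by apply: cdiff_cont; exact: dlin.
- move=> z /andP[z1' /rH[_ h]]; apply: cdiffD; last exact: dlin.
  apply: cdiffM; first exact: cdiff_cst.
  by apply: h; rewrite -subr_eq0 -N_gt0.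
move=> v Nv; have Xv : X (a + v).
  by have [] := rH (a + v); first by rewrite addrC addKr Nv; lra.
have av : a + v - a = v by rewrite addrC addKr.
have := qa _ Xv; rewrite /q /phi Nsq_add Nv av subrr !mulr0 addr0 cReD (cReM (2 * e)%:C) /= mul0r subr0.
move: (Re (a^*%C * v)) => u; lra.
Qed.
End MaxPrinciple.

(** * Removable singularities, Schwarz's lemma and Liouville's theorem *)

Section Holomorphic.
Context {R : realType}.
Notation C := R[i].
Implicit Types (z w a b c v : C) (r e d : R) (f g h : C -> C) (D : set C).

Definition opn D := forall a, D a -> exists2 r, 0 < r & forall z, N (z - a) < r -> D z.
Definition holo D f := forall a, D a -> cdiff f a.
Definition disc a r : set C := [set z | N (z - a) < r].

Lemma opn_disc a r : opn (disc a r).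
Proof.
move=> b; rewrite /disc /= => br; exists (r - N (b - a)); first by rewrite subr_gt0.
move=> z; have := N_dist z b a; lra.
Qed.
Lemma opnT : opn setT.
Proof. by move=> a _; exists 1. Qed.

(** Differentiability on punctured neighbourhoods admits finitely many exceptional points at which
    [f] is merely continuous; the removal of singularities relies on this. *)
Lemma max_disc f a r (M : R) :
  (forall z, N (z - a) <= r -> cont f z) ->
  (forall z, N (z - a) < r -> exists2 d, 0 < d & forall w, N (w - z) < d -> w != z -> cdiff f w) ->
  (forall z, N (z - a) = r -> N (f z) <= M) ->
  forall z, N (z - a) <= r -> N (f z) <= M.
Proof.
move=> cf df fM; apply: (@max_principle R (cdisc a r) [set z | N (z - a) = r]).
- exact: compact_cdisc.
- exact: cf.
- move=> z; rewrite /cdisc /= => zr zne.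
  have {zne}zr' : N (z - a) < r by rewrite lt_neqAle zr andbT; apply/eqP.
  have [d d0 dH] := df z zr'; exists (Num.min d (r - N (z - a))).
    by rewrite lt_min d0 subr_gt0.
  move=> w; rewrite lt_min => /andP[wd wr]; split; last by exact: dH.
  by have := N_dist w z a; lra.
- by move=> z _; exact: fM.
Qed.

Lemma max_disc_holo f a r (M : R) : (forall z, N (z - a) <= r -> cdiff f z) ->
  (forall z, N (z - a) = r -> N (f z) <= M) ->
  forall z, N (z - a) <= r -> N (f z) <= M.
Proof.
move=> df; apply: max_disc => z zr; first exact/cdiff_cont/df.
have [d d0 dH] := @opn_disc a r z zr; exists d => // w wd _; apply: df.
exact/ltW/dH.
Qed.

Lemma compact_bound f a r : (forall z, N (z - a) <= r -> cont f z) ->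
  exists2 M : R, 0 < M & forall z, N (z - a) <= r -> N (f z) <= M.
Proof.
move=> cf; have [r0|r0] := ltP r 0.
  by exists 1 => // z zr; have := N_ge0 (z - a); lra.
have X0 : cdisc a r !=set0 by exists a; rewrite /cdisc /= subrr N0.
have [b br bH] := evt_max X0 (@compact_cdisc _ a r) (fun z hz => rcont_N (cf z hz)).
exists (N (f b) + 1); first by have := N_ge0 (f b); lra.
by move=> z /bH; lra.
Qed.

Lemma avoid z p : exists2 d, 0 < d & forall w, w != z -> N (w - z) < d -> w != p.
Proof.
have [->|zp] := eqVneq p z; first by exists 1.
exists (N (p - z)); first by rewrite N_gt0 subr_eq0.
by move=> w _; apply: contraTneq => ->; rewrite ltxx.
Qed.

Lemma dnbhs_N a (A : set C) :
  dnbhs a A <-> exists2 d, 0 < d & forall z, N (z - a) < d -> z != a -> A z.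
Proof.
split => [/nbhs_N[d d0 H]|[d d0 H]]; first by exists d => // z /H.
by apply/nbhs_N; exists d => // z /H.
Qed.

(** Near [a] the values stay in a compact disc, so they have a cluster point, and the Cauchy
    condition turns it into a limit. *)
Lemma cauchy_limit (k : C -> C) a :
  (forall e, 0 < e -> exists2 d, 0 < d & forall b c, 0 < N (b - a) < d -> 0 < N (c - a) < d ->
     N (k b - k c) <= e) ->
  exists l, forall e, 0 < e -> exists2 d, 0 < d & forall b, 0 < N (b - a) < d -> N (k b - l) <= e.
Proof.
move=> H; have [d1 d10 H1] := H 1 ltr01.
pose b0 := a + (d1 / 2)%:C.
have b0d : 0 < N (b0 - a) < d1.
  by rewrite /b0 addrC addKr NC ger0_norm; lra.
have PF : ProperFilter (k b @[b --> a^']) by exact: fmap_proper_filter.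
have FA : (k b @[b --> a^']) (cdisc (k b0) 1).
  suff: dnbhs a (k @^-1` cdisc (k b0) 1) by [].
  apply/dnbhs_N; exists d1 => // b bd ba.
  by rewrite /cdisc /=; apply: H1 => //; rewrite bd N_gt0 subr_eq0 ba.
have [l [_ cl]] := @compact_cdisc _ (k b0) 1 _ PF FA.
exists l => e e0; have e2 : 0 < e / 2 by lra.
have [d d0 dH] := H _ e2; exists d => // b bd.
have [||l' [/= [c cd ce]]] := cl (k @` [set c | 0 < N (c - a) < d]) (disc l (e / 2)).
- suff: dnbhs a (k @^-1` (k @` [set c | 0 < N (c - a) < d])) by [].
  apply/dnbhs_N; exists d => // c cd ca; exists c => //=.
  by rewrite cd N_gt0 subr_eq0 ca.
- by apply/nbhs_N; exists (e / 2).
rewrite -ce /disc /= => cl'.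
by have := N_dist (k b) (k c) l; have := dH b c bd cd; lra.
Qed.

(** The derivative at [a] is obtained as a limit. The slope [k b] is the value at [a] of the
    difference quotient of [h] based at [b]. The quotients based at [b] and [c] differ by a
    continuous function that is holomorphic off [a], [b], [c]; the maximum principle bounds it at
    [a] by its values on a fixed circle, and these are small when [b] and [c] are close to [a]. *)
Theorem removable h a r : 0 < r -> cont h a ->
  (forall z, 0 < N (z - a) < r -> cdiff h z) -> cdiff h a.
Proof.
move=> r0 ca dh; pose r1 := r / 2.
have r10 : 0 < r1 by rewrite /r1; lra.
have r1r : r1 < r by rewrite /r1; lra.
have ch z : N (z - a) <= r1 -> cont h z.
  move=> zr; have [->//|za] := eqVneq z a; apply/cdiff_cont/dh.
  by rewrite N_gt0 subr_eq0 za; lra.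
have [M M0 hM] := compact_bound ch.
have Q b : 0 < N (b - a) < r1 -> exists2 p : C -> C,
    (forall z, h z = h b + p z * (z - b)) &
    (forall z, N (z - a) <= r1 -> cont p z) /\
    (forall z, N (z - a) <= r1 -> z != a -> z != b -> cdiff p z).
  move=> /andP[b0 br]; have [|p cp hE] := dh b; first by rewrite b0; lra.
  have pE z : z != b -> p z = (h z - h b) / (z - b).
    by move=> zb; rewrite hE addrC addKr mulfK // subr_eq0.
  exists p => //; split => z zr.
    have [->//|zb] := eqVneq z b.
    have zb0 : 0 < N (z - b) by rewrite N_gt0 subr_eq0.
    apply: (@cont_near _ (fun z => (h z - h b) / (z - b)) _ z _ zb0).
      by move=> w wz; rewrite pE //; apply: contraTneq wz => ->; rewrite NB ltxx.
    apply: contM; first by apply: contB; [exact: ch|exact: cont_cst].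
    apply: contV; first by rewrite subr_eq0.
    by apply: contB; [exact: cont_id|exact: cont_cst].
  move=> za zb; have zb0 : 0 < N (z - b) by rewrite N_gt0 subr_eq0.
  apply: (@cdiff_near _ (fun z => (h z - h b) / (z - b)) _ z _ zb0).
    by move=> w wz; rewrite pE //; apply: contraTneq wz => ->; rewrite NB ltxx.
  apply: cdiff_div; first by rewrite subr_eq0.
    apply: cdiffB; last exact: cdiff_cst.
    by apply: dh; rewrite N_gt0 subr_eq0 za; lra.
  by apply: cdiffB; [exact: cdiff_id|exact: cdiff_cst].
pose k z := (h z - h a) / (z - a).
have est b c : 0 < N (b - a) < r1 / 2 -> 0 < N (c - a) < r1 / 2 ->
    N (k b - k c) <= (2 * M * N (b - c) + N (h c - h b) * (2 * r1)) / (r1 / 2) ^+ 2.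
  move=> /andP[b0 br] /andP[c0 cr].
  have [|p pE [cp dp]] := Q b; first by rewrite b0; lra.
  have [|q qE [cq dq]] := Q c; first by rewrite c0; lra.
  have kb : k b = p a.
    have ba : b - a != 0 by rewrite -N_gt0.
    rewrite /k; have := pE a; move: (p a) => u ->; rewrite -opprB; field.
    by rewrite ba.
  have kc : k c = q a.
    have ba : c - a != 0 by rewrite -N_gt0.
    rewrite /k; have := qE a; move: (q a) => u ->; rewrite -opprB; field.
    by rewrite ba.
  rewrite kb kc; apply: (@max_disc (fun z => p z - q z) a r1).
  - by move=> z zr; apply: contB; [exact: cp|exact: cq].
  - move=> z zr; have [d1 d10 H1] := avoid z a; have [d2 d20 H2] := avoid z b.
    have [d3 d30 H3] := avoid z c.
    exists (Num.min (Num.min d1 d2) (Num.min d3 (r1 - N (z - a)))).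
      by rewrite !lt_min d10 d20 d30 subr_gt0.
    move=> w; rewrite !lt_min => /andP[/andP[w1 w2] /andP[w3 w4]] wz.
    have wr : N (w - a) <= r1 by have := N_dist w z a; clear -w4; lra.
    by apply: cdiffB; [apply: dp => //; [exact: H1|exact: H2]|apply: dq => //; [exact: H1|exact: H3]].
  - move=> z zr; have zb : r1 / 2 <= N (z - b) by have := N_dist z b a; lra.
    have zc : r1 / 2 <= N (z - c) by have := N_dist z c a; lra.
    have zb0 : z - b != 0 by rewrite -N_gt0; lra.
    have zc0 : z - c != 0 by rewrite -N_gt0; lra.
    have -> : p z - q z = ((h z - h c) * (b - c) + (h c - h b) * (z - c)) / ((z - b) * (z - c)).
      have -> : p z = (h z - h b) / (z - b) by rewrite (pE z) addrC addKr mulfK.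
      have -> : q z = (h z - h c) / (z - c) by rewrite (qE z) addrC addKr mulfK.
      by field; rewrite zb0 zc0.
    rewrite NM NV NM; apply: ler_pM; rewrite ?N_ge0 ?invr_ge0 ?mulr_ge0 ?N_ge0 //.
      apply: le_trans (N_triangle _ _) _; rewrite !NM; apply: lerD.
        apply: ler_wpM2r; first exact: N_ge0.
        have := N_triangle (h z) (- h c); rewrite NN.
        have := hM z; have := hM c; rewrite zr lexx => h1 /(_ isT) h2; have {h1} := h1 _; clear -cr h2 r10; lra.
      apply: ler_wpM2l; first exact: N_ge0.
      by have := N_dist z a c; rewrite (NB a c); clear -cr r10 zr; lra.
    rewrite lef_pV2 ?posrE ?mulr_gt0 ?N_gt0 // ?exprn_gt0; try lra.
    rewrite expr2; apply: ler_pM => //; clear -r10; lra.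
  by rewrite subrr N0 ltW.
have [e e0|l lH] := @cauchy_limit k a.
  pose e1 := e * (r1 / 2) ^+ 2 / (4 * (M + r1)).
  have e10 : 0 < e1 by rewrite divr_gt0 ?mulr_gt0 ?exprn_gt0 //; clear -M0 r10; lra.
  have e2 : 0 < e1 / 2 by lra.
  have [d d0 dH] := ca _ e2.
  exists (Num.min (Num.min d (e1 / 2)) (r1 / 2)); first by rewrite !lt_min d0 /=; lra.
  move=> b c; rewrite !lt_min => /andP[b0 /andP[/andP[b1 b2] b3]] /andP[c0 /andP[/andP[c1 c2] c3]].
  apply: le_trans (est b c _ _) _; rewrite ?b0 ?c0 //.
  rewrite ler_pdivrMr ?exprn_gt0; try lra.
  have -> : e * (r1 / 2) ^+ 2 = 4 * (M + r1) * e1 by rewrite /e1; field; rewrite gt_eqF //; clear -M0 r10; lra.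
  have bc : N (b - c) <= e1 by have := N_dist b a c; rewrite (NB a c); clear -b2 c2; lra.
  have hbc : N (h c - h b) <= e1.
    by have := N_dist (h c) (h a) (h b); rewrite (NB (h a) (h b)); have := dH b b1; have := dH c c1; clear; lra.
  have := ler_wpM2l (ltW M0) bc; have := ler_wpM2l (ltW r10) hbc; nra.
exists (fun z => if z == a then l else k z).
  move=> e e0; have e2 : 0 < e / 2 by lra.
  have [d d0 dH] := lH _ e2; exists d => // z zd; rewrite eqxx.
  case: eqP => [_|/eqP za]; first by rewrite subrr N0.
  have := dH z; rewrite N_gt0 subr_eq0 za zd => /(_ isT); clear -e0; lra.
move=> z; case: eqP => [->|/eqP za]; first by rewrite subrr mulr0 addr0.
by rewrite divfK ?subr_eq0 // addrC subrK.
Qed.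

(** The difference quotient is continuous at [a] by assumption and holomorphic elsewhere, so
    [removable] applies. Zeros of entire functions are split off in this way, one factor at a
    time. *)
Lemma division D f a : opn D -> holo D f -> D a ->
  exists2 p, holo D p & forall z, f z = f a + p z * (z - a).
Proof.
move=> oD hf Da; have [p cp fE] := hf a Da; exists p => //.
have dp z : D z -> z != a -> cdiff p z.
  move=> Dz za; have za0 : 0 < N (z - a) by rewrite N_gt0 subr_eq0.
  apply: (@cdiff_near _ (fun z => (f z - f a) / (z - a)) _ z _ za0).
    move=> w wz; rewrite (fE w) addrAC subrr add0r mulfK // subr_eq0.
    by apply: contraTneq wz => ->; rewrite NB ltxx.
  apply: cdiff_div; first by rewrite subr_eq0.
    by apply: cdiffB; [exact: hf|exact: cdiff_cst].
  by apply: cdiffB; [exact: cdiff_id|exact: cdiff_cst].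
move=> z Dz; have [->|za] := eqVneq z a; last exact: dp.
have [r r0 rD] := oD a Da; apply: (removable r0 cp) => w /andP[w0 wr].
by apply: dp; [exact: rD|rewrite -subr_eq0 -N_gt0].
Qed.

Lemma schwarz a r f p (M : R) : holo (disc a r) f -> (forall z, disc a r z -> N (f z) <= M) ->
  cont p a -> (forall z, f z = f a + p z * (z - a)) ->
  forall z, disc a r z -> N (p z) <= 2 * M / r.
Proof.
move=> hf fM cp fE z zr; have r0 : 0 < r by have := N_ge0 (z - a); move: zr; rewrite /disc /=; lra.
have aa : disc a r a by rewrite /disc /= subrr N0.
have [q hq qE] := division (@opn_disc a r) hf aa.
have pq := cdiff_quot_inj cp (cdiff_cont (hq a aa)) fE qE.
rewrite pq leNgt; apply/negP => Mq.
have M0 : 0 <= M by apply: le_trans (N_ge0 (f z)) (fM z zr).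
have q0 : 0 < N (q z) by apply: le_lt_trans Mq; rewrite divr_ge0 ?mulr_ge0 // ltW.
(* Instead of letting the radius tend to [r]: if the bound failed at [z], it would already fail for
   the circle of a radius [s] strictly between [t] and [r]. *)
pose t := Num.max (N (z - a)) (2 * M / N (q z)).
have tr : t < r.
  rewrite gt_max; apply/andP; split; first exact: zr.
  by rewrite ltr_pdivrMr // (mulrC r) -ltr_pdivrMr.
pose s := (t + r) / 2.
have s1 : N (z - a) < s.
  have : N (z - a) <= t by rewrite le_max lexx.
  by rewrite /s; lra.
have s2 : 2 * M / N (q z) < s.
  have : 2 * M / N (q z) <= t by rewrite le_max lexx orbT.
  by rewrite /s; lra.
have sr : s < r by rewrite /s; lra.
have s0 : 0 < s by have := N_ge0 (z - a); lra.
have : N (q z) <= 2 * M / s.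
  apply: (@max_disc_holo q a s); last exact: ltW.
    by move=> w ws; apply: hq; rewrite /disc /=; lra.
  move=> w ws; have wa : w - a != 0 by rewrite -N_gt0 ws.
  rewrite -[q w](mulfK wa) NM NV ws; apply: ler_wpM2r; first by rewrite invr_ge0 ltW.
  have -> : q w * (w - a) = f w - f a by rewrite (qE w) addrAC subrr add0r.
  apply: le_trans (N_triangle _ _) _; rewrite NN.
  have h1 := fM w; have h2 := fM a; move: h1 h2; rewrite /disc /= ws subrr N0 => h1 h2.
  have {h1} := h1 sr; have {h2} := h2 r0; lra.
rewrite ltr_pdivrMr // in s2; rewrite ler_pdivlMr // leNgt => /negP; apply.
by rewrite (mulrC (N _)).
Qed.

Lemma schwarz_diff a r f (M : R) : holo (disc a r) f -> (forall z, disc a r z -> N (f z) <= M) ->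
  forall z, disc a r z -> N (f z - f a) <= 2 * M / r * N (z - a).
Proof.
move=> hf fM z zr; have r0 : 0 < r by have := N_ge0 (z - a); move: zr; rewrite /disc /=; lra.
have aa : disc a r a by rewrite /disc /= subrr N0.
have [p cp fE] := hf a aa; rewrite (fE z) addrC addKr NM.
by rewrite ler_wpM2r ?N_ge0 //; exact: (schwarz hf fM cp fE).
Qed.

Lemma holoS (D D' : set C) f : (forall z, D z -> D' z) -> holo D' f -> holo D f.
Proof. by move=> DD h a /DD /h. Qed.

Theorem liouville f (M : R) : holo setT f -> (forall z, N (f z) <= M) -> forall z, f z = f 0.
Proof.
move=> hf fM z; apply/eqP; rewrite -subr_eq0 -N_eq0 eq_le N_ge0 andbT.
apply/ler_addgt0Pl => e e0; rewrite addr0.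
have M0 : 0 <= M := le_trans (N_ge0 _) (fM 0).
pose r := 2 * M * N z / e + N z + 1.
have r1 : N z < r.
  have : 0 <= 2 * M * N z / e by rewrite divr_ge0 ?mulr_ge0 ?N_ge0 // ltW.
  rewrite /r; lra.
have r0 : 0 < r by have := N_ge0 z; lra.
have h : holo (disc 0 r) f by apply: holoS hf.
have := schwarz_diff h (fun z _ => fM z) (_ : disc 0 r z).
rewrite /disc /= !subr0 => /(_ r1) h1; apply: le_trans h1 _.
rewrite mulrAC ler_pdivrMr // /r mulrDr mulrDr mulrCA divff ?gt_eqF // mulr1 mulr1.
by rewrite -addrA lerDl addr_ge0 ?mulr_ge0 ?N_ge0 // ltW.
Qed.
End Holomorphic.

(** * Growth, zeros and openness of entire functions *)

Section Entire.
Context {R : realType}.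
Notation C := R[i].
Implicit Types (z w a b c v : C) (r e d : R) (f g h : C -> C) (D : set C).

Definition ispoly f := exists p : {poly C}, forall z, f z = p.[z].
Notation entireC := (holo (@setT C)).

(** Induction on the exponent: [(f z - f 0) / z] extends to an entire function whose growth exponent
    is one less, and exponent 0 is Liouville's theorem. *)
Lemma growth_poly f (A : R) n : entireC f -> (forall z, N (f z) <= A * (1 + N z) ^+ n) -> ispoly f.
Proof.
elim: n f A => [|n IH] f A ef fA.
  exists (f 0)%:P => z; rewrite hornerC; apply: (@liouville _ f A ef) => w.
  by have := fA w; rewrite expr0 mulr1.
have [p ep pE] := division opnT ef (I : setT (0 : C)).
have A0 : 0 <= A by have := fA 0; rewrite N0 addr0 expr1n mulr1; apply: le_trans; exact: N_ge0.
have f0 := N_ge0 (f 0).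
pose B := 2 * A + N (f 0).
have pB z : 1 <= N z -> N (p z) <= B * (1 + N z) ^+ n.
  move=> z1; have z0 : 0 < N z by lra.
  rewrite -(ler_pM2r z0) -NM.
  have -> : p z * z = f z - f 0 by rewrite (pE z) subr0 addrAC subrr add0r.
  apply: le_trans (N_triangle _ _) _; rewrite NN /B mulrDl mulrDl; apply: lerD.
    apply: le_trans (fA z) _; rewrite exprS.
    have h : 0 <= A * (1 + N z) ^+ n by rewrite mulr_ge0 // exprn_ge0 //; lra.
    nra.
  rewrite -mulrA ler_peMr // mulr_ege1 // exprn_ege1 //; lra.
have {IH} [q qE] : ispoly p.
  apply: (IH p (B * 2 ^+ n)) => // z.
  have [z1|z1] := leP 1 (N z).
    apply: le_trans (pB z z1) _; rewrite ler_wpM2r ?exprn_ge0 //; first by lra.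
    by rewrite ler_peMr ?exprn_ege1 // /B; lra.
  have h : N (p z) <= B * 2 ^+ n.
    apply: (@max_disc_holo _ p 0 1); rewrite ?subr0; [by move=> w _; exact: ep| |exact: ltW].
    by move=> w; rewrite subr0 => w1; have := pB w; rewrite w1 lexx => /(_ isT).
  apply: le_trans h _; rewrite ler_peMr ?exprn_ege1 //; last by have := N_ge0 z; lra.
  by rewrite mulr_ge0 ?exprn_ge0 // /B; lra.
exists ((f 0)%:P + q * 'X) => z.
by rewrite pE subr0 qE !hornerE.
Qed.

Lemma nonpoly_nonconst f (c : C) : ~ ispoly f -> ~ (forall z, f z = c).
Proof. by move=> np H; apply: np; exists c%:P => z; rewrite hornerC. Qed.

(** The entire function [(f z - f 0) / z] is not constant, hence unbounded by Liouville; the maximum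
    principle finds a large value of it on every large circle. *)
Lemma nonpoly_growth f (K : R) : entireC f -> ~ ispoly f ->
  exists2 r0, 0 < r0 & forall r, r0 <= r -> exists2 z, N z = r & K * r <= N (f z).
Proof.
move=> ef np; have [p ep pE] := division opnT ef (I : setT (0 : C)).
pose K' := `|K| + N (f 0) + 1.
have [z1 z1K] : exists z1, K' < N (p z1).
  apply: contrapT => /forallNP H; apply: np.
  have pc : forall z, p z = p 0.
    by apply: (@liouville _ p K' ep) => w; rewrite leNgt; apply/negP; exact: H.
  exists ((f 0)%:P + (p 0)%:P * 'X) => z.
  by rewrite !hornerE pE subr0 (pc z).
exists (Num.max 1 (N z1)); first by rewrite lt_max ltr01.
move=> r; rewrite ge_max => /andP[r1 rz1].
have r0 : 0 < r by lra.
apply: contrapT => /forall2NP H.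
have : N (p z1) <= K'.
  apply: (@max_disc_holo _ p 0 r); rewrite ?subr0 //; first by move=> w _; exact: ep.
  move=> w; rewrite subr0 => wr; have [//|/negP] := H w; rewrite -ltNge => h.
  rewrite -(ler_pM2r r0) -{1}wr -NM.
  have -> : p w * w = f w - f 0 by rewrite (pE w) subr0 addrAC subrr add0r.
  apply: le_trans (N_triangle _ _) _; rewrite NN /K' !mulrDl mul1r.
  have := ler_wpM2l (N_ge0 (f 0)) r1; have := ler_wpM2r (ltW r0) (ler_norm K); lra.
by lra.
Qed.

Lemma N_prod (s : seq C) (F : C -> C) : N (\prod_(a <- s) F a) = \prod_(a <- s) N (F a).
Proof. by elim: s => [|a s IH]; rewrite ?big_nil ?N1 // !big_cons NM IH. Qed.

Lemma prod_ge (s : seq C) z (t : R) : 0 <= t -> (forall a, a \in s -> t <= N (z - a)) ->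
  t ^+ size s <= N (\prod_(a <- s) (z - a)).
Proof.
move=> t0; elim: s => [|a s IH] H; first by rewrite big_nil N1.
rewrite big_cons NM /= exprS; apply: ler_pM; rewrite ?exprn_ge0 //.
  by apply: H; rewrite inE eqxx.
by apply: IH => b bs; apply: H; rewrite inE bs orbT.
Qed.

Lemma prod_le (s : seq C) z (t : R) : 0 <= t -> (forall a, a \in s -> N (z - a) <= t) ->
  N (\prod_(a <- s) (z - a)) <= t ^+ size s.
Proof.
move=> t0; elim: s => [|a s IH] H; first by rewrite big_nil N1.
rewrite big_cons NM /= exprS; apply: ler_pM; rewrite ?N_ge0 //.
  by apply: H; rewrite inE eqxx.
by apply: IH => b bs; apply: H; rewrite inE bs orbT.
Qed.

(** A weak form of Jensen's inequality. Each factor has modulus at least [4 * t] on the circle of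
    radius [5 * t] and at most [2 * t] at [z0], so every zero split off halves the bound on
    [N (f z0)]. *)
Lemma factor_bound f z0 (r : R) : entireC f -> f z0 != 0 ->
  exists n : nat, forall (s : seq C) g, entireC g -> (forall a, a \in s -> N a <= r) ->
    (forall z, f z = (\prod_(a <- s) (z - a)) * g z) -> (size s < n)%N.
Proof.
move=> ef fz0; pose t := N z0 + `|r| + 1.
have t0 : 0 < t by have := N_ge0 z0; have := normr_ge0 r; rewrite /t; lra.
have [M M0 fM] := @compact_bound _ f 0 (5 * t) (fun z _ => cdiff_cont (ef z I)).
have n0 : 0 < N (f z0) by rewrite N_gt0.
exists (Num.truncn (M / N (f z0))).+1 => s g eg sr fE.
have rt : r <= t by have := ler_norm r; have := N_ge0 z0; rewrite /t; lra.
have zt : N z0 <= t by have := normr_ge0 r; rewrite /t; lra.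
have gz : N (g z0) <= M / (4 * t) ^+ size s.
  apply: (@max_disc_holo _ g 0 (5 * t)); rewrite ?subr0; [by move=> z _; exact: eg| |lra].
  move=> z; rewrite subr0 => zr; rewrite ler_pdivlMr ?exprn_gt0 //; last lra.
  have h1 : (4 * t) ^+ size s <= N (\prod_(a <- s) (z - a)).
    apply: prod_ge; first lra.
    by move=> a /sr ar; have := N_sub z a; rewrite zr; lra.
  have := fM z; rewrite subr0 zr lexx fE NM => /(_ isT); apply: le_trans.
  by rewrite mulrC ler_wpM2r ?N_ge0.
have fz : N (f z0) <= (2 * t) ^+ size s * (M / (4 * t) ^+ size s).
  rewrite fE NM; apply: ler_pM; rewrite ?N_ge0 //; apply: prod_le; first lra.
  by move=> a /sr ar; have := N_triangle z0 (- a); rewrite NN; lra.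
have e4 : (4 * t) ^+ size s = 2 ^+ size s * (2 * t) ^+ size s by rewrite -exprMn; congr (_ ^+ _); ring.
have p2 : 0 < 2 ^+ size s :> R by rewrite exprn_gt0.
have pt : 0 < (2 * t) ^+ size s by rewrite exprn_gt0; lra.
have : 2 ^+ size s <= M / N (f z0).
  rewrite ler_pdivlMr // mulrC -ler_pdivlMr //; apply: le_trans fz _.
  rewrite e4 [leLHS](_ : _ = M / 2 ^+ size s) //.
  by field; rewrite !gt_eqF.
move=> h; have : (size s)%:R < M / N (f z0).
  by apply: lt_le_trans h; rewrite -natrX ltr_nat ltn_expl.
by move=> {}h; rewrite -(ltr_nat R); exact: lt_trans h (truncnS_gt _).
Qed.

Lemma extend_factor (s : seq C) f g b : entireC g ->
  (forall z, f z = (\prod_(a <- s) (z - a)) * g z) -> g b = 0 ->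
  exists2 g', entireC g' & forall z, f z = (\prod_(a <- b :: s) (z - a)) * g' z.
Proof.
move=> eg fE gb; have [p ep pE] := division opnT eg (I : setT b).
by exists p => // z; rewrite fE big_cons pE gb; ring.
Qed.

(** Otherwise [f z - f a] has zeros on the circles about [a] of radii [e / 2], [e / 3], and so on.
    Their radii make them distinct, so they can be split off successively, more of them than
    [factor_bound] allows. *)
Lemma isolated f a e : entireC f -> (exists z, f z != f a) -> 0 < e ->
  exists2 rho, 0 < rho < e & forall z, N (z - a) = rho -> f z != f a.
Proof.
move=> ef [z0 fz0] e0; apply: contrapT => /forall2NP H.
pose F z := f z - f a.
have eF : entireC F by move=> z _; apply: cdiffB; [exact: ef|exact: cdiff_cst].
have F0 : F z0 != 0 by rewrite subr_eq0.
have [n nH] := factor_bound (N a + e) eF F0.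
have [s [ss _ sr [g eg fE]]] : exists s : seq C, [/\ size s = n,
    (forall b, b \in s -> e / n.+1%:R <= N (b - a)), (forall b, b \in s -> N b <= N a + e) &
    exists2 g, entireC g & forall z, F z = (\prod_(a <- s) (z - a)) * g z].
  elim: n {nH} => [|n [s [ss sd sr [g eg fE]]]].
    by exists [::]; split => //; exists F => // z; rewrite big_nil mul1r.
  pose rho := e / n.+2%:R.
  have rho0 : 0 < rho by rewrite divr_gt0.
  have rhoe : rho < e / n.+1%:R by rewrite ltr_pM2l // ltf_pV2 ?posrE // ltr_nat.
  have rhoe' : rho < e by rewrite ltr_pdivrMr // ltr_pMr // ltr1n.
  have [/negP|] := H rho; first by rewrite rho0 rhoe'.
  move=> /existsNP [b /not_implyP[br /negP]]; rewrite negbK => /eqP fb.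
  have gb : g b = 0.
    have := fE b; rewrite /F fb subrr => /esym/eqP; rewrite mulf_eq0 => /orP[|/eqP //].
    rewrite -N_eq0 N_prod prodf_seq_eq0 => /hasP[c cs /=].
    rewrite N_eq0 subr_eq0 => /eqP bc; exfalso; by have := sd c cs; rewrite -bc br leNgt rhoe.
  have [g' eg' fE'] := extend_factor eg fE gb.
  exists (b :: s); split => /=; first by rewrite ss.
  - move=> c; rewrite inE => /orP[/eqP ->|/sd]; [by rewrite br|apply: le_trans; exact: ltW rhoe].
  - move=> c; rewrite inE => /orP[/eqP ->|/sr //].
    by have := N_sub b a; rewrite br; lra.
  by exists g'.
by have := nH s g eg sr fE; rewrite ss ltnn.
Qed.

(** On a circle that avoids the level set of [f a], the distance to [f a] has a minimum [m > 0]. If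
    a value [v] within [m / 2] of [f a] were omitted inside, [(f z - v)^-1] would be at most [2 / m]
    on the circle and larger at the centre. *)
Lemma open_mapping f a e : entireC f -> (exists z, f z != f a) -> 0 < e ->
  exists2 eta, 0 < eta & forall v, N (v - f a) < eta -> exists2 z, N (z - a) < e & f z = v.
Proof.
move=> ef nc e0; have [rho /andP[rho0 rhoe] H] := isolated ef nc e0.
have X0 : [set z | N (z - a) = rho] !=set0.
  by exists (a + rho%:C); rewrite /= addrC addKr NC ger0_norm ?ltW.
have cq : forall b, [set z | N (z - a) = rho] b -> rcont (fun z => N ((f z - f a)^-1)) b.
  move=> b br; apply: rcont_N; apply: contV; first by rewrite subr_eq0; exact: H.
  by apply: contB; [exact/cdiff_cont/ef|exact: cont_cst].
have [b br bH] := evt_max X0 (@compact_circle _ a rho) cq; pose m := N (f b - f a).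
have m0 : 0 < m by rewrite N_gt0 subr_eq0; exact: H.
have mH z : N (z - a) = rho -> m <= N (f z - f a).
  move=> zr; have := bH z zr; rewrite !NV lef_pV2 ?posrE // N_gt0 subr_eq0; exact: H.
exists (m / 2); first by lra.
move=> v vm; apply: contrapT => /forall2NP nv.
have nz z : N (z - a) <= rho -> f z - v != 0.
  by move=> zr; rewrite subr_eq0; have [/negP|/eqP //] := nv z; rewrite -leNgt; lra.
have := @max_disc_holo _ (fun z => (f z - v)^-1) a rho (2 / m).
have dz z : cdiff (fun z => f z - v) z by apply: cdiffB; [exact: ef|exact: cdiff_cst].
move=> /(_ _ _ a); rewrite subrr N0 (ltW rho0) => h.
have : N (f a - v)^-1 <= 2 / m.
  apply: h => //; first by move=> z zr; apply: cdiffV; [exact: nz|exact: dz].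
  move=> z zr; rewrite NV -[leRHS]invf_div lef_pV2 ?posrE ?divr_gt0 //; last first.
    by rewrite N_gt0; apply: nz; rewrite zr.
  by have := mH z zr; have := N_dist (f z) v (f a); lra.
rewrite NV -[leRHS]invf_div lef_pV2 ?posrE ?divr_gt0 //; first by rewrite NB; lra.
by rewrite N_gt0; apply: nz; rewrite subrr N0 ltW.
Qed.

(** The zeros lie in a disc, so by [factor_bound] they can be split off completely. The remaining
    factor [g] has no zeros, and its inverse grows polynomially; a polynomial without roots is
    constant. *)
Lemma tends_inf_poly f (r : R) : entireC f -> (forall z, r < N z -> 1 <= N (f z)) -> ispoly f.
Proof.
move=> ef fr; pose z0 : C := (`|r| + 1)%:C.
have z0r : r < N z0 by rewrite NC ger0_norm; have := ler_norm r; have := normr_ge0 r; lra.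
have fz0 : f z0 != 0 by rewrite -N_gt0; have := fr z0 z0r; lra.
have [n nH] := factor_bound r ef fz0.
have [s [sr [g eg fE] gz]] : exists s : seq C, [/\ (forall b, b \in s -> N b <= r),
    (exists2 g, entireC g & forall z, f z = (\prod_(a <- s) (z - a)) * g z) &
    forall g, (forall z, f z = (\prod_(a <- s) (z - a)) * g z) -> entireC g -> forall z, g z != 0].
  apply: contrapT => /forallNP NH.
  have [s [ss sr [g eg fE]]] : exists s : seq C, [/\ size s = n, (forall b, b \in s -> N b <= r) &
    exists2 g, entireC g & forall z, f z = (\prod_(a <- s) (z - a)) * g z].
    elim: n {nH} => [|n [s [ss sr [g eg fE]]]].
      by exists [::]; split => //; exists f => // z; rewrite big_nil mul1r.
    have := NH s => /not_and3P[//|[]|]; first by exists g.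
    move=> /existsNP[g1 /not_implyP[fE1 /not_implyP[eg1 /existsNP[b /negP]]]].
    rewrite negbK => /eqP g1b.
    have [g' eg' fE'] := extend_factor eg1 fE1 g1b.
    exists (b :: s); split; [by rewrite /= ss| |by exists g'].
    move=> c; rewrite inE => /orP[/eqP ->|/sr //]; rewrite leNgt; apply/negP => /fr.
    by rewrite fE1 g1b mulr0 N0; lra.
  by have := nH s g eg sr fE; rewrite ss ltnn.
have {}gz := gz g fE eg.
have eh : entireC (fun z => (g z)^-1) by move=> z _; apply: cdiffV; [exact: gz|exact: eg].
have r0 : 0 < `|r| + 1 by have := normr_ge0 r; lra.
have rr : r < `|r| + 1 by have := ler_norm r; lra.
have h1 z : r < N z -> N (g z)^-1 <= (`|r| + 1 + N z) ^+ size s.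
  move=> zr; have fz := fr z zr; have gp : 0 < N (g z) by rewrite N_gt0.
  apply: (@le_trans _ _ (N (\prod_(a <- s) (z - a)))).
    rewrite NV -div1r ler_pdivrMr // -NM -fE //.
  apply: prod_le; first by have := N_ge0 z; lra.
  by move=> a /sr ar; have := N_triangle z (- a); rewrite NN; lra.
have [q qE] : ispoly (fun z => (g z)^-1).
  apply: (@growth_poly _ ((2 * (`|r| + 1)) ^+ size s) (size s)) => // z.
  rewrite -exprMn; have h2 : (`|r| + 1 + N z) ^+ size s <= (2 * (`|r| + 1) * (1 + N z)) ^+ size s.
    apply: lerXn2r; rewrite ?nnegrE; have := N_ge0 z; have := normr_ge0 r; nra.
  have [zr|zr] := ltP r (N z); first exact: le_trans (h1 z zr) h2.
  apply: (@le_trans _ _ ((2 * (`|r| + 1)) ^+ size s)).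
    apply: (@max_disc_holo _ (fun z => (g z)^-1) 0 (`|r| + 1)).
    - by move=> w _; exact: eh.
    - move=> w; rewrite subr0 => wr; have := h1 w; rewrite wr => /(_ rr); congr (_ <= _ ^+ _); ring.
    - by rewrite subr0; lra.
  apply: lerXn2r; rewrite ?nnegrE; have := N_ge0 z; have := normr_ge0 r; nra.
have sq : size q == 1%N.
  apply/negPn/negP => /closed_rootP[x /rootP]; rewrite -qE => /eqP; rewrite invr_eq0.
  by rewrite (negPf (gz x)).
have [c c0 qc] := size_poly1P _ sq.
exists (c^-1 *: \prod_(a <- s) ('X - a%:P)) => z.
rewrite hornerZ horner_prod fE; have := qE z; rewrite qc hornerC => <-; rewrite invrK mulrC.
by congr (_ * _); apply: eq_bigr => a _; rewrite !hornerE.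
Qed.
End Entire.

(** * Holomorphic roots and their use for functions without zeros *)

Section Roots.
Context {R : realType}.
Notation C := R[i].
Implicit Types (z w a b c u v : C) (r e d t : R) (f g h k : C -> C) (D : set C).

Lemma exp_small (x e : R) : 0 <= x < 1 -> 0 < e -> exists m : nat, x ^+ m <= e.
Proof.
move=> /andP[x0 x1] e0; have x1' : `|x| < 1 by rewrite ger0_norm.
have [m _ /(_ m (leqnn m))] := (@cvgrPdist_le _ _ _ _ _ _ _).1 (cvg_expr x1') e e0.
by rewrite sub0r normrN normrX ger0_norm // => h; exists m.
Qed.

(** Since all values have nonnegative real part, [rt v + rt w] cannot vanish once [Re (rt w) > 0];
    differentiability at such [w] follows by dividing [v - w] by this sum. *)
Definition rt w : C := if 0 <= Re (sqrtc w) then sqrtc w else - sqrtc w.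

Lemma rt_sq w : rt w ^+ 2 = w.
Proof. by rewrite /rt; case: ifP => _; rewrite ?sqrrN sqr_sqrtc. Qed.

Lemma Re_rt w : 0 <= Re (rt w).
Proof. by rewrite /rt; case: ifP => // /negbT; rewrite -ltNge cReN; lra. Qed.

Lemma Re_rt_gt0 w : N (w - 1) < 1 -> 0 < Re (rt w).
Proof.
move=> w1; rewrite lt_def Re_rt andbT; apply/eqP => r0.
have := rt_sq w; rewrite expr2 => /(congr1 (@complex.Re R)); rewrite cReM r0 mul0r sub0r => h.
have := Re_le (w - 1); rewrite cReD cReN /= -h => h1.
have := ler_norm (- (- (Im (rt w) * Im (rt w)) - 1)); rewrite normrN.
have := sqr_ge0 (Im (rt w)); rewrite expr2; lra.
Qed.

Lemma rt_cdiff w : N (w - 1) < 1 -> cdiff rt w.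
Proof.
move=> w1; have p0 := Re_rt_gt0 w1.
have lb v : Re (rt w) <= N (rt v + rt w).
  by apply: le_trans (Re_le _); rewrite cReD ler_normr; apply/orP; left; have := Re_rt v; lra.
have nz v : rt v + rt w != 0 by rewrite -N_gt0; apply: lt_le_trans p0 _.
have eq v : rt v - rt w = (rt v + rt w)^-1 * (v - w).
  have -> : v - w = (rt v - rt w) * (rt v + rt w) by rewrite -subr_sqr !rt_sq.
  by rewrite mulrC mulfK.
have ct : cont rt w.
  move=> e e0; exists (e * Re (rt w)); first exact: mulr_gt0.
  move=> v vw; rewrite eq NM NV mulrC ltr_pdivrMr ?N_gt0 //.
  by apply: lt_le_trans vw _; rewrite ler_wpM2l // ltW.
exists (fun v => (rt v + rt w)^-1); last by move=> v; rewrite -eq addrC subrK.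
apply: contV; first exact: nz.
by apply: contD => //; exact: cont_cst.
Qed.

Lemma cdiff_prod n (F : nat -> C -> C) a : (forall j, (j < n)%N -> cdiff (F j) a) ->
  cdiff (fun z => \prod_(j < n) F j z) a.
Proof.
elim: n => [|n IH] H.
  by apply: (cdiff_ext _ (cdiff_cst 1 a)) => z; rewrite big_ord0.
have h : cdiff (fun z => \prod_(j < n) F j z) a by apply: IH => j /ltnW /H.
by apply: (cdiff_ext _ (cdiffM h (H n (leqnn _)))) => z; rewrite big_ord_recr.
Qed.

(* f(z) is f(a) times the telescoping product of f(z_(j+1)) / f(z_j) along the
   segment; for a fine subdivision every factor is within distance 1 of 1, so
   it has a principal square root. *)
Lemma holo_sqrt a r t f : 0 < t < r -> holo (disc a r) f -> (forall z, disc a r z -> f z != 0) ->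
  exists2 s, holo (disc a t) s & forall z, disc a t z -> s z ^+ 2 = f z.
Proof.
move=> /andP[t0 tr] hf fnz; pose rho := (t + r) / 2.
have [tro rhor] : t < rho /\ rho < r by rewrite /rho; lra.
have [M M0 fM] : exists2 M : R, 0 < M & forall z, N (z - a) <= rho -> N (f z) <= M.
  apply: compact_bound => z zr; apply/cdiff_cont/hf; rewrite /disc /=; lra.
have [K K0 fK] : exists2 K : R, 0 < K & forall z, N (z - a) <= t -> N (f z)^-1 <= K.
  apply: compact_bound => z zr; apply: contV; first by apply: fnz; rewrite /disc /=; lra.
  apply/cdiff_cont/hf; rewrite /disc /=; lra.
pose L := 2 * M / (rho - t).
have L0 : 0 < L by rewrite divr_gt0 ?mulr_gt0 // subr_gt0.
have lip u v : N (u - a) <= t -> N (v - u) < rho - t -> N (f v - f u) <= L * N (v - u).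
  move=> ut vu; apply: (@schwarz_diff R u (rho - t) f M) => //.
    move=> z; rewrite /disc /= => zu; apply: hf; rewrite /disc /=; have := N_dist z u a; lra.
  move=> z; rewrite /disc /= => zu; apply: fM; have := N_dist z u a; lra.
(* The first summand makes each step shorter than [rho - t], so that [lip] applies to it; the second
   brings each quotient of consecutive values within distance 1 of 1. *)
pose x := t / (rho - t) + L * t * K.
have rt0 : 0 < rho - t by rewrite subr_gt0.
have x0 : 0 < x by rewrite /x; apply: addr_gt0; [exact: divr_gt0|exact: mulr_gt0 (mulr_gt0 L0 t0) K0].
pose n := (Num.truncn x).+1.
have xn : x < n%:R by exact: truncnS_gt.
have n0 : 0 < n%:R :> R by rewrite ltr0n.
pose pt (j : nat) z : C := a + (j%:R / n%:R)%:C * (z - a).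
have pt_disc j z : (j <= n)%N -> N (pt j z - a) <= N (z - a).
  move=> jn; rewrite /pt addrC addKr NM NC ger0_norm ?divr_ge0 // ler_piMl ?N_ge0 //.
  by rewrite ler_pdivrMr // mul1r ler_nat.
have ptS j z : N (z - a) < t -> N (pt j.+1 z - pt j z) < t / n%:R.
  move=> zt; have -> : pt j.+1 z - pt j z = (n%:R^-1)%:C * (z - a).
    have jE : (j.+1%:R / n%:R) = j%:R / n%:R + n%:R^-1 :> R.
      by rewrite -natr1 mulrDl mul1r.
    by rewrite /pt jE rmorphD /=; ring.
  by rewrite NM NC ger0_norm ?invr_ge0 ?ltW // mulrC ltr_pM2r // invr_gt0.
pose F j z := f (pt j.+1 z) / f (pt j z).
have fpt j z : (j <= n)%N -> N (z - a) < t -> f (pt j z) != 0.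
  by move=> jn zt; apply: fnz; have := pt_disc j z jn; rewrite /disc /=; lra.
have F1 j z : (j < n)%N -> N (z - a) < t -> N (F j z - 1) < 1.
  move=> jn zt; have fz := fpt j z (ltnW jn) zt.
  have -> : F j z - 1 = (f (pt j.+1 z) - f (pt j z)) / f (pt j z) by rewrite /F; field.
  have zd := pt_disc j z (ltnW jn); have zs := ptS j z zt.
  have s1 : t / n%:R < rho - t.
    rewrite ltr_pdivrMr // mulrC -ltr_pdivrMr; last by rewrite subr_gt0.
    apply: lt_trans xn; rewrite /x ltrDl; exact: mulr_gt0 (mulr_gt0 L0 t0) K0.
  have := lip (pt j z) (pt j.+1 z) (ltW (le_lt_trans zd zt)) (lt_trans zs s1).
  have := fK (pt j z) (ltW (le_lt_trans zd zt)).
  rewrite NM => h1 h2; apply: le_lt_trans (ler_pM (N_ge0 _) (N_ge0 _) h2 h1) _.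
  apply: (@le_lt_trans _ _ (L * (t / n%:R) * K)).
    by rewrite ler_wpM2r ?(ltW K0) // ler_wpM2l ?(ltW L0) // ltW.
  rewrite mulrA mulrAC ltr_pdivrMr // mul1r; apply: lt_trans xn.
  by rewrite /x ltrDr divr_gt0 // subr_gt0.
exists (fun z => rt (f a) * \prod_(j < n) rt (F j z)).
  move=> z zt; apply: cdiffM; first exact: cdiff_cst.
  apply: (@cdiff_prod n (fun j z => rt (F j z))) => j jn.
  apply: (@cdiff_comp _ rt (F j)); last exact/rt_cdiff/F1.
  have dpt i : (i <= n)%N -> cdiff (fun z => f (pt i z)) z.
    move=> ile; apply: (@cdiff_comp _ f (pt i)).
      apply: cdiffD; first exact: cdiff_cst.
      apply: cdiffM; first exact: cdiff_cst.
      by apply: cdiffB; [exact: cdiff_id|exact: cdiff_cst].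
    by apply: hf; have := pt_disc i z ile; move: zt; rewrite /disc /=; lra.
  by apply: cdiff_div; [apply: fpt (ltnW jn) zt|exact: dpt|apply: dpt; exact: ltnW].
move=> z zt; rewrite exprMn rt_sq -prodrXl.
under eq_bigr do rewrite rt_sq.
have tele m : (m <= n)%N -> f a * \prod_(j < m) F j z = f (pt m z).
  elim: m => [|m IH] mn.
    by rewrite big_ord0 mulr1 /pt mul0r mul0r addr0.
  rewrite big_ord_recr /= mulrA IH ?(ltnW mn) // /F mulrC divfK //.
  by apply: fpt => //; exact: ltnW.
by rewrite tele // /pt divff ?mul1r ?gt_eqF // addrC subrK.
Qed.

Lemma holo_root m a r t f : 0 < t < r -> holo (disc a r) f -> (forall z, disc a r z -> f z != 0) ->
  exists2 s, holo (disc a t) s & forall z, disc a t z -> s z ^+ (2 ^ m) = f z.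
Proof.
elim: m r f => [|m IH] r f tr hf fnz.
  exists f => // z zt; apply: hf; move: zt; rewrite /disc /=; lra.
pose rho := (t + r) / 2.
have [|s hs sE] := @holo_sqrt a r rho f _ hf fnz; first by rewrite /rho; lra.
have [||k hk kE] := IH rho s _ hs; [by rewrite /rho; lra| |].
  move=> z zr; apply/negP => /eqP s0; have := sE z zr; rewrite s0 expr0n /= => f0.
  have : f z != 0 by apply: fnz; move: zr; rewrite /disc /rho /=; lra.
  by rewrite -f0 eqxx.
exists k => // z zt; rewrite expnSr exprM kE // sE //.
by move: zt; rewrite /disc /rho /=; lra.
Qed.

(* Extracting a 2^m-th root makes both the central value and, by Schwarz, the
   nearby values bounded by 1/2 before raising to the power 2^m again. *)
Lemma harnack e : 0 < e -> exists2 d, 0 < d & forall a r h, 0 < r -> holo (disc a r) h ->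
  (forall z, disc a r z -> h z != 0) -> (forall z, disc a r z -> N (h z) <= 1) -> N (h a) <= d ->
  forall z, N (z - a) <= r / 16 -> N (h z) <= e.
Proof.
move=> e0; have [m me] : exists m : nat, (1 / 2) ^+ m <= e by apply: exp_small => //; lra.
exists ((1 / 4) ^+ (2 ^ m)); first by rewrite exprn_gt0 //; lra.
move=> a r h r0 hh hnz h1 ha z zr; have p2 : (0 < 2 ^ m)%N by rewrite expn_gt0.
have [|k hk kE] := @holo_root m a r (r / 2) h _ hh hnz; first by lra.
have aa : disc a (r / 2) a by rewrite /disc /= subrr N0; lra.
have k1 w : disc a (r / 2) w -> N (k w) <= 1.
  move=> wr; rewrite -(@expr_le1 _ (2 ^ m)%N) ?N_ge0 // -NX kE //; apply: h1.
  by move: wr; rewrite /disc /=; lra.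
have ka : N (k a) <= 1 / 4.
  have q0 : 0 <= 1 / 4 :> R by lra.
  rewrite -(ler_pXn2r p2) ?nnegrE ?N_ge0 //.
  by rewrite -NX kE.
have zz : disc a (r / 2) z by rewrite /disc /=; lra.
have kz : N (k z) <= 1 / 2.
  have := schwarz_diff hk k1 zz; have := N_sub (k z) (k a).
  have : 2 * 1 / (r / 2) * N (z - a) <= 2 * 1 / (r / 2) * (r / 16).
    by rewrite ler_wpM2l // divr_ge0 //; lra.
  have -> : 2 * 1 / (r / 2) * (r / 16) = 1 / 4 by field; rewrite gt_eqF.
  lra.
rewrite -kE // NX; apply: le_trans me; apply: (@le_trans _ _ ((1 / 2) ^+ (2 ^ m))).
  by apply: lerXn2r => //; rewrite nnegrE ?N_ge0 //; lra.
apply: ler_wiXn2l; [lra|lra|]; exact/ltnW/ltn_expl.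
Qed.

(** For [t] on the unit circle with [Re t >= 0] one has [N (t + 1) >= 4 / 3], so each root taken
    shrinks the distance to 1 by the factor 3/4. The point [u] locates roots of unity near a given
    point, and its powers lead around a circle in short steps. *)
Lemma root_near m v : N v = 1 -> exists u, [/\ u ^+ (2 ^ m) = v, N u = 1 & N (u - 1) <= 2 * (3 / 4) ^+ m].
Proof.
move=> v1; elim: m => [|m [u [uE u1 ud]]].
  by exists v; split => //; have := N_triangle v (- 1); rewrite NN v1 N1; lra.
pose t := rt u; have tt : t ^+ 2 = u by exact: rt_sq.
have t1 : N t = 1.
  by apply/eqP; rewrite -(@eqrXn2 _ 2) ?N_ge0 // expr1n -NX tt u1.
exists t; split => //; first by rewrite expnS exprM tt.
have h : N (t - 1) * N (t + 1) = N (u - 1) by rewrite -NM -tt -{3}(expr1n _ 2) subr_sqr.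
have p1 : 4 / 3 <= N (t + 1).
  have q0 : 0 <= 4 / 3 :> R by lra.
  rewrite -(@ler_pXn2r _ 2) ?nnegrE ?N_ge0 //.
  rewrite Nsq cReD cImD /= addr0; have := Nsq t; rewrite t1 => t2.
  have := Re_rt u; rewrite -/t => t3; nra.
rewrite exprS; have := N_ge0 (t - 1); nra.
Qed.
End Roots.

(** * Chains of discs, derivatives and the spherical derivative *)

Section Schottky.
Context {R : realType}.
Notation C := R[i].
Implicit Types (z w a b c u v : C) (r e d t : R) (f g h k : C -> C) (D : set C).

(** Serves twice: in Landau's theorem to carry closeness to an omitted value from disc to disc, and
    in Schottky's theorem to carry bounds that deteriorate at each step. *)
Lemma chain (c : R) n (S : C -> Prop) (Q : nat -> C -> Prop) :
  (forall z w t, S z -> S w -> 0 <= t <= 1 -> S (z + t%:C * (w - z))) ->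
  (forall j p w, (j < n)%N -> S p -> S w -> N (w - p) <= c -> Q j p -> Q j.+1 w) ->
  forall p w, S p -> S w -> N (w - p) <= n%:R * c -> Q 0%N p -> Q n w.
Proof.
move=> conv step p w Sp Sw; have : (n <= n)%N by [].
elim: {-2}n w Sw => [|m IH] w Sw mn wp Qp.
  have -> : w = p by apply/eqP; rewrite -subr_eq0 -N_eq0 eq_le N_ge0 andbT; move: wp; rewrite mulr0n mul0r.
  exact: Qp.
pose x : R := m%:R / m.+1%:R.
have m0 : 0 < m.+1%:R :> R by rewrite ltr0n.
have x01 : 0 <= x <= 1 by rewrite divr_ge0 // ler_pdivrMr // mul1r ler_nat leqnSn.
have x1 : 1 - x = m.+1%:R^-1 by rewrite /x -natr1; field; rewrite natr1 gt_eqF.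
pose w' := p + x%:C * (w - p).
have Sw' : S w' by exact: conv.
have h1 : N (w - w') <= c.
  have -> : w - w' = (m.+1%:R^-1)%:C * (w - p) by rewrite /w' -x1 rmorphB /=; ring.
  by rewrite NM NC ger0_norm ?invr_ge0 // mulrC ler_pdivrMr // mulrC.
apply: (step m w' w) => //; apply: IH => //; first exact: ltnW.
rewrite /w' addrC addKr NM NC ger0_norm; last by case/andP: x01.
rewrite /x mulrAC ler_pdivrMr // -mulrA (mulrC c) ler_wpM2l //.
Qed.

(** Continuous induction: the supremum of the points where the bound with slope [L + e] holds is
    itself such a point and cannot lie below 1. With [L = 0] this says that a locally constant
    function on a segment takes the same value at both ends. *)
Lemma lip_local (q : R -> R) (L : R) :
  (forall t, 0 <= t <= 1 -> forall e, 0 < e -> exists2 d, 0 < d &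
     forall s, `|s - t| < d -> `|q s - q t| <= (L + e) * `|s - t|) ->
  `|q 1 - q 0| <= L.
Proof.
move=> H; apply/ler_addgt0Pl => e e0; rewrite (addrC e L).
pose S : set R := [set t | 0 <= t <= 1 /\ `|q t - q 0| <= (L + e) * t].
have S0 : S 0 by rewrite /S /= subrr normr0 mulr0 !lexx ler01.
have ubS : has_ubound S by exists 1 => t [/andP[]].
have hs : has_sup S by split => //; exists 0.
pose tau := sup S.
have tau0 : 0 <= tau by exact: sup_upper_bound.
have tau1 : tau <= 1 by apply: ge_sup => [|t [/andP[]]] //; exists 0.
have [|d d0 dH] := H tau _ e e0; first by rewrite tau0.
have [s Ss sd] := sup_adherent d0 hs.
have st : s <= tau by exact: sup_upper_bound.
have St : `|q tau - q 0| <= (L + e) * tau.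
  have [_ hs'] := Ss; have h1 : `|s - tau| < d by rewrite ltr_norml; move: sd; rewrite -/tau; lra.
  have h2 := dH s h1; have := ler_distD (q s) (q tau) (q 0).
  rewrite (distrC (q tau) (q s)); move: h2; rewrite (ler0_norm (_ : s - tau <= 0)); clear -hs' st; lra.
have [t1|t1] := ltP tau 1; last first.
  have E : tau = 1 by lra.
  by move: St; rewrite E mulr1.
pose u := Num.min 1 (tau + d / 2).
have u1 : u <= 1 by rewrite ge_min lexx.
have ut : tau < u by rewrite lt_min t1 ltrDl; lra.
have ud : u <= tau + d / 2 by rewrite ge_min lexx orbT.
have : S u.
  split; first by rewrite u1 andbT; lra.
  have h1 : `|u - tau| < d by rewrite ltr_norml; clear -ud ut; lra.
  have h2 := dH u h1; have := ler_distD (q tau) (q u) (q 0).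
  move: h2; rewrite (ger0_norm (_ : 0 <= u - tau)); clear -St ut; lra.
by move=> /(sup_upper_bound hs); rewrite -/tau leNgt ut.
Qed.

(** The value at [a] of the quotient in [cdiff], which [cdiff_quot_inj] makes unique; 0 where [f] is
    not differentiable. *)
Definition der f a : C := xget 0 [set l | exists2 p : C -> C, cont p a /\ p a = l & forall z, f z = f a + p z * (z - a)].

Lemma derE f p a : cont p a -> (forall z, f z = f a + p z * (z - a)) -> der f a = p a.
Proof.
move=> cp fE; rewrite /der; case: xgetP => [l _ [q [cq <-] qE]|/(_ (p a)) []]; last by exists p.
by rewrite (cdiff_quot_inj cp cq fE qE).
Qed.

Lemma derP f a : cdiff f a -> exists2 p : C -> C, cont p a & p a = der f a /\ forall z, f z = f a + p z * (z - a).
Proof. by move=> [p cp fE]; exists p => //; rewrite (derE cp fE). Qed.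

Lemma derM f g a : cdiff f a -> cdiff g a -> der (fun z => f z * g z) a = der f a * g a + f a * der g a.
Proof.
move=> df dg; have cf := cdiff_cont df.
have [p cp [<- pE]] := derP df; have [q cq [<- qE]] := derP dg.
apply: (@derE _ (fun z => p z * g a + f z * q z)).
  by apply: contD; apply: contM => //; exact: cont_cst.
by move=> z; rewrite qE mulrDr {1}pE; ring.
Qed.

Lemma derV f a : f a != 0 -> cdiff f a -> der (fun z => (f z)^-1) a = - der f a / f a ^+ 2.
Proof.
move=> fa df; have [q cq [qa qE]] := derP (cdiffV fa df).
have [p cp [pa pE]] := derP df.
have cV : cont (fun z => (f z)^-1) a by apply: contV => //; exact: cdiff_cont.
rewrite -pa; rewrite (@derE _ (fun z => if f z == 0 then q z else - p z / (f z * f a))).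
- by rewrite (negPf fa) expr2.
- have fa0 : 0 < N (f a) by rewrite N_gt0.
  have [d d0 dH] := cdiff_cont df fa0.
  apply: (@cont_near _ (fun z => - p z / (f z * f a)) _ a d) => //.
    move=> z /dH; case: eqP => // ->; rewrite sub0r NN ltxx //.
  apply: contM; first exact: contN.
  apply: contV; first by rewrite mulf_neq0.
  by apply: contM; [exact: cdiff_cont|exact: cont_cst].
move=> z; case: eqP => [_|/eqP fz]; first exact: qE.
have : f z - f a = p z * (z - a) by rewrite (pE z) addrAC subrr add0r.
move=> h; have -> : - p z / (f z * f a) * (z - a) = - (f z - f a) / (f z * f a) by rewrite h; ring.
by field; rewrite fz fa.
Qed.

Lemma der_near f g a d : 0 < d -> cdiff f a -> (forall z, N (z - a) < d -> f z = g z) -> der g a = der f a.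
Proof.
move=> d0 df fg; have dg := cdiff_near d0 fg df.
have [p cp [<- pE]] := derP df; have [q cq [<- qE]] := derP dg.
have fga : g a = f a by rewrite fg // subrr N0.
rewrite -(@derE g q a) // (@derE g (fun z => if N (z - a) < d then p z else q z) a).
- by rewrite subrr N0 d0.
- by apply: (cont_near d0 _ cp) => z ->.
move=> z; case: ifP => zd; last exact: qE.
by rewrite fga -fg // pE.
Qed.

Lemma derBc f c a : cdiff f a -> der (fun z => f z - c) a = der f a.
Proof.
move=> /derP[p cp [<- pE]]; apply: derE => // z.
by rewrite pE; ring.
Qed.

Lemma der_bound a r f (M : R) : 0 < r -> holo (disc a r) f -> (forall z, disc a r z -> N (f z) <= M) ->
  N (der f a) <= 2 * M / r.
Proof.
move=> r0 hf fM; have aa : disc a r a by rewrite /disc /= subrr N0.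
have [p cp [<- pE]] := derP (hf a aa).
exact: (schwarz hf fM cp pE aa).
Qed.

(** The spherical derivative, up to a constant factor. Inversion of [f] leaves it unchanged
    ([sphV]), so a value of modulus above 1 can be replaced by its inverse. *)
Definition sph f a : R := N (der f a) / (1 + N (f a) ^+ 2).

Lemma one_sq (x : R) : 0 < 1 + x ^+ 2. Proof. by have := sqr_ge0 x; lra. Qed.

Lemma sph_ge0 f a : 0 <= sph f a.
Proof. by rewrite divr_ge0 ?N_ge0 // ltW // one_sq. Qed.

Lemma sph_near f g a d : 0 < d -> cdiff f a -> (forall z, N (z - a) < d -> f z = g z) -> sph g a = sph f a.
Proof. by move=> d0 df fg; rewrite /sph (der_near d0 df fg) fg // subrr N0. Qed.

(** With [x = N (k a)] the claim amounts to [x * (1 + x ^+ 2) <= 1 + x ^+ 4], and the difference of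
    the two sides is [(1 - x) ^+ 2 * (1 + x + x ^+ 2)]. *)
Lemma sph_sq k a : cdiff k a -> sph (fun z => k z ^+ 2) a <= 2 * sph k a.
Proof.
move=> dk; rewrite /sph.
have -> : (fun z => k z ^+ 2) = fun z => k z * k z by apply/funext => z; rewrite expr2.
rewrite derM // NM; have -> : der k a * k a + k a * der k a = 2%:R * (k a * der k a) by ring.
rewrite !NM; have -> : N (2%:R : C) = 2.
  have -> : (2%:R : C) = (1 + 1 : R)%:C by rewrite rmorphD.
  by rewrite NC ger0_norm.
set x := N (k a); set y := N (der k a).
have x0 : 0 <= x by exact: N_ge0. have y0 : 0 <= y by exact: N_ge0.
rewrite ler_pdivrMr ?one_sq // (mulrA 2 y) mulrAC ler_pdivlMr ?one_sq //.
have h : x * (1 + x ^+ 2) <= 1 + (x * x) ^+ 2.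
  rewrite -subr_ge0; have -> : 1 + (x * x) ^+ 2 - x * (1 + x ^+ 2) = (1 - x) ^+ 2 * (1 + x + x ^+ 2) by ring.
  by rewrite mulr_ge0 ?sqr_ge0 //; have := sqr_ge0 x; lra.
have := ler_wpM2l y0 h; lra.
Qed.

Lemma sph_root m k f a d : 0 < d -> holo (disc a d) k ->
  (forall z, disc a d z -> k z ^+ (2 ^ m) = f z) -> sph f a <= 2 ^+ m * sph k a.
Proof.
move=> d0 hk; have aa : disc a d a by rewrite /disc /= subrr N0.
elim: m f => [|m IH] f kE.
  by rewrite mul1r (sph_near d0 (hk a aa)) // => z /kE; rewrite expr1.
pose g z := k z ^+ (2 ^ m); have := IH g (fun _ _ => erefl).
have dg : cdiff g a by apply: cdiffX; exact: hk.
have fg z : N (z - a) < d -> g z ^+ 2 = f z by move=> /kE <-; rewrite /g -exprM -expnSr.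
rewrite (sph_near d0 _ fg); last exact: cdiffX.
by have := sph_sq dg; rewrite exprS; lra.
Qed.

Lemma sphV k a : k a != 0 -> cdiff k a -> sph (fun z => (k z)^-1) a = sph k a.
Proof.
move=> ka dk; rewrite /sph derV // NM NN !NV NX; have := ka; rewrite -N_gt0.
move: (N (k a)) (N (der k a)) => x y x0; field.
have := one_sq x; have := sqr_ge0 x.
by move=> h1 h2; rewrite !gt_eqF //; nra.
Qed.

(** Up to an affine change, the height of [f z] on the Riemann sphere. A bound on the spherical
    derivative makes it Lipschitz, and it controls [N (f z)] from both sides. *)
Definition qq f z : R := (1 + N (f z) ^+ 2)^-1.

Lemma qq_lip f z w (L : R) : (forall t, 0 <= t <= 1 -> cdiff f (z + t%:C * (w - z)) /\ sph f (z + t%:C * (w - z)) <= L) ->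
  `|qq f w - qq f z| <= 2 * L * N (w - z).
Proof.
move=> H; have [->|wz] := eqVneq w z; first by rewrite !subrr normr0 N0 mulr0.
have n0 : 0 < N (w - z) by rewrite N_gt0 subr_eq0.
pose s t := z + t%:C * (w - z).
have L0 : 0 <= L.
  have [|_] := H 0; first by rewrite lexx ler01.
  by apply: le_trans; exact: sph_ge0.
have := @lip_local (fun t => qq f (s t)) (2 * L * N (w - z)).
have -> : s 1 = w by rewrite /s mul1r addrC subrK.
have -> : s 0 = z by rewrite /s mul0r addr0.
apply => t t01 e e0; have [df fL] := H t t01.
have [p cp [pE fE]] := derP df.
pose e1 := e / (2 * N (w - z)).
have e10 : 0 < e1 by rewrite divr_gt0 // mulr_gt0.
have e1E : 2 * e1 * N (w - z) = e by rewrite /e1; field; rewrite gt_eqF.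
have [d d0 dH] := cp _ e10.
set b := N (f (s t)).
have b0 : 0 <= b by exact: N_ge0.
(* For [a = N (f u) >= b / 2] one gets [a + b <= 3 * a <= 2 * (1 + a ^+ 2)], which cancels the
   factor [1 + a ^+ 2] in the denominator of the increment. *)
have [d' d'0 dH'] : exists2 d', 0 < d' & forall u, N (u - s t) < d' -> b / 2 <= N (f u).
  have [b1|b1] := ltP 0 b.
    have b2 : 0 < b / 2 by lra.
    have [d' d'0 dH'] := cdiff_cont df b2; exists d' => // u /dH'.
    by have := N_sub (f (s t)) (f u); rewrite (NB (f u)) -/(s t) -/b; lra.
  by exists 1 => // u _; have := N_ge0 (f u); lra.
exists (Num.min d d' / N (w - z)); first by rewrite divr_gt0 // lt_min d0.
move=> x; rewrite ltr_pdivlMr // => xt.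
have sN : N (s x - s t) = `|x - t| * N (w - z).
  have -> : s x - s t = (x - t)%:C * (w - z) by rewrite /s rmorphB /=; ring.
  by rewrite NM NC.
move: xt; rewrite -sN lt_min => /andP[xd xd'].
have := dH _ xd; have := dH' _ xd'; rewrite -/(s t) in fE fL pE.
have := fE (s x); set u := s x; rewrite -/(s t); set a := N (f u) => fu ba pu.
have pN : N (p u) <= N (der f (s t)) + e1.
  have := N_sub (p u) (p (s t)); rewrite pE -/(s t); move: pu; rewrite pE -/(s t); clear; lra.
have fd : N (f u - f (s t)) = N (p u) * N (u - s t).
  by rewrite fu addrAC subrr add0r NM.
have ab : `|b - a| <= N (p u) * N (u - s t).
  rewrite -fd ler_norml; have := N_sub (f u) (f (s t)); have := N_sub (f (s t)) (f u).
  by rewrite (NB (f (s t))) -/a -/b; clear; lra.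
have a0 : 0 <= a by exact: N_ge0.
have pa := one_sq a; have pb := one_sq b.
rewrite /qq -/a -/b.
have -> : (1 + a ^+ 2)^-1 - (1 + b ^+ 2)^-1 = (b - a) * (a + b) / ((1 + a ^+ 2) * (1 + b ^+ 2)).
  by field; rewrite !gt_eqF.
rewrite !normrM normfV (ger0_norm (_ : 0 <= a + b)); last (clear -b0 ba; lra).
rewrite (ger0_norm (_ : 0 <= _ * _)); last by rewrite mulr_ge0 // ltW.
rewrite ler_pdivrMr ?mulr_gt0 //.
have abs : a + b <= 2 * (1 + a ^+ 2) by have := sqr_ge0 (a - 3 / 4); nra.
set y := N (u - s t) in sN fd ab *.
have y0 : 0 <= y by exact: N_ge0.
have P0 := N_ge0 (p u).
apply: (@le_trans _ _ (N (p u) * y * (2 * (1 + a ^+ 2)))).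
  by apply: ler_pM => //; clear -b0 ba; lra.
have -> : (2 * L * N (w - z) + e) * `|x - t| = 2 * (L + e1) * y.
  by rewrite sN -{1}e1E; ring.
have sL : N (der f (s t)) <= L * (1 + b ^+ 2) by move: fL; rewrite /sph ler_pdivrMr.
have pL : N (p u) <= (L + e1) * (1 + b ^+ 2).
  apply: le_trans pN _; rewrite mulrDl; apply: lerD => //.
  by rewrite ler_peMr ?(ltW e10) //; have := sqr_ge0 b; clear; lra.
have -> : 2 * (L + e1) * y * ((1 + a ^+ 2) * (1 + b ^+ 2)) = ((L + e1) * (1 + b ^+ 2)) * (y * (2 * (1 + a ^+ 2))) by ring.
by rewrite -mulrA ler_wpM2r // mulr_ge0 // mulr_ge0 // ltW.
Qed.
End Schottky.

(** * Landau's theorem in rescaled form *)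

Section Landau.
Context {R : realType}.
Notation C := R[i].
Implicit Types (z w a b c u v : C) (r e d t : R) (f g h k : C -> C) (D : set C).

Lemma ivt_seg (q : C -> R) z w (v : R) :
  (forall t, 0 <= t <= 1 -> rcont q (z + t%:C * (w - z))) -> q z <= v <= q w ->
  exists2 t, 0 <= t <= 1 & q (z + t%:C * (w - z)) = v.
Proof.
move=> H /andP[v1 v2]; pose g t := q (z + t%:C * (w - z)).
have cg : {within `[0, 1], continuous g}.
  apply: continuous_in_subspaceT => t /set_mem; rewrite /= in_itv /= => t01.
  move=> A /nbhs_ballP[e /= e0 eA]; have [d d0 dH] := H t t01 e e0.
  have n0 : 0 < N (w - z) + 1 by have := N_ge0 (w - z); lra.
  apply/nbhs_ballP; exists (d / (N (w - z) + 1)); first by rewrite /= divr_gt0.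
  move=> s; rewrite /ball /= distrC ltr_pdivlMr // => st; apply: eA.
  rewrite /ball /= distrC; apply: dH.
  have -> : z + s%:C * (w - z) - (z + t%:C * (w - z)) = (s - t)%:C * (w - z).
    by rewrite rmorphB /=; ring.
  rewrite NM NC; apply: le_lt_trans st; rewrite ler_wpM2l //; lra.
have g0 : g 0 = q z by rewrite /g mul0r addr0.
have g1 : g 1 = q w by rewrite /g mul1r addrC subrK.
have [|t] := @IVT R g 0 1 v ler01 cg.
  by rewrite g0 g1 ge_min v1 le_max v2 orbT.
by rewrite in_itv /= => t01 gt; exists t.
Qed.

Lemma disc_conv a r z w t : disc a r z -> disc a r w -> 0 <= t <= 1 -> disc a r (z + t%:C * (w - z)).
Proof.
rewrite /disc /= => zr wr /andP[t0 t1].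
have -> : z + t%:C * (w - z) - a = (1 - t)%:C * (z - a) + t%:C * (w - a).
  by rewrite rmorphB /=; ring.
apply: le_lt_trans (N_triangle _ _) _; rewrite !NM !NC !ger0_norm //; last lra.
have [t2|t2] := ltP 0 t.
  have := ler_wpM2l (_ : 0 <= 1 - t) (ltW zr); rewrite subr_ge0 => /(_ t1).
  have : t * N (w - a) < t * r by rewrite ltr_pM2l.
  lra.
have -> : t = 0 by lra.
lra.
Qed.

(** On the disc of radius [1 / (64 * s)] the function [qq k] varies by at most 1/8, so
    [N (k p) <= 5 / 4] implies [N (k u) <= 2] there. Hence [k - w], divided by 3, is bounded by 1
    and without zeros, as [harnack] demands. *)
Lemma landau_chain_step e : 0 < e -> exists2 d, 0 < d & forall p (s : R) k w, 0 < s ->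
  holo (disc p (1 / (64 * s))) k -> (forall z, disc p (1 / (64 * s)) z -> sph k z <= 4 * s) ->
  N w = 1 -> (forall z, disc p (1 / (64 * s)) z -> k z != w) -> N (k p - w) <= d ->
  forall z, N (z - p) <= 1 / (64 * 16 * s) -> N (k z - w) <= e.
Proof.
move=> e0; have e3 : 0 < e / 3 by lra.
have [d d0 dH] := harnack e3.
exists (Num.min (1 / 4) (3 * d)); first by rewrite lt_min; apply/andP; split; lra.
move=> p s k w s0 hk sk w1 kw; rewrite le_min => /andP[kp1 kp2] z zp.
have r0 : 0 < 1 / (64 * s) by rewrite divr_gt0 // mulr_gt0.
have pp : disc p (1 / (64 * s)) p by rewrite /disc /= subrr N0.
have kp : N (k p) <= 5 / 4 by have := N_sub (k p) w; lra.
have kb u : disc p (1 / (64 * s)) u -> N (k u) <= 2.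
  move=> ur; have seg t : 0 <= t <= 1 -> cdiff k (p + t%:C * (u - p)) /\ sph k (p + t%:C * (u - p)) <= 4 * s.
    by move=> /(disc_conv pp ur) h; split; [exact: hk|exact: sk].
  have := qq_lip seg.
  have h1 : 2 * (4 * s) * N (u - p) <= 1 / 8.
    have h2 : N (u - p) <= 1 / (64 * s) by exact: ltW.
    apply: (@le_trans _ _ (2 * (4 * s) * (1 / (64 * s)))); first by rewrite ler_wpM2l //; clear -s0; lra.
    have -> : 2 * (4 * s) * (1 / (64 * s)) = 1 / 8 by field; rewrite gt_eqF.
    exact: lexx.
  rewrite /qq ler_norml => /andP[h2 _].
  have h3 : 16 / 41 <= (1 + N (k p) ^+ 2)^-1.
    have -> : 16 / 41 = (41 / 16 : R)^-1 by field.
    rewrite lef_pV2 ?posrE ?one_sq //; have := N_ge0 (k p); nra.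
  have h4 : 1 / 4 <= (1 + N (k u) ^+ 2)^-1 by clear -h1 h2 h3; lra.
  have := h4; rewrite div1r lef_pV2 ?posrE ?one_sq // => h5.
  have := N_ge0 (k u); nra.
have h3C u : N ((k u - w) / 3%:C) = N (k u - w) / 3 by rewrite NM NV NC ger0_norm.
have c3 : 3%:C != 0 :> C by rewrite -N_gt0 NC normr_gt0.
have : N ((k z - w) / 3%:C) <= e / 3.
  apply: (dH p (1 / (64 * s)) (fun u => (k u - w) / 3%:C) r0).
  - move=> u ur; apply: cdiffM; last exact: cdiff_cst.
    by apply: cdiffB; [exact: hk|exact: cdiff_cst].
  - by move=> u ur; rewrite mulf_neq0 ?invr_eq0 // subr_eq0; exact: kw.
  - by move=> u ur; rewrite h3C; have := kb u ur; have := N_triangle (k u) (- w); rewrite NN; clear -w1; lra.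
  - by rewrite h3C; lra.
  by have -> : 1 / (64 * s) / 16 = 1 / (64 * 16 * s) by field; rewrite gt_eqF.
by rewrite h3C; clear; lra.
Qed.

(* Some point where |k| = 1 lies near b, and there k is close to an omitted
   2^m-th root of unity w.  Harnack, along a chain of discs back to b, keeps
   k - w small, against sph k b = s. *)
Lemma landau_core : exists m : nat, forall b (s : R) k, 0 < s -> holo (disc b (4 / s)) k ->
  (forall z, disc b (4 / s) z -> sph k z <= 4 * s) -> sph k b = s -> N (k b) <= 1 ->
  (forall z, disc b (4 / s) z -> k z ^+ (2 ^ m) != 1) -> False.
Proof.
pose K : R := 64 * 16.
have /choice[Dl DlH] : forall e : R, exists d, 0 < e -> 0 < d /\ forall p (s : R) k w, 0 < s ->
  holo (disc p (1 / (64 * s))) k -> (forall z, disc p (1 / (64 * s)) z -> sph k z <= 4 * s) ->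
  N w = 1 -> (forall z, disc p (1 / (64 * s)) z -> k z != w) -> N (k p - w) <= d ->
  forall z, N (z - p) <= 1 / (64 * 16 * s) -> N (k z - w) <= e.
  move=> e; have [e0|] := ltP 0 e; last by exists 0.
  by have [d d0 dH] := landau_chain_step e0; exists d.
(* With steps of length [1 / (K * s)], [J] of them cover the distance [3 / s + 1 / (K * s)]. The
   final closeness [e0] below is such that the derivative of [k] at [b] comes out as at most
   [s / 2]. *)
pose J := (Num.truncn (3 * K + 1)).+1.
have KJ : 3 * K + 1 < J%:R by exact: truncnS_gt.
pose e0 : R := 1 / (4 * K).
have K0 : 0 < K by rewrite /K; lra.
have e00 : 0 < e0 by rewrite /e0 divr_gt0 // mulr_gt0.
have itp n : 0 < iter n Dl e0 by elim: n => // n IH /=; exact: (DlH _ IH).1.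
(* The roots of unity of order [2 ^ m] are to be as dense as [J] steps of [landau_chain_step],
   followed backwards from [e0], require. *)
have [m mH] : exists m : nat, (3 / 4) ^+ m <= iter J Dl e0 / 2.
  by apply: exp_small; [lra|have := itp J; lra].
exists m => b s k s0 hk sk sb kb1 km.
have s4 : 0 < 4 / s by rewrite divr_gt0.
have bb : disc b (4 / s) b by rewrite /disc /= subrr N0.
have db : s <= N (der k b).
  rewrite -sb /sph ler_pdivrMr ?one_sq // ler_peMr ?N_ge0 //; have := sqr_ge0 (N (k b)); lra.
have s3 : 0 < 3 / s by rewrite divr_gt0.
have s34 : 3 / s < 4 / s by rewrite ltr_pM2r ?invr_gt0 //; lra.
(* Otherwise [k] is bounded by 1 on the disc of radius [3 / s], and its derivative at [b] is at most
   [2 / 3 * s], against [db]. *)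
have [z1 z1r kz1] : exists2 z, disc b (3 / s) z & 1 <= N (k z).
  apply: contrapT => /forall2NP H.
  have h : holo (disc b (3 / s)) k by move=> z zr; apply: hk; move: zr; rewrite /disc /=; lra.
  have := der_bound s3 h (M := 1).
  have -> : 2 * 1 / (3 / s) = 2 / 3 * s by field; rewrite gt_eqF.
  move=> /(_ _) hh; have : N (der k b) <= 2 / 3 * s.
    by apply: hh => z zr; have [//|/negP] := H z; rewrite -ltNge => /ltW.
  clear -db s0; lra.
have [t t01 kt] : exists2 t, 0 <= t <= 1 & N (k (b + t%:C * (z1 - b))) = 1.
  apply: (ivt_seg (q := fun z => N (k z))); last by rewrite kb1 kz1.
  move=> t t01; apply: rcont_N; apply: cdiff_cont; apply: hk; apply: disc_conv => //.
  by move: z1r; rewrite /disc /=; clear -s4; lra.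
set z0 := b + _ in kt.
have b3 : disc b (3 / s) b by rewrite /disc /= subrr N0.
have z0r : disc b (3 / s) z0 by exact: disc_conv.
have kzm : N (k z0 ^+ (2 ^ m)) = 1 by rewrite NX kt expr1n.
have [u [uE u1 ud]] := root_near m kzm.
have u0 : u != 0 by rewrite -N_gt0 u1.
pose w := k z0 / u.
have w1 : N w = 1 by rewrite NM NV kt u1 invr1 mulr1.
have wm : w ^+ (2 ^ m) = 1.
  by rewrite exprMn exprVn uE divff // expf_neq0 // -N_gt0 kt.
have kw : N (k z0 - w) <= iter J Dl e0.
  have -> : k z0 - w = w * (u - 1) by rewrite /w; field.
  by rewrite NM w1 mul1r; clear -mH ud; lra.
have c0 : 0 < 1 / (K * s) by rewrite divr_gt0 // mulr_gt0.
have cs : 1 / (K * s) < 3 / s.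
  rewrite ltr_pdivlMr // [ltLHS](_ : _ = K^-1); last by field; rewrite !gt_eqF.
  by rewrite invf_plt ?posrE // /K; clear; lra.
have knear z : N (z - b) < 1 / (K * s) -> N (k z - w) <= e0.
  move=> zb; have zr : disc b (3 / s) z by rewrite /disc /=; clear -cs zb; lra.
  pose Q j z := N (k z - w) <= iter (J - j) Dl e0.
  have : Q J z; last by rewrite /Q subnn.
  apply: (@chain R (1 / (K * s)) J (disc b (3 / s)) Q _ _ z0 z) => //.
  - by move=> x y t' hx hy ht; exact: disc_conv.
  - move=> j p v jJ pr vr vp; rewrite /Q -(subnSK jJ) iterS => kp.
    have ej : 0 < iter (J - j.+1) Dl e0 by exact: itp.
    have sub : forall x, disc p (1 / (64 * s)) x -> disc b (4 / s) x.
      move=> x; rewrite /disc /= => xp.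
      have : 1 / (64 * s) <= 1 / s.
        by rewrite !div1r lef_pV2 ?posrE ?mulr_gt0 //; clear -s0; lra.
      have := N_dist x p b; move: pr; rewrite /disc /=.
      have -> : 4 / s = 3 / s + 1 / s by rewrite -mulrDl; congr (_ / _); ring.
      clear -xp; lra.
    have [_ /(_ p s k w s0)] := DlH _ ej; apply => //.
    + by move=> x /sub; exact: hk.
    + by move=> x /sub; exact: sk.
    + by move=> x /sub /km; apply: contraNneq => ->; rewrite wm.
  - have h1 : N (z - z0) <= 3 / s + 1 / (K * s).
      by have := N_dist z b z0; rewrite (NB b); move: z0r; rewrite /disc /=; clear -zb; lra.
    apply: le_trans h1 _.
    have -> : 3 / s + 1 / (K * s) = (3 * K + 1) * (1 / (K * s)) by field; rewrite !gt_eqF.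
    by rewrite ler_wpM2r // ltW.
have hkw : holo (disc b (1 / (K * s))) (fun z => k z - w).
  move=> z zr; apply: cdiffB; last exact: cdiff_cst.
  by apply: hk; move: zr; rewrite /disc /=; clear -cs s4; lra.
have := der_bound c0 hkw knear.
rewrite derBc; last exact: hk.
have -> : 2 * e0 / (1 / (K * s)) = s / 2 by rewrite /e0; field; rewrite !gt_eqF.
clear -db s0; lra.
Qed.

End Landau.

(** * Theorems of Landau, Schottky and Picard; growth of iterates *)

Section Picard.
Context {R : realType}.
Notation C := R[i].
Implicit Types (z w a b c u v : C) (r e d t : R) (f g h k : C -> C) (D : set C).
Notation entireC := (holo (@setT C)).

Lemma landau : exists2 L : R, 1 <= L & forall a r f, 0 < r -> holo (disc a r) f ->
  (forall z, disc a r z -> f z != 0 /\ f z != 1) -> r * sph f a <= L.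
Proof.
have [m core] := @landau_core R.
have p2 : 1 <= 2 ^+ m :> R by rewrite exprn_ege1 //; lra.
(* The factor [2 ^+ m] pays for the root. The remaining 64 gives [la a > 16] and [d * s > 8] below,
   so that the disc of radius [4 / s] about [b] has at most half the radius available there. *)
exists (64 * 2 ^+ m); first by lra.
move=> a r f r0 hf f01; rewrite leNgt; apply/negP => big.
have [|k hk kE] := @holo_root R m a r (r / 2) f _ hf (fun z hz => (f01 z hz).1); first by lra.
have sk := sph_root (_ : 0 < r / 2) hk kE.
have {}sk : sph f a <= 2 ^+ m * sph k a by apply: sk; lra.
have ska : 64 < r * sph k a.
  have : 64 * 2 ^+ m < r * (2 ^+ m * sph k a) by apply: lt_le_trans big _; rewrite ler_wpM2l // ltW.
  by rewrite mulrCA mulrC ltr_pM2l //; lra.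
pose rho := r / 4.
have rho0 : 0 < rho by rewrite /rho; lra.
have [M M0 kM] : exists2 M : R, 0 < M & forall z, N (z - a) <= 3 * r / 8 -> N (k z) <= M.
  by apply: compact_bound => z zr; apply/cdiff_cont/hk; rewrite /disc /=; lra.
(* Zalcman's rescaling: at a near maximum b of la, sph k is at most 4 times
   its central value on a disc of radius 4 / sph k b. *)
pose la z := (rho - N (z - a)) * sph k z.
have laM z : disc a rho z -> la z <= rho * (2 * M / (r / 8)).
  move=> zr; have r8 : 0 < r / 8 by lra.
  have sM : sph k z <= 2 * M / (r / 8).
    apply: le_trans (_ : N (der k z) <= _).
      rewrite /sph ler_pdivrMr ?one_sq // ler_peMr ?N_ge0 //; have := sqr_ge0 (N (k z)); lra.
    apply: der_bound => // w; rewrite /disc /= => wz.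
      by apply: hk; have := N_dist w z a; move: zr; rewrite /disc /= /rho; lra.
    by apply: kM; have := N_dist w z a; move: zr; rewrite /disc /= /rho; lra.
  apply: ler_pM => //; last by have := N_ge0 (z - a); lra.
    by move: zr; rewrite /disc /=; lra.
  exact: sph_ge0.
pose S := la @` disc a rho.
have aa : disc a rho a by rewrite /disc /= subrr N0.
have hs : has_sup S.
  split; first by exists (la a); exists a.
  by exists (rho * (2 * M / (r / 8))) => _ [z zr <-]; exact: laM.
have laa : la a = rho * sph k a by rewrite /la subrr N0 subr0.
have lab : 16 < la a by rewrite laa /rho; lra.
have supa : la a <= sup S by apply: sup_upper_bound => //; exists a.
have sup0 : 0 < sup S / 2 by move: lab supa; set x := sup S; lra.
have [_ [b br <-] lb] := sup_adherent sup0 hs.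
have ls z : disc a rho z -> la z < 2 * la b.
  move=> zr; have : la z <= sup S by apply: sup_upper_bound => //; exists z.
  move: lb; set x := sup S; clear; lra.
pose d := rho - N (b - a); pose s := sph k b.
have d0 : 0 < d by move: br; rewrite /d /disc /=; clear; lra.
have lE : la b = d * s by [].
have lb8 : 8 < d * s by rewrite -lE; move: lb supa lab; set x := sup S; clear; lra.
have s0 : 0 < s by rewrite -(pmulr_rgt0 _ d0); clear -lE lab lb supa; lra.
have sd : 4 / s <= d / 2 by rewrite ler_pdivrMr //; clear -lE lab lb supa; lra.
have sub z : disc b (4 / s) z -> N (z - b) < d / 2 by rewrite /disc /=; clear -sd; lra.
have subr z : disc b (4 / s) z -> disc a rho z.
  by move=> /sub zb; have := N_dist z b a; move: d0 zb; rewrite /disc /= /d; clear; lra.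
have subr2 z : disc b (4 / s) z -> disc a (r / 2) z.
  by move=> /subr; rewrite /disc /= /rho; clear -r0; lra.
have subr1 z : disc b (4 / s) z -> disc a r z.
  by move=> /subr; rewrite /disc /= /rho; clear -r0; lra.
have hkb : holo (disc b (4 / s)) k by move=> z /subr2; exact: hk.
have skb z : disc b (4 / s) z -> sph k z <= 4 * s.
  move=> zr; have := ls z (subr z zr); rewrite lE /la => h1.
  have h2 : d / 2 <= rho - N (z - a) by have := sub z zr; have := N_dist z b a; rewrite /d; clear; lra.
  have h3 : d / 2 * sph k z <= (rho - N (z - a)) * sph k z by rewrite ler_wpM2r ?sph_ge0.
  have : d / 2 * sph k z <= d / 2 * (4 * s) by clear -h1 h3; lra.
  by rewrite ler_pM2l //; clear -d0; lra.
have k0 z : disc b (4 / s) z -> k z != 0.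
  move=> zr; have [f0 _] := f01 z (subr1 z zr); apply: contraNneq f0 => k0.
  by rewrite -kE ?k0 ?expr0n ?expn_eq0 //; exact: subr2.
have k1 z : disc b (4 / s) z -> k z ^+ (2 ^ m) != 1.
  by move=> zr; have [_ f1] := f01 z (subr1 z zr); rewrite kE //; exact: subr2.
have bb : disc b (4 / s) b by rewrite /disc /= subrr N0 divr_gt0.
have [kb|kb] := leP (N (k b)) 1; first exact: (core b s k).
apply: (core b s (fun z => (k z)^-1)) => //.
- by move=> z zr; apply: cdiffV; [exact: k0|exact: hkb].
- by move=> z zr; rewrite sphV; [exact: skb|exact: k0|exact: hkb].
- by rewrite sphV; [|exact: k0|exact: hkb].
- by rewrite NV invf_le1 ?N_gt0 ?k0 // ltW.
- by move=> z zr; rewrite exprVn invr_eq1; exact: k1.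
Qed.

(** The bound on [N (f z)] grows by [Psi] along a chain of discs. At a point [w] with [N (f w) > 1],
    Landau's bound keeps [N (f u) >= 1 / 2] nearby, so the inverse of [2 f] is bounded by 1 and has
    no zeros. If [f w] were too large, [harnack] would make this inverse so small at the previous
    point [p] that the bound known for [f p] fails. *)
Lemma schottky01 (B : R) : exists Q : R, forall a r f, 0 < r -> holo (disc a r) f ->
  (forall z, disc a r z -> f z != 0 /\ f z != 1) -> N (f a) <= B ->
  forall z, N (z - a) <= r / 2 -> N (f z) <= Q.
Proof.
have [L L1 landauH] := landau.
(* On a disc of radius [x * r] where the spherical derivative is at most [4 * L / r], [qq f] differs
   from its central value by at most 1/4. *)
pose x := (32 * L)^-1.
have x0 : 0 < x by rewrite invr_gt0; lra.
have xL : 32 * L * x = 1 by rewrite /x mulfV // gt_eqF //; lra.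
have x1 : x <= 1 / 32 by nra.
have /choice[Dl DlH] : forall e : R, exists d, 0 < e -> 0 < d /\ forall a r h, 0 < r -> holo (disc a r) h ->
  (forall z, disc a r z -> h z != 0) -> (forall z, disc a r z -> N (h z) <= 1) -> N (h a) <= d ->
  forall z, N (z - a) <= r / 16 -> N (h z) <= e.
  move=> e; have [e0|] := ltP 0 e; last by exists 0.
  by have [d d0 dH] := harnack e0; exists d.
pose Psi (b : R) := Num.max 1 (2 * Dl (1 / (4 * Num.max b 1)))^-1.
pose n := (Num.truncn (8 / x)).+1.
have nx : 1 / 2 < n%:R * (x / 16).
  have : 8 / x < n%:R by exact: truncnS_gt.
  by rewrite ltr_pdivrMr //; lra.
exists (iter n Psi B) => a r f r0 hf f01 fa z za.
pose Q j z := N (f z) <= iter j Psi B.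
suff : Q n z by [].
apply: (@chain R (x * r / 16) n (fun z => N (z - a) <= r / 2) Q _ _ a z) => //.
- move=> u v t ua va /andP[t0 t1].
  have -> : u + t%:C * (v - u) - a = (1 - t)%:C * (u - a) + t%:C * (v - a).
    by rewrite rmorphB /=; ring.
  apply: le_trans (N_triangle _ _) _; rewrite !NM !NC !ger0_norm //; last lra.
  have := ler_wpM2l t0 va; have := ler_wpM2l (_ : 0 <= 1 - t) ua; rewrite subr_ge0 => /(_ t1); clear; lra.
- move=> j p w _ pa wa wp; rewrite /Q /= => fp; set b := iter j Psi B in fp *.
  rewrite /Psi le_max; have [//|f1] := leP (N (f w)) 1; apply/orP; right.
  pose b1 := Num.max b 1.
  have b11 : 1 <= b1 by rewrite le_max lexx orbT.
  have bb1 : b <= b1 by rewrite le_max lexx.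
  have e0 : 0 < 1 / (4 * b1) by rewrite divr_gt0 //; clear -b11; lra.
  have [d0 dH] := DlH _ e0; rewrite -/b1; set d := Dl _ in d0 dH *.
  have xr0 : 0 < x * r by exact: mulr_gt0.
  have xr : x * r <= r / 32 by have := ler_wpM2r (ltW r0) x1; clear; lra.
  have ww : disc w (x * r) w by rewrite /disc /= subrr N0.
  have inr u : disc w (x * r) u -> disc a r u.
    by rewrite /disc /= => uw; have := N_dist u w a; clear -r0 uw wa xr; lra.
  have sphL u : disc w (x * r) u -> sph f u <= 4 * L / r.
    move=> uw; have r4 : 0 < r / 4 by (clear -r0; lra).
    have sub v : disc u (r / 4) v -> disc a r v.
      by move: uw; rewrite /disc /= => uw vu; have := N_dist v u a; have := N_dist u w a; clear -r0 uw vu wa xr; lra.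
    have := landauH u (r / 4) f r4 (holoS sub hf) (fun v hv => f01 v (sub v hv)).
    by rewrite ler_pdivlMr //; clear; lra.
  have lip u : disc w (x * r) u -> 1 / 2 <= N (f u).
    move=> uw; have seg t : 0 <= t <= 1 -> cdiff f (w + t%:C * (u - w)) /\ sph f (w + t%:C * (u - w)) <= 4 * L / r.
      by move=> /(disc_conv ww uw) h; split; [exact/hf/inr|exact: sphL].
    have := qq_lip seg.
    have h1 : 2 * (4 * L / r) * N (u - w) <= 1 / 4.
      have h2 : N (u - w) <= x * r by exact: ltW.
      apply: (@le_trans _ _ (2 * (4 * L / r) * (x * r))).
        by rewrite ler_wpM2l // mulr_ge0 // divr_ge0 //; clear -L1 r0; lra.
      have -> : 2 * (4 * L / r) * (x * r) = 32 * L * x / 4 by field; rewrite gt_eqF.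
      by rewrite xL.
    rewrite /qq ler_norml => /andP[_ h2].
    have h3 : (1 + N (f w) ^+ 2)^-1 <= 1 / 2.
      by rewrite div1r lef_pV2 ?posrE ?one_sq //; nra.
    have h4 : (1 + N (f u) ^+ 2)^-1 <= (4 / 3)^-1 by rewrite invf_div; clear -h1 h2 h3; lra.
    have q43 : 0 < 4 / 3 :> R by clear; lra.
    move: h4; rewrite lef_pV2 ?posrE ?one_sq //.
    have := N_ge0 (f u); nra.
  rewrite leNgt; apply/negP => hbig.
  have Nh u : N ((2 : R)%:C * f u)^-1 = (2 * N (f u))^-1 by rewrite NV NM NC ger0_norm.
  have nz u : disc w (x * r) u -> (2 : R)%:C * f u != 0.
    by move=> uw; rewrite mulf_neq0 //; [rewrite -N_gt0 NC normr_gt0|exact: (f01 u (inr u uw)).1].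
  have fwd : (N (f w))^-1 <= 2 * d.
    rewrite -(invrK (2 * d)) lef_pV2 ?posrE ?invr_gt0 ?mulr_gt0 //; [exact: ltW|(clear -f1; lra)].
  have : N ((2 : R)%:C * f p)^-1 <= 1 / (4 * b1).
    apply: (dH w (x * r) (fun u => ((2 : R)%:C * f u)^-1) xr0).
    - move=> u uw; apply: cdiffV; first exact: nz.
      by apply: cdiffM; [exact: cdiff_cst|exact/hf/inr].
    - by move=> u uw; rewrite invr_eq0; exact: nz.
    - move=> u uw; rewrite Nh invf_le1; have := lip u uw; clear; lra.
    - rewrite Nh invfM; clear -fwd; lra.
    - by rewrite NB; clear -wp; lra.
  have pp : disc w (x * r) p by rewrite /disc /= NB; clear -wp xr0; lra.
  have fp2 := lip p pp.
  rewrite Nh div1r lef_pV2 ?posrE; [|(clear -b11 fp2; lra)|(clear -b11 fp2; lra)].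
  by clear -b11 bb1 fp; lra.
- by rewrite subrr N0; clear -r0; lra.
- apply: le_trans za _.
  have -> : n%:R * (x * r / 16) = n%:R * (x / 16) * r by ring.
  by have := ler_wpM2r (ltW r0) (ltW nx); lra.
Qed.

Theorem schottky v w (B : R) : v != w -> exists Q : R, forall a r f, 0 < r -> holo (disc a r) f ->
  (forall z, disc a r z -> f z != v /\ f z != w) -> N (f a) <= B ->
  forall z, N (z - a) <= r / 2 -> N (f z) <= Q.
Proof.
move=> vw; have wv0 : 0 < N (w - v) by rewrite N_gt0 subr_eq0 eq_sym.
have wv : w - v != 0 by rewrite -N_gt0.
have [Q QH] := schottky01 ((B + N v) / N (w - v)).
exists (Q * N (w - v) + N v) => a r f r0 hf fvw fa z za.
have := QH a r (fun z => (f z - v) / (w - v)) r0.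
move=> H; have : N ((f z - v) / (w - v)) <= Q.
  apply: H => //.
  - move=> u ur; apply: cdiffM; last exact: cdiff_cst.
    by apply: cdiffB; [exact: hf|exact: cdiff_cst].
  - move=> u ur; have [f1 f2] := fvw u ur; split; first by rewrite mulf_neq0 ?invr_eq0 // subr_eq0.
    by rewrite -subr_eq0 -[X in _ - X](divff wv) -mulrBl mulf_neq0 ?invr_eq0 // opprB addrA subrK subr_eq0.
  - by rewrite NM NV ler_pM2r ?invr_gt0 //; have := N_triangle (f a) (- v); rewrite NN; lra.
rewrite NM NV ler_pdivrMr //; have := N_sub (f z) v; lra.
Qed.

Theorem little_picard f v w : entireC f -> v != w -> (forall z, f z != v /\ f z != w) ->
  forall z, f z = f 0.
Proof.
move=> ef vw fvw; have [Q QH] := schottky (N (f 0)) vw.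
apply: (liouville (M := Q)) => // z.
apply: (QH 0 (2 * N z + 1) f) => //; first by have := N_ge0 z; lra.
  by apply: holoS ef.
by rewrite subr0; lra.
Qed.

(* Polya: if two values of moduli s and 2s were omitted on |z| < r, Schottky
   would bound f on |z| <= r/2 by a multiple of s. *)
Lemma covers_circle f : entireC f -> ~ ispoly f -> exists2 r0, 0 < r0 & forall r, r0 <= r ->
  exists2 s, 2 * r <= s & forall w, N w = s -> exists2 z, N z < r & f z = w.
Proof.
move=> ef np; have [Q QH] := @schottky01 2.
(* Growth on the circle of radius [r / 2] provides the value [K * (r / 2)], which exceeds the bound
   that Schottky will give, 2r plus 6r times the modulus of [Q]. *)
pose K := 2 * (2 + 6 * `|Q| + 1).
have [r0 r00 r0H] := nonpoly_growth K ef np.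
exists (2 * r0 + N (f 0)); first by have := N_ge0 (f 0); lra.
move=> r rr; have f00 := N_ge0 (f 0); have rp : 0 < r by lra.
apply: contrapT => /forall2NP H.
have [/negP|/existsNP [w1 /not_implyP[w1N /forall2NP w1H]]] := H (2 * r); first by rewrite lexx.
have [/negP|/existsNP [w2 /not_implyP[w2N /forall2NP w2H]]] := H (4 * r).
  by rewrite -ltNge; lra.
have ww : 2 * r <= N (w2 - w1) by have := N_sub w2 w1; lra.
have ww6 : N (w2 - w1) <= 6 * r by have := N_triangle w2 (- w1); rewrite NN; lra.
have ww0 : w2 - w1 != 0 by rewrite -N_gt0; lra.
have rr2 : r0 <= r / 2 by lra.
have [z zr fz] := r0H (r / 2) rr2.
have : N ((f z - w1) / (w2 - w1)) <= Q.
  apply: (QH 0 r (fun z => (f z - w1) / (w2 - w1))) => //.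
  - move=> u _; apply: cdiffM; last exact: cdiff_cst.
    by apply: cdiffB; [exact: ef|exact: cdiff_cst].
  - move=> u ur; have ur' : N u < r by move: ur; rewrite /disc /= subr0.
    split.
      rewrite mulf_neq0 ?invr_eq0 // subr_eq0; apply/eqP => fu.
      by have [] := w1H u.
    rewrite -subr_eq0 -[X in _ - X](divff ww0) -mulrBl mulf_neq0 ?invr_eq0 //.
    by rewrite opprB addrA subrK subr_eq0; apply/eqP => fu; have [] := w2H u.
  - rewrite NM NV ler_pdivrMr; last by lra.
    by have := N_triangle (f 0) (- w1); rewrite NN; lra.
  - by rewrite subr0 zr.
rewrite NM NV ler_pdivrMr; last by lra.
have Q0 := normr_ge0 Q; have QQ := ler_norm Q.
move=> h; have h2 : Q * N (w2 - w1) <= `|Q| * (6 * r).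
  by apply: le_trans (_ : `|Q| * N (w2 - w1) <= _); [rewrite ler_wpM2r ?N_ge0|rewrite ler_wpM2l].
have := N_sub (f z) w1; move: fz; rewrite /K => fz; clear -f00 fz h h2 r00 rr w1N; lra.
Qed.

Lemma entire_comp f g : entireC f -> entireC g -> entireC (fun z => f (g z)).
Proof. by move=> ef eg z _; apply: cdiff_comp; [exact: eg|exact: ef]. Qed.

Lemma entire_iter f n : entireC f -> entireC (fun z => iter n f z).
Proof.
move=> ef; elim: n => [|n IH]; first by move=> z _; exact: cdiff_id.
exact: (entire_comp ef IH).
Qed.

Lemma on_circle f r z (B : R) : entireC f -> N z <= r -> B <= N (f z) -> exists2 w, N w = r & B <= N (f w).
Proof.
move=> ef zr Bz; apply: contrapT => /forall2NP H.
have r0 : 0 <= r := le_trans (N_ge0 z) zr.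
have Nr : N (r%:C : C) = r by rewrite NC ger0_norm.
have X0 : [set w : C | N (w - 0) = r] !=set0 
  by exists r%:C; have : N (r%:C - 0 : C) = r by rewrite subr0.
have [b /= br bH] := evt_max X0 (@compact_circle _ 0 r) (fun a _ => rcont_N (cdiff_cont (ef a I))).
have : N (f z) <= N (f b).
  by apply: (@max_disc_holo _ f 0 r); rewrite ?subr0 // => w _; exact: ef.
rewrite subr0 in br.
have [//|/negP] := H b; rewrite -ltNge; lra.
Qed.

(** The image of the disc of radius [r] contains a circle of radius at least [2 * r], to which the
    induction hypothesis applies. The preimage found lies inside the disc, and [on_circle] moves it
    to the boundary. *)
Lemma iter_growth f : entireC f -> ~ ispoly f -> exists2 r0, 0 < r0 & forall n r, r0 <= r ->
  exists2 z, N z = r & 2 ^+ n * r <= N (iter n f z).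
Proof.
move=> ef np; have [r0 r00 r0H] := covers_circle ef np.
exists r0 => //; elim=> [|n IH] r rr.
  have Nr : N (r%:C : C) = r by rewrite NC ger0_norm //; lra.
  by exists r%:C; [exact: Nr|rewrite expr0 mul1r -{1}Nr].
have [s s2 sH] := r0H r rr.
have rs : r0 <= s by lra.
have [w ws wn] := IH s rs.
have [z zr fz] := sH w ws.
apply: (on_circle (entire_iter n.+1 ef) (ltW zr)).
rewrite iterSr fz; apply: le_trans wn; rewrite exprSr -mulrA ler_wpM2l // exprn_ge0 //.
Qed.
End Picard.

(** * Picard's theorem at infinity, chordal distance and Montel's theorem *)

Section Montel.
Context {R : realType}.
Notation C := R[i].
Implicit Types (z w a b c u v : C) (r e d t : R) (f g h k : C -> C) (D : set C).
Notation entireC := (holo (@setT C)).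

(* Great Picard at infinity: by a chain of discs around the circle |z| = rho,
   Schottky compares all values of f on it up to a constant independent of rho,
   so either f is bounded or |f| >= 1 near infinity. *)
Theorem omit_outside_poly f v w r : entireC f -> v != w -> 0 < r ->
  (forall z, r < N z -> f z != v /\ f z != w) -> ispoly f.
Proof.
move=> ef vw r0 fvw.
have /choice[Q QH] : forall B : R, exists Q : R, forall a r f, 0 < r -> holo (disc a r) f ->
  (forall z, disc a r z -> f z != v /\ f z != w) -> N (f a) <= B ->
  forall z, N (z - a) <= r / 2 -> N (f z) <= Q by move=> B; exact: schottky.
(* The steps around the circle then have length at most [N z / 4], half the radius of discs that
   stay in the region where the values are omitted; their number [2 ^ m] is the same for all
   circles. *)
have [m mH] : exists m : nat, (3 / 4) ^+ m <= 1 / 8 :> R by apply: exp_small; lra.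
pose B := iter (2 ^ m) Q 1.
have circ z y : 2 * r < N z -> N y = N z -> N (f z) <= 1 -> N (f y) <= B.
  move=> zr yz fz; have z0 : z != 0 by rewrite -N_gt0; lra.
  have yz1 : N (y / z) = 1 by rewrite NM NV yz divff // gt_eqF // N_gt0.
  have [u [uE u1 ud]] := root_near m yz1.
  have -> : y = z * u ^+ (2 ^ m) by rewrite uE mulrC divfK.
  rewrite /B; elim: (2 ^ m)%N => [|j IH]; first by rewrite mulr1.
  have Nj : N (z * u ^+ j) = N z by rewrite NM NX u1 expr1n mulr1.
  apply: (QH _ (z * u ^+ j) (N z / 2) f) => //; first by lra.
  - by apply: holoS ef.
  - move=> x; rewrite /disc /= => xz; apply: fvw.
    by have := N_sub (z * u ^+ j) x; rewrite NB; lra.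
  - have -> : z * u ^+ j.+1 - z * u ^+ j = z * u ^+ j * (u - 1) by rewrite exprSr; ring.
    by rewrite NM Nj; have := ler_wpM2l (N_ge0 z) ud; have := ler_wpM2l (N_ge0 z) mH; lra.
have [[R1 R1H]|NH] := pselect (exists R1 : R, forall z, R1 < N z -> 1 <= N (f z)).
  exact: tends_inf_poly R1H.
have bd y : N (f y) <= B.
  have [z zy fz] : exists2 z, Num.max (2 * r) (N y) < N z & N (f z) <= 1.
    apply: contrapT => /forall2NP H; apply: NH; exists (Num.max (2 * r) (N y)) => z zr.
    by have [//|/negP] := H z; rewrite -ltNge => /ltW.
  move: zy; rewrite gt_max => /andP[z2 zy].
  apply: (@max_disc_holo _ f 0 (N z)); rewrite ?subr0; [by move=> x _; exact: ef| |exact: ltW].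
  by move=> x; rewrite subr0 => xz; exact: (circ z).
by exists (f 0)%:P => z; rewrite hornerC; exact: (liouville ef bd).
Qed.

Implicit Types (p q : riemann_sphere R).
(** Of a limit map into the sphere only its distance to infinity will be used, which is enough to
    tell large iterates from bounded ones. *)
Definition chi p : R := chordal_dist p None.
Definition Xi (B : R) : R := 2 / Num.sqrt (1 + B ^+ 2).

Lemma sq1_gt0 (x : R) : 0 < Num.sqrt (1 + x ^+ 2).
Proof. by rewrite sqrtr_gt0 one_sq. Qed.

Lemma sq1_ge1 (x : R) : 1 <= Num.sqrt (1 + x ^+ 2).
Proof. by rewrite -[leLHS]sqrtr1 ler_sqrt ?(ltW (one_sq _)) // lerDl sqr_ge0. Qed.

Lemma chi_Some z : chi (Some z) = Xi (N z). Proof. by []. Qed.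

Lemma chordal_le z w : chordal_dist (Some z) (Some w) <= 2 * N (z - w).
Proof.
rewrite /= -/(N (z - w)) -/(N z) -/(N w) ler_pdivrMr ?mulr_gt0 ?sq1_gt0 //.
rewrite ler_peMr ?mulr_ge0 ?N_ge0 //; apply: mulr_ege1; exact: sq1_ge1.
Qed.

Lemma sq1_lip z w : Num.sqrt (1 + N z ^+ 2) <= Num.sqrt (1 + N w ^+ 2) + N (z - w).
Proof.
set s := Num.sqrt (1 + N w ^+ 2).
have s0 : 0 < s by exact: sq1_gt0.
have s2 : s ^+ 2 = 1 + N w ^+ 2 by rewrite sqr_sqrtr // ltW // one_sq.
have ws : N w <= s by rewrite -(@ler_pXn2r _ 2) ?nnegrE ?N_ge0 ?(ltW s0) // s2 lerDr.
have d0 := N_ge0 (z - w).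
rewrite -(@ler_pXn2r _ 2) ?nnegrE ?sqrtr_ge0 ?addr_ge0 ?N_ge0 ?(ltW s0) //.
rewrite sqr_sqrtr ?(ltW (one_sq _)) //.
have zw : N z <= N w + N (z - w) by have := N_sub z w; lra.
have : N z ^+ 2 <= (N w + N (z - w)) ^+ 2 by rewrite ler_sqr ?nnegrE ?addr_ge0 ?N_ge0.
rewrite !sqrrD s2; have := ler_wpM2r d0 ws; lra.
Qed.

Lemma chi_lip p q : `|chi p - chi q| <= chordal_dist p q.
Proof.
have half z w : chi (Some z) - chi (Some w) <= chordal_dist (Some z) (Some w).
  rewrite /chi /= -/(N (z - w)) -/(N z) -/(N w).
  have := sq1_lip w z; have := sq1_gt0 (N z); have := sq1_gt0 (N w).
  set s := Num.sqrt _; set t := Num.sqrt _ => s0 t0; rewrite (NB w) => h.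
  have -> : 2 / t - 2 / s = 2 * (s - t) / (t * s) by field; rewrite !gt_eqF.
  by rewrite ler_pM2r ?invr_gt0 ?mulr_gt0 //; lra.
have sym z w : chordal_dist (Some w) (Some z) = chordal_dist (Some z) (Some w).
  by rewrite /= -/(N (z - w)) -/(N (w - z)) NB (mulrC (Num.sqrt _)).
have X0 (x : R) : 0 <= Xi x by rewrite divr_ge0 // sqrtr_ge0.
case: p q => [z|] [w|].
- by rewrite ler_norml; have := half z w; have := half w z; rewrite sym; lra.
- by rewrite [chi None]/= subr0 ger0_norm //; exact: X0.
- by rewrite [chi None]/= sub0r normrN ger0_norm //; exact: X0.
- by rewrite subrr normr0.
Qed.

Lemma Xi_le (B x : R) : 0 <= x <= B -> Xi B <= Xi x.
Proof.
move=> /andP[x0 xB]; rewrite ler_pM2l // lef_pV2 ?posrE ?sq1_gt0 // ler_sqrt ?(ltW (one_sq _)) //.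
by rewrite lerD2l ler_sqr ?nnegrE //; exact: le_trans xB.
Qed.

Lemma Xi_gt0 (B : R) : 0 < Xi B. Proof. by rewrite divr_gt0 ?sq1_gt0. Qed.

Lemma Xi_small e : 0 < e -> exists2 B : R, 0 <= B & Xi B < e.
Proof.
move=> e0; exists (2 / e); first by rewrite divr_ge0 // ltW.
rewrite /Xi ltr_pdivrMr ?sq1_gt0 // -ltr_pdivrMl // mulrC.
rewrite -[ltLHS]ger0_norm ?divr_ge0 ?ltW // -sqrtr_sqr ltr_sqrt ?one_sq //.
by rewrite ltrDr.
Qed.

Lemma Xi_lt B (x : R) : 0 <= B -> 0 <= x -> Xi x < Xi B -> B < x.
Proof. by move=> B0 x0; rewrite !ltNge; apply: contra => xB; apply: Xi_le; rewrite x0. Qed.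

Lemma normal_infty (F : nat -> C -> C) D :
  (forall B : R, exists n0 : nat, forall n, (n0 <= n)%N -> forall z, D z -> B < N (F n z)) ->
  locally_uniform_cvg D (fun n z => Some (F n z) : riemann_sphere R) (fun=> None).
Proof.
move=> H K _ KD e e0; have [B B00 Be] := Xi_small e0.
have [n0 n0H] := H B; exists n0 => // n nn z Kz.
change (Xi (N (F n z)) < e); apply: le_lt_trans Be; apply: Xi_le.
by rewrite B00 /= ltW //; apply: n0H => //; exact: KD.
Qed.

(* Little Montel: pointwise limits are taken along an ultrafilter, and
   equicontinuity makes them uniform on a compact disc. *)
Lemma normal_bounded (F : nat -> C -> C) a r (Q : R) (P : nat -> Prop) : 0 < r ->
  (forall n, holo (disc a r) (F n)) -> (forall n0, exists2 n, (n0 <= n)%N & P n) ->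
  (forall n, P n -> forall z, N (z - a) <= r / 2 -> N (F n z) <= Q) ->
  exists phi : nat -> nat, {homo phi : m n / (m < n)%N} /\ exists g,
    locally_uniform_cvg (disc a (r / 8)) (fun n z => Some (F (phi n) z) : riemann_sphere R)
      (fun z => Some (g z)).
Proof.
move=> r0 hF Pinf PQ.
pose G := filter_from (@setT nat) (fun n0 => [set n | (n0 <= n)%N /\ P n]).
have PG : ProperFilter G.
  apply: filter_from_proper.
    apply: filter_from_filter; first by exists 0%N.
    move=> i j _ _; exists (maxn i j) => // n [/=]; rewrite geq_max => /andP[ni nj] Pn.
    by split; split.
  by move=> i _; have [n ni Pn] := Pinf i; exists n.
have [U [UU GU]] := ultraFilterLemma PG.
have UP : U P by apply: GU; exists 0%N => // n [].
have Uge n0 : U [set n | (n0 <= n)%N] by apply: GU; exists n0 => // n [].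
have Ulim (x : C) : exists g : C, N (x - a) <= r / 2 -> forall e, 0 < e -> U [set n | N (F n x - g) < e].
  have [xr|] := leP (N (x - a)) (r / 2); last by exists 0.
  have Fx : (F n x @[n --> U]) (cdisc 0 Q).
    suff: U ((fun n => F n x) @^-1` cdisc 0 Q) by [].
    apply: filterS UP => n Pn.
    by have : N (F n x - 0) <= Q by rewrite subr0; exact: (PQ n Pn x xr).
  have PF : ProperFilter (F n x @[n --> U]) by exact: fmap_proper_filter.
  have [g [_ cg]] := @compact_cdisc _ (0 : C) Q _ PF Fx.
  exists g => _ e e0; have [//|Un] := in_ultra_setVsetC [set n | N (F n x - g) < e] UU.
  have Fn : (F n x @[n --> U]) [set y | ~ N (y - g) < e].
    by suff: U ((fun n => F n x) @^-1` [set y | ~ N (y - g) < e]) by []; exact: filterS Un.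
  have ng : nbhs g [set y | N (y - g) < e] by apply/nbhs_N; exists e.
  by have [y [/= h1 h2]] := cg _ _ Fn ng.
have {Ulim} [g gH] := choice Ulim.
have Q0 : 0 <= Q.
  have [n _ Pn] := Pinf 0%N; apply: le_trans (N_ge0 (F n a)) _; apply: PQ => //.
  by rewrite subrr N0; lra.
pose L := 2 * Q / (3 * r / 8).
have L0 : 0 <= L by rewrite divr_ge0 ?mulr_ge0 //; lra.
have lip n x y : P n -> N (x - a) <= r / 8 -> N (y - a) <= r / 8 -> N (F n x - F n y) <= L * N (x - y).
  move=> Pn xr yr; apply: (@schwarz_diff R y (3 * r / 8) (F n) Q).
  - by move=> z; rewrite /disc /= => zy; apply: hF; rewrite /disc /=; have := N_dist z y a; lra.
  - by move=> z; rewrite /disc /= => zy; apply: PQ => //; have := N_dist z y a; lra.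
  - by rewrite /disc /=; have := N_dist x a y; rewrite (NB a y); lra.
have near_lim x e : N (x - a) <= r / 8 -> 0 < e -> U [set n | N (F n x - g x) < e].
  by move=> xr e0; apply: gH => //; lra.
have glip x y : N (x - a) <= r / 8 -> N (y - a) <= r / 8 -> N (g x - g y) <= L * N (x - y).
  move=> xr yr; apply/ler_addgt0Pl => e e0; have e2 : 0 < e / 2 by lra.
  have := filter_ex (filterI UP (filterI (near_lim x _ xr e2) (near_lim y _ yr e2))).
  move=> [n [Pn [/= hx hy]]]; have := lip n x y Pn xr yr.
  have := N_dist (g x) (F n x) (g y); have := N_dist (F n x) (F n y) (g y).
  by rewrite (NB (g x) (F n x)); lra.
have unif e : 0 < e -> U [set n | forall x, N (x - a) <= r / 8 -> N (F n x - g x) < e].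
  move=> e0; have := (@compact_near_coveringP C (cdisc a (r / 8))).1 (@compact_cdisc _ _ _).
  move=> /near_covering_withinP.
  move=> /(_ nat U (fun n x => N (F n x - g x) < e) _) H.
  apply: H => x xr; have e3 : 0 < e / 3 by lra.
  exists ([set y | N (y - x) < e / (3 * (L + 1))], [set n | P n /\ N (F n x - g x) < e / 3]).
    split => /=; last by apply: filterI => //; exact: near_lim.
    apply/nbhs_N; exists (e / (3 * (L + 1))) => //.
    by rewrite divr_gt0 // mulr_gt0 //; lra.
  move=> [y n] /= [yx [Pn nx]] yr.
  have : L * N (y - x) <= e / 3.
    apply: (@le_trans _ _ ((L + 1) * (e / (3 * (L + 1))))).
      by apply: ler_pM; rewrite ?N_ge0 ?(ltW yx) //; lra.
    by rewrite [leLHS](_ : _ = e / 3) //; field; rewrite gt_eqF //; lra.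
  have := lip n y x Pn yr xr; have := glip x y xr yr; rewrite (NB x y).
  have := N_dist (F n y) (F n x) (g y); have := N_dist (F n x) (g x) (g y).
  move=> h1 h2 h3 h4 h5; move: yx nx; rewrite /cdisc /=; clear -h1 h2 h3 h4 h5; lra.
have /choice[S SH] : forall jm : nat * nat, exists n, (jm.2 < n)%N /\
    forall x, N (x - a) <= r / 8 -> N (F n x - g x) < jm.1.+1%:R^-1.
  move=> [j m]; have j0 : 0 < j.+1%:R^-1 :> R by rewrite invr_gt0.
  by have [n [h1 h2]] := filter_ex (filterI (Uge m.+1) (unif _ j0)); exists n.
pose phi := fix phi n := if n is m.+1 then S (m.+1, phi m) else S (0, 0)%N.
exists phi; split.
  apply: homo_ltn; first exact: ltn_trans.
  by move=> i; exact: (SH (i.+1, phi i)).1.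
have phiH n x : N (x - a) <= r / 8 -> N (F (phi n) x - g x) < n.+1%:R^-1.
  by case: n => [|n] xr; [exact: (SH (0, 0)%N).2|exact: (SH (n.+1, phi n)).2].
exists g => K _ KD e e0; exists (Num.truncn (2 / e)).+1 => // n nn z Kz.
apply: le_lt_trans (chordal_le _ _) _; have zr := KD z Kz.
have h := phiH n z (ltW zr); apply: (@lt_le_trans _ _ (2 * n.+1%:R^-1)); first by rewrite ltr_pM2l.
rewrite ler_pdivrMr // -ler_pdivrMl // mulrC; apply: le_trans (ltW (truncnS_gt _)) _.
by rewrite ler_nat; exact: leqW.
Qed.

(** A dichotomy at the centre. If [F n a] tends to infinity, Schottky applied from the other points
    of a smaller disc makes [F n] tend to infinity uniformly. Otherwise infinitely many [F n a] obey
    one bound [B], and Schottky applied from [a] bounds these [F n] on the disc of half the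
    radius. *)
Theorem montel f a r v w : entireC f -> v != w -> 0 < r ->
  (forall n z, disc a r z -> iter n f z != v /\ iter n f z != w) ->
  normal_on (disc a (r / 8)) (iterates f).
Proof.
move=> ef vw r0 fvw u uI.
have /choice[k kE] : forall n, exists k : nat, u n = fun z => Some (iter k f z).
  by move=> n; have [k _ <-] := uI n; exists k.
pose F n z := iter (k n) f z.
have uE n z : u n z = Some (F n z) by rewrite kE.
have hF D n : holo D (F n) by apply: holoS (entire_iter (k n) ef).
have omit n z : disc a r z -> F n z != v /\ F n z != w by exact: fvw.
have [H|/existsNP[B /forallNP H]] := pselect (forall B : R, exists n0 : nat, forall n, (n0 <= n)%N -> B < N (F n a)).
  exists id; split => //; exists (fun=> None).
  rewrite (_ : (fun n => u (id n)) = fun n z => Some (F n z)); last first.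
    by apply/funext => n; apply/funext => z; exact: uE.
  apply: normal_infty => B.
  have [Q QH] := schottky B vw; have [n0 n0H] := H Q.
  exists n0 => n nn z zr; rewrite ltNge; apply/negP => zB.
  have := n0H n nn; rewrite ltNge => /negP; apply.
  move: zr; rewrite /disc /= => zr.
  apply: (QH z (r / 2) (F n)) => //; first by lra.
  - by move=> y; rewrite /disc /= => yz; apply: omit; rewrite /disc /=; have := N_dist y z a; lra.
  - by rewrite NB; lra.
have [Q QH] := schottky B vw.
have Pinf n0 : exists2 n, (n0 <= n)%N & N (F n a) <= B.
  have /existsNP[n /not_implyP[nn /negP]] := H n0.
  by rewrite -leNgt => h; exists n.
have [phi [phiH [g gH]]] := @normal_bounded F a r Q _ r0 (hF _) Pinf
  (fun n Pn => QH a r (F n) r0 (hF _ n) (omit n) Pn).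
exists phi; split => //; exists (fun z => Some (g z)).
rewrite (_ : (fun n => u (phi n)) = fun n z => Some (F (phi n) z)) //.
by apply/funext => n; apply/funext => z; exact: uE.
Qed.
End Montel.

(** * Bounded and unbounded orbits, Fatou and Julia set *)

Section Dynamics.
Context {R : realType}.
Notation C := R[i].
Implicit Types (z w a b c u v : C) (r e d t : R) (f g h k : C -> C) (D : set C).
Notation entireC := (holo (@setT C)).
Notation fatou := Defs.fatou.

Definition bddorb f z := exists B : R, forall n, N (iter n f z) <= B.
Definition unbdd f z := forall B : R, exists n, B < N (iter n f z).

Lemma bounded_setN (A : set C) : bounded_set A <-> exists B : R, forall z, A z -> N z <= B.
Proof.
split => [[M [Mr MH]]|[B BH]].
  exists (Re (M + 1)) => z Az; have := MH (M + 1); rewrite ltrDl ltr01 => /(_ isT z Az).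
  by rewrite /= normE lecE => /andP[_].
exists B%:C; split; first by apply/complex_realP; exists B.
move=> x Bx z Az; rewrite /= normE; apply: le_trans (ltW Bx); rewrite lecR; exact: BH.
Qed.

Lemma unbddE f z : unbounded_orbit_set f z <-> unbdd f z.
Proof.
rewrite /unbounded_orbit_set /=; split => [H B|H /bounded_setN[B BH]].
  apply: contrapT => /forallNP nH; apply: H; apply/bounded_setN; exists B => _ [n _ <-].
  by rewrite leNgt; apply/negP.
by have [n] := H B; rewrite ltNge BH //; exists n.
Qed.

Lemma unbddN f z : ~ unbdd f z <-> bddorb f z.
Proof.
split => [/existsNP[B /forallNP BH]|[B BH] /(_ B)[n]]; last by rewrite ltNge BH.
by exists B => n; rewrite leNgt; apply/negP.
Qed.

Lemma unbdd_tail f z (m : nat) : unbdd f z -> forall B : R, exists n, (m <= n)%N /\ B < N (iter n f z).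
Proof.
move=> H B; pose B' := \sum_(j < m) N (iter j f z) + `|B|.
have [n nB] := H B'; exists n; split; last first.
  apply: le_lt_trans nB; apply: le_trans (ler_norm B) _.
  by rewrite /B' lerDr sumr_ge0 // => j _; exact: N_ge0.
rewrite leqNgt; apply/negP => nm; move: nB; rewrite ltNge => /negP; apply.
rewrite /B' (bigD1 (Ordinal nm)) //= -addrA lerDl addr_ge0 //.
by rewrite sumr_ge0 // => j _; exact: N_ge0.
Qed.

Lemma unbdd_f f z : unbdd f (f z) <-> unbdd f z.
Proof.
split => H B; first by have [n nB] := H B; exists n.+1; rewrite iterSr.
have [n [n1 nB]] := unbdd_tail 1 H B; case: n n1 nB => // n _ nB.
by exists n; rewrite -iterSr.
Qed.

Lemma bddorb_f f z : bddorb f (f z) <-> bddorb f z.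
Proof. by rewrite -!unbddN unbdd_f. Qed.

Lemma unbdd_iter f z n : unbdd f (iter n f z) <-> unbdd f z.
Proof. by elim: n => //= n IH; rewrite unbdd_f. Qed.

Lemma bddorb_iter f z n : bddorb f (iter n f z) <-> bddorb f z.
Proof. by rewrite -!unbddN unbdd_iter. Qed.

Lemma unbdd_nfix f z : unbdd f z -> f z != z.
Proof.
move=> H; apply/eqP => fz; have [n] := H (N z).
have -> : iter n f z = z by elim: n => //= n ->.
by rewrite ltxx.
Qed.

Lemma fatou_limit f z (k : nat -> nat) : fatou f z -> exists2 r, 0 < r & exists phi : nat -> nat,
  {homo phi : m n / (m < n)%N} /\ exists g : C -> riemann_sphere R, forall e, 0 < e ->
    exists j0 : nat, forall j, (j0 <= j)%N -> forall w, N (w - z) <= r ->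
      `|Xi (N (iter (k (phi j)) f w)) - chi (g w)| < e.
Proof.
move=> [U [oU Uz nU]].
have [r r0 rU] : exists2 r, 0 < r & forall w, N (w - z) < r -> U w.
  by have : nbhs z U by [exact: open_nbhs_nbhs]; move=> /nbhs_N.
have [|phi [phiH [g gH]]] := nU (fun j w => Some (iter (k j) f w)).
  by move=> n; exists (k n).
exists (r / 2); first by lra.
exists phi; split => //; exists g => e e0.
have KU : cdisc z (r / 2) `<=` U by move=> w; rewrite /cdisc /= => wr; apply: rU; lra.
have [j0 _ j0H] := gH (cdisc z (r / 2)) (@compact_cdisc _ _ _) KU e e0.
exists j0 => j jj w wr; apply: le_lt_trans (j0H j jj w wr).
exact: (@chi_lip R (Some (iter (k (phi j)) f w)) (g w)).
Qed.

Lemma homo_ge (phi : nat -> nat) : {homo phi : m n / (m < n)%N} -> forall n, (n <= phi n)%N.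
Proof. by move=> H; elim=> // n IH; apply: leq_ltn_trans IH (H _ _ _). Qed.

Lemma cont_Xi f a : cont f a -> forall e, 0 < e -> exists2 d, 0 < d & forall z, N (z - a) < d ->
  `|Xi (N (f z)) - Xi (N (f a))| < e.
Proof.
move=> cf e e0; have e2 : 0 < e / 2 by lra.
have [d d0 dH] := cf _ e2; exists d => // z /dH h.
have := @chi_lip R (Some (f z)) (Some (f a)); have := chordal_le (f z) (f a).
move=> h1 h2; have := le_trans h2 h1; rewrite !chi_Some; lra.
Qed.

(** Comparison with the single continuous iterate [F j1] shows that all later [F j] exceed 1 in
    modulus near [z], and so omit 0 and 1/2. From a nearby point of bounded orbit, Schottky would
    then bound [F j z] independently of [j]. *)
Lemma fatou_unbdd f z : entireC f -> fatou f z -> unbdd f z ->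
  exists2 d, 0 < d & forall w, N (w - z) < d -> unbdd f w.
Proof.
move=> ef Fz Iz; have /choice[k kH] : forall j : nat, exists n, j%:R < N (iter n f z) by move=> j; exact: Iz.
have [r r0 [phi [phiH [g gH]]]] := fatou_limit k Fz.
pose F j w := iter (k (phi j)) f w.
have Fj j : j%:R < N (F j z).
  by apply: le_lt_trans (kH (phi j)); rewrite ler_nat; exact: homo_ge.
(* Four errors below [e] occur between [F j w] and infinity: two to the limit map at [w], one from
   [w] to [z], and the distance of [F j1 z] from infinity. *)
pose e : R := Xi 1 / 5.
have X1 := Xi_gt0 (1 : R); have e0 : 0 < e by rewrite /e; lra.
have [j0 j0H] := gH e e0; have [B B0 Be] := Xi_small e0.
pose j1 := maxn j0 (Num.truncn B).+1.
have j01 : (j0 <= j1)%N by exact: leq_maxl.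
have FB j : (j1 <= j)%N -> Xi (N (F j z)) < e.
  move=> jj; apply: le_lt_trans Be; apply: Xi_le; rewrite B0 /=; apply/ltW/lt_trans/Fj.
  apply: lt_le_trans (truncnS_gt B) _; rewrite ler_nat; exact: leq_trans (leq_maxr _ _) jj.
have zz : N (z - z) <= r by rewrite subrr N0 ltW.
have [d d0 dH] := cont_Xi (cdiff_cont (entire_iter (k (phi j1)) ef (I : setT z))) e0.
pose d' := Num.min d r.
have d'0 : 0 < d' by rewrite lt_min d0.
have big j w : (j1 <= j)%N -> N (w - z) < d' -> 1 < N (F j w).
  move=> jj; rewrite lt_min => /andP[wd wr]; apply: Xi_lt; rewrite ?N_ge0 //.
  have h1 := j0H j (leq_trans j01 jj) w (ltW wr).
  have h2 := j0H j1 j01 w (ltW wr); have h3 := dH w wd; have h4 := FB j1 (leqnn _).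
  move: h1 h2 h3 h4; rewrite /e /F !ltr_norml; clear; lra.
exists (d' / 4); first by lra.
move=> w wd; apply: contrapT => /unbddN[B1 B1H].
have v0 : (0 : C) != (1 / 2 : R)%:C by rewrite eq_sym -N_gt0 NC ger0_norm; clear; lra.
have [Q QH] := schottky B1 v0.
have [j jQ] : exists j : nat, (j1 <= j)%N /\ Q <= j%:R.
  exists (maxn j1 (Num.truncn Q).+1); split; first exact: leq_maxl.
  apply/ltW/(lt_le_trans (truncnS_gt Q)); rewrite ler_nat; exact: leq_maxr.
have : N (F j z) <= Q.
  apply: (QH w (d' / 2) (F j)) => //; first by (clear -d'0; lra).
  - by apply: holoS (entire_iter _ ef).
  - move=> y; rewrite /disc /= => yw; have := big j y jQ.1 _.
    have yz : N (y - z) < d' by have := N_dist y w z; clear -d'0 wd yw; lra.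
    move=> /(_ yz) h; split; first by rewrite -N_gt0; clear -h; lra.
    by apply/eqP => hy; move: h; rewrite hy NC ger0_norm; clear; lra.
  - exact: B1H.
  - by rewrite NB; clear -wd; lra.
by have := Fj j; have := jQ.2; clear; lra.
Qed.

Definition lbdd f z := exists2 d, 0 < d & exists M : R, forall w, N (w - z) < d -> forall n, N (iter n f w) <= M.

(** Otherwise points [w j] tending to [z] have iterates larger than [j]. Normality, applied to the
    sequence of their exponents, compares a late one of these iterates at its point with a fixed one
    there, and by continuity the latter is close to its value at [z], which the orbit of [z]
    bounds. *)
Lemma fatou_bdd f z : entireC f -> fatou f z -> bddorb f z -> lbdd f z.
Proof.
move=> ef Fz [B BH]; apply: contrapT => NL.
have /choice[w wH] : forall j : nat, exists wn : C * nat, N (wn.1 - z) < j.+1%:R^-1 /\ j%:R < N (iter wn.2 f wn.1).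
  move=> j; apply: contrapT => /forallNP nH; apply: NL; exists j.+1%:R^-1; first by rewrite invr_gt0.
  exists j%:R => w wz n; rewrite leNgt; apply/negP => h; exact: (nH (w, n)).
have [r r0 [phi [phiH [g gH]]]] := fatou_limit (fun j => (w j).2) Fz.
have B0 : 0 <= B := le_trans (N_ge0 _) (BH 0%N).
pose e := Xi B / 5; have XB := Xi_gt0 B; have e0 : 0 < e by rewrite /e; lra.
have [j0 j0H] := gH e e0; have [B1 B10 B1e] := Xi_small e0.
have [d d0 dH] := cont_Xi (cdiff_cont (entire_iter ((w (phi j0)).2) ef (I : setT z))) e0.
pose d' := Num.min d r; have d'0 : 0 < d' by rewrite lt_min d0.
pose j := maxn j0 (maxn (Num.truncn B1).+1 (Num.truncn d'^-1).+1).
have j0j : (j0 <= j)%N by exact: leq_maxl.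
pose x := (w (phi j)).1.
have jp := homo_ge phiH j.
have xd : N (x - z) < d'.
  apply: lt_trans (wH (phi j)).1 _; rewrite invf_plt ?posrE // ?invr_gt0 //.
  apply: lt_le_trans (truncnS_gt _) _; rewrite ler_nat; apply: leq_trans (leqW jp).
  by rewrite /j !leq_max leqnn !orbT.
move: xd; rewrite lt_min => /andP[xd xr].
have big : Xi (N (iter (w (phi j)).2 f x)) < e.
  apply: le_lt_trans B1e; apply: Xi_le; rewrite B10 /=; apply/ltW/lt_trans/(wH (phi j)).2.
  apply: lt_le_trans (truncnS_gt _) _; rewrite ler_nat; apply: leq_trans jp.
  by rewrite /j !leq_max leqnn orbT.
have h1 := j0H j j0j x (ltW xr); have h2 := j0H j0 (leqnn _) x (ltW xr); have h3 := dH x xd.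
have h4 : Xi B <= Xi (N (iter (w (phi j0)).2 f z)) by apply: Xi_le; rewrite N_ge0 BH.
move: h1 h2 h3 h4 big; rewrite /e !ltr_norml; clear; lra.
Qed.

Lemma open_disc a r : open (disc a r).
Proof.
rewrite openE => z /opn_disc[d d0 dH]; apply/nbhs_N; by exists d.
Qed.

Lemma montel_fatou f a r v w : entireC f -> v != w -> 0 < r ->
  (forall n z, disc a r z -> iter n f z != v /\ iter n f z != w) -> fatou f a.
Proof.
move=> ef vw r0 H; exists (disc a (r / 8)); split; first exact: open_disc.
  by rewrite /disc /= subrr N0; lra.
exact: montel vw r0 H.
Qed.

Lemma lbdd_fatou f z : entireC f -> lbdd f z -> fatou f z.
Proof.
move=> ef [d d0 [M MH]].
have M0 : 0 <= M by apply: le_trans (MH z _ 0%N); rewrite ?N_ge0 // subrr N0.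
have N1' : N (M + 1)%:C = M + 1 by rewrite NC ger0_norm //; lra.
have N2' : N (M + 2)%:C = M + 2 by rewrite NC ger0_norm //; lra.
apply: (@montel_fatou f z d (M + 1)%:C (M + 2)%:C) => //.
  by apply/eqP => /(congr1 N); rewrite N1' N2'; lra.
move=> n u ud; have := MH u ud n; split; apply/eqP => h; move: H; rewrite h ?N1' ?N2'; lra.
Qed.

Definition iunb f z := exists2 d, 0 < d & forall w, N (w - z) < d -> unbdd f w.
Definition ibdd f z := exists2 d, 0 < d & forall w, N (w - z) < d -> bddorb f w.

(** One unbounded orbit supplies both omitted values: [w] and [f w] are distinct, and no bounded
    orbit reaches either. *)
Lemma ibdd_fatou f z : entireC f -> (exists w, unbdd f w) -> ibdd f z -> fatou f z.
Proof.
move=> ef [w Iw] [d d0 dH]; have := unbdd_nfix Iw; rewrite eq_sym => ww.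
apply: (@montel_fatou f z d w (f w)) => // n u /dH Ku; split; apply/eqP => h.
  by move: Iw; rewrite -h; apply/unbddN/bddorb_iter.
by move: (Iw); rewrite -unbdd_f -h; apply/unbddN/bddorb_iter.
Qed.

Definition two_bdd f := exists v w, [/\ v != w, bddorb f v & bddorb f w].

Lemma iunb_fatou f z : entireC f -> two_bdd f -> iunb f z -> fatou f z.
Proof.
move=> ef [v [w [vw Kv Kw]]] [d d0 dH].
by apply: (@montel_fatou f z d v w) => // n u /dH Iu; split; apply/eqP => h;
  [move: Kv|move: Kw]; rewrite -h bddorb_iter => /unbddN.
Qed.

(** In this form, membership passes to images by the open mapping theorem and to preimages by
    continuity. *)
Lemma fatouE f z : entireC f -> two_bdd f -> fatou f z <-> lbdd f z \/ iunb f z.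
Proof.
move=> ef K2; split => [Fz|[|]]; [|exact: lbdd_fatou|exact: iunb_fatou].
have [Iz|/unbddN Kz] := pselect (unbdd f z); first by right; exact: fatou_unbdd.
by left; exact: fatou_bdd.
Qed.

(** On the Fatou set, whether an orbit is bounded is locally constant; its indicator function along
    the segment satisfies [lip_local] with slope 0. *)
Lemma segment_unbdd f z w : entireC f -> (forall t, 0 <= t <= 1 -> fatou f (z + t%:C * (w - z))) ->
  unbdd f z -> unbdd f w.
Proof.
move=> ef H Iz; pose q t : R := if `[< unbdd f (z + t%:C * (w - z)) >] then 0 else 1.
have q0 : q 0 = 0 by rewrite /q mul0r addr0; case: asboolP.
have : `|q 1 - q 0| <= 0.
  apply: lip_local => t t01 e e0; have Ft := H t t01.
  have n0 : 0 < N (w - z) + 1 by have := N_ge0 (w - z); lra.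
  have near d : 0 < d -> exists2 d', 0 < d' & forall s, `|s - t| < d' ->
      N (z + s%:C * (w - z) - (z + t%:C * (w - z))) < d.
    move=> d0; exists (d / (N (w - z) + 1)); first by rewrite divr_gt0.
    move=> s; rewrite ltr_pdivlMr // => st.
    have -> : z + s%:C * (w - z) - (z + t%:C * (w - z)) = (s - t)%:C * (w - z) by rewrite rmorphB /=; ring.
    rewrite NM NC; apply: le_lt_trans st; rewrite ler_wpM2l //; lra.
  have [It|/unbddN Kt] := pselect (unbdd f (z + t%:C * (w - z))).
    have [d d0 dH] := fatou_unbdd ef Ft It; have [d' d'0 d'H] := near d d0.
    exists d' => // s /d'H /dH Is; rewrite /q; case: asboolP => // _; case: asboolP => // _.
    by rewrite subrr normr0 mulr_ge0 //; lra.
  have [d d0 [M MH]] := fatou_bdd ef Ft Kt; have [d' d'0 d'H] := near d d0.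
  exists d' => // s /d'H /MH Ks; rewrite /q.
  have nKs : ~ unbdd f (z + s%:C * (w - z)) by apply/unbddN; exists M.
  have nKt : ~ unbdd f (z + t%:C * (w - z)) by apply/unbddN.
  case: asboolP => // _; case: asboolP => // _.
  by rewrite subrr normr0 mulr_ge0 //; lra.
rewrite q0 subr0 /q mul1r addrC subrK; case: asboolP => // _.
by rewrite normr1; lra.
Qed.

Lemma nonpoly_nc f a : ~ ispoly f -> exists z, f z != f a.
Proof.
move=> np; apply: contrapT => /forallNP H; apply: (nonpoly_nonconst (c := f a) np) => z.
by apply/eqP; apply/negPn/negP; exact: H.
Qed.

Lemma fatou_image f z : entireC f -> ~ ispoly f -> two_bdd f -> fatou f z -> fatou f (f z).
Proof.
move=> ef np K2 /(fatouE _ ef K2)[[d d0 [M MH]]|[d d0 dH]]; apply/(fatouE _ ef K2).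
  have [r r0 rH] := open_mapping ef (nonpoly_nc z np) d0.
  left; exists r => //; exists M => _ /rH[u uz <-] n; rewrite -iterSr; exact: MH.
have [r r0 rH] := open_mapping ef (nonpoly_nc z np) d0.
by right; exists r => // _ /rH[u uz <-]; apply/unbdd_f/dH.
Qed.

Lemma fatou_preimage f z : entireC f -> two_bdd f -> fatou f (f z) -> fatou f z.
Proof.
move=> ef K2 /(fatouE _ ef K2)[[d d0 [M MH]]|[d d0 dH]]; apply/(fatouE _ ef K2);
  have [r r0 rH] := cdiff_cont (ef z I) d0.
  left; exists r => //; exists (Num.max M (N z + r)) => w wr [|n].
    by rewrite /= le_max; apply/orP; right; have := N_sub w z; lra.
  by rewrite iterSr le_max MH // rH.
by right; exists r => // w /rH /dH /unbdd_f.
Qed.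

Lemma julia_iter f z n : entireC f -> ~ ispoly f -> two_bdd f -> julia f (iter n f z) <-> julia f z.
Proof.
move=> ef np K2; elim: n => //= n IH; rewrite -IH; split => h hF; apply: h.
  exact: fatou_image.
exact: fatou_preimage hF.
Qed.

Lemma julia_blowup f z r v w : entireC f -> julia f z -> 0 < r -> v != w ->
  exists n u, N (u - z) < r /\ (iter n f u = v \/ iter n f u = w).
Proof.
move=> ef Jz r0 vw; apply: contrapT => /forallNP H; apply: Jz.
apply: (montel_fatou ef vw r0) => n u ur; have /forallNP Hn := H n.
by split; apply/eqP => h; apply: (Hn u); split => //; [left|right].
Qed.
End Dynamics.

(** * Two bounded orbits; unboundedness of the Julia set and an unbounded orbit in it *)

Section JuliaUnbounded.
Context {R : realType}.
Notation C := R[i].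
Implicit Types (z w a b c u v : C) (r e d t : R) (f g h k : C -> C) (D : set C).
Notation entireC := (holo (@setT C)).
Notation fatou := Defs.fatou.

Lemma compact_unif (X : set C) (P : nat -> C -> Prop) : compact X ->
  (forall x, X x -> exists2 d, 0 < d & exists n0 : nat, forall n, (n0 <= n)%N ->
     forall y, N (y - x) < d -> P n y) ->
  exists n, forall x, X x -> P n x.
Proof.
move=> /compact_near_coveringP cX H.
have [] := @cX nat \oo P _ _.
  move=> x /H[d d0 [n0 n0H]]; exists ([set y | N (y - x) < d], [set n | (n0 <= n)%N]).
    by split => /=; [apply/nbhs_N; exists d|exists n0].
  by move=> [y n] /= [yx nn]; exact: n0H.
by move=> n _ nH; exists n => x; exact: (nH n (leqnn n)).
Qed.

Lemma lbdd_compact f X : compact X -> (forall x, X x -> lbdd f x) ->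
  exists n : nat, forall x, X x -> forall j, N (iter j f x) <= n%:R.
Proof.
move=> cX H; apply: compact_unif cX _ => x /H[d d0 [M MH]].
exists d => //; exists (Num.truncn M).+1 => n nM y yx j.
apply: le_trans (MH y yx j) _; apply: le_trans (ltW (truncnS_gt M)) _.
by rewrite ler_nat.
Qed.

(* If f o f had no fixed point, Picard applied to (f(f z) - z)/(f z - z) would
   express z as an entire function of f z, against the growth of f. *)
Lemma period_two f : entireC f -> ~ ispoly f -> exists p, f (f p) = p.
Proof.
move=> ef np; apply: contrapT => /forallNP H.
have f1 z : f z - z != 0.
  by rewrite subr_eq0; apply/eqP => fz; apply: (H z); rewrite !fz.
pose g z := (f (f z) - z) / (f z - z).
have eg : entireC g.
  move=> z _; apply: cdiff_div; first exact: f1.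
    by apply: cdiffB; [exact: (entire_comp ef ef)|exact: cdiff_id].
  by apply: cdiffB; [exact: ef|exact: cdiff_id].
have g01 z : g z != 0 /\ g z != 1.
  split; first by rewrite mulf_neq0 ?invr_eq0 // subr_eq0; apply/eqP/H.
  apply/eqP => /(congr1 (fun x => x * (f z - z))); rewrite /g divfK // mul1r => /addIr h.
  by have := f1 (f z); rewrite h subrr eqxx.
have v01 : (0 : C) != 1 by rewrite eq_sym oner_neq0.
have gc := little_picard eg v01 g01; set c := g 0 in gc.
have c1 : 1 - c != 0 by rewrite subr_eq0 eq_sym; exact: (g01 0).2.
pose psi w := (f w - c * w) / (1 - c).
have epsi : entireC psi.
  move=> z _; apply: cdiffM; last exact: cdiff_cst.
  apply: cdiffB; first exact: ef.
  by apply: cdiffM; [exact: cdiff_cst|exact: cdiff_id].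
have psif z : psi (f z) = z.
  have : f (f z) - z = c * (f z - z) by rewrite -(gc z) /g divfK.
  move=> h; have h' : f (f z) = c * (f z - z) + z by rewrite -h subrK.
  rewrite /psi h'; have -> : c * (f z - z) + z - c * f z = z * (1 - c) by ring.
  by rewrite mulfK.
have nppsi : ~ ispoly psi.
  move=> [q qE]; apply: np; exists ((1 - c) *: q + c *: 'X) => z.
  by rewrite !hornerE -qE /psi mulrC divfK // subrK.
(* A point [z] is mapped to a point [w] of at least twice the modulus, and [psi] grows so fast that
   [N (psi w) >= N w]; but [psi w = z]. *)
have [r0 r00 r0H] := covers_circle ef np.
have [r1 r10 r1H] := nonpoly_growth 1 epsi nppsi.
have m0 : r0 <= Num.max r0 r1 by rewrite le_max lexx.
have m1 : r1 <= Num.max r0 r1 by rewrite le_max lexx orbT.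
have [s s2 sH] := r0H _ m0; have sr1 : r1 <= s by lra.
have [w ws wpsi] := r1H s sr1; have [z zr fz] := sH w ws.
by move: wpsi; rewrite -fz psif; move: s2 zr; set M := Num.max _ _; lra.
Qed.

(* If p were the only point of bounded orbit, then f = p + (z - p) phi where
   phi omits 0, and omits 1 off p.  Either phi omits 0 and 1, or its square
   root with value 1 at p omits 0 and -1; both make phi constant. *)
Lemma two_bddorb f : entireC f -> ~ ispoly f -> two_bdd f.
Proof.
move=> ef np; apply: contrapT => NT.
have [p pp] := period_two ef np.
have Kp : bddorb f p.
  exists (Num.max (N p) (N (f p))) => n.
  have : iter n f p = p \/ iter n f p = f p.
    by elim: n => [|n [] /= ->]; [left|right|left].
  by case=> ->; rewrite le_max lexx ?orbT.
have Kuniq z : bddorb f z -> z = p.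
  move=> Kz; apply: contrapT => /eqP zp; apply: NT; by exists z, p.
have fp : f p = p by apply: Kuniq; apply/bddorb_f.
have [phi ephi phiE] := division opnT ef (I : setT p); rewrite fp in phiE.
have phi0 z : z != p -> phi z != 0.
  move=> zp; apply: contraNneq zp => h; apply/eqP/Kuniq/bddorb_f.
  by rewrite phiE h mul0r addr0.
have phi1 z : z != p -> phi z != 1.
  move=> zp; apply: contraNneq zp => h; apply/eqP/Kuniq.
  have fz : f z = z by rewrite phiE h mul1r addrC subrK.
  by exists (N z) => n; have -> : iter n f z = z by elim: n => //= n ->.
have phic : ~ (forall z, phi z = phi 0).
  move=> h; apply: np; exists (p%:P + (phi 0) *: ('X - p%:P)) => z.
  by rewrite !hornerE phiE h.
(* If [phi p = 0], then [p] is a superattracting fixed point, and nearby points have bounded orbits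
   as well. *)
have phip : phi p != 0.
  apply/eqP => h0; have h12 : 0 < 1 / 2 :> R by lra.
  have [d d0 dH] := cdiff_cont (ephi p I) h12.
  have fd z : N (z - p) < d -> N (f z - p) < d.
    move=> zd; have := dH z zd; rewrite h0 subr0 phiE addrC addKr NM => h.
    have := ler_wpM2r (N_ge0 (z - p)) (ltW h); have := N_ge0 (z - p); lra.
  have : p + (d / 2)%:C = p.
    apply: Kuniq; exists (N p + d) => n.
    suff : N (iter n f (p + (d / 2)%:C) - p) < d.
      by have := N_sub (iter n f (p + (d / 2)%:C)) p; lra.
    elim: n => [|n IH]; last exact: fd.
    by rewrite /= addrC addKr NC ger0_norm; lra.
  move=> h; have : N (p + (d / 2)%:C - p) = 0 by rewrite h subrr N0.
  by rewrite addrC addKr NC ger0_norm; lra.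
have phinz z : phi z != 0 by have [->//|/phi0] := eqVneq z p.
have v01 : (0 : C) != 1 by rewrite eq_sym oner_neq0.
have [p1|p1] := eqVneq (phi p) 1; last first.
  apply: phic; apply: (little_picard ephi v01) => z; split; first exact: phinz.
  by have [->//|/phi1] := eqVneq z p.
have v02 : (0 : C) != - 1 by rewrite eq_sym oppr_eq0 oner_neq0.
have [Q QH] := schottky 1 v02; apply: phic.
apply: (liouville (M := Q ^+ 2) ephi) => z.
pose r := 8 * (N (z - p) + 1); have zp0 := N_ge0 (z - p).
have hphi : holo (disc p r) phi by apply: holoS ephi.
have [|s hs sE] := @holo_sqrt _ p r (r / 2) phi _ hphi (fun z _ => phinz z); first by rewrite /r; lra.
have pp2 : disc p (r / 2) p by rewrite /disc /= subrr N0 /r; lra.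
have sp : s p ^+ 2 = 1 by rewrite sE.
(* Since [s p] is 1 or -1, this is the square root of [phi] with value 1 at [p]. Off [p] it cannot
   equal -1, because [phi] omits 1 there. *)
pose s' z := s p * s z.
have sE' y : disc p (r / 2) y -> s' y ^+ 2 = phi y by move=> yr; rewrite exprMn sp mul1r sE.
have zr : disc p (r / 2) z by rewrite /disc /= /r; lra.
have : N (s' z) <= Q.
  apply: (QH p (r / 2) s').
  - by rewrite /r; lra.
  - by move=> y yr; apply: cdiffM; [exact: cdiff_cst|exact: hs].
  - move=> y yr; split; apply/eqP => h; have := sE' y yr; rewrite h.
      by rewrite expr0n /= => /esym/eqP; rewrite (negPf (phinz y)).
    rewrite sqrrN expr1n => /esym ph; have [yp|/phi1] := eqVneq y p; last by rewrite ph eqxx.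
    by move: h; rewrite yp /s' -expr2 sp => /eqP; rewrite -subr_eq0 opprK -mulr2n pnatr_eq0.
  - by rewrite /s' -expr2 sp N1.
  - by rewrite /r; lra.
move=> h; rewrite -sE' // NX; apply: lerXn2r => //; rewrite nnegrE ?N_ge0 //.
exact: le_trans (N_ge0 _) h.
Qed.

(** The points are joined outside the disc of radius [r] by a radial segment followed by short
    chords, whose directions come from [root_near]; [segment_unbdd] applies to each piece. *)
Lemma annulus_unbdd f r z w : entireC f -> 0 < r -> (forall z, r < N z -> fatou f z) ->
  2 * r < N z -> 2 * r < N w -> unbdd f z -> unbdd f w.
Proof.
move=> ef r0 Fr zr wr Iz.
have z0 : z != 0 by rewrite -N_gt0; lra.
pose l := N w / N z; have nz : 0 < N z by rewrite N_gt0.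
have l0 : 0 < l by rewrite divr_gt0 //; lra.
have lz : l * N z = N w by rewrite /l divfK // gt_eqF.
pose x := l%:C * z.
have xN : N x = N w by rewrite NM NC ger0_norm ?(ltW l0).
have Ix : unbdd f x.
  apply: (segment_unbdd ef _ Iz) => t /andP[t0 t1]; apply: Fr.
  have -> : z + t%:C * (x - z) = (1 - t + t * l)%:C * z by rewrite /x !(rmorphD, rmorphB, rmorphM, rmorph1) /=; ring.
  have h1 := ler_wpM2l t0 (ltW wr); have h2 := ler_wpM2l (_ : 0 <= 1 - t) (ltW zr).
  have tl : 0 <= t * l by rewrite mulr_ge0 // ltW.
  rewrite NM NC ger0_norm; last by lra.
  rewrite mulrDl mulrBl mul1r -mulrA lz; move: h2; rewrite subr_ge0 => /(_ t1); lra.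
have x0 : x != 0 by rewrite -N_gt0 xN; lra.
have wx1 : N (w / x) = 1 by rewrite NM NV xN divff // gt_eqF //; lra.
have [m mH] : exists m : nat, (3 / 4) ^+ m <= 1 / 8 :> R by apply: exp_small; lra.
have [u [uE u1 ud]] := root_near m wx1.
have -> : w = x * u ^+ (2 ^ m) by rewrite uE mulrC divfK.
elim: (2 ^ m)%N => [|j IH]; first by rewrite mulr1.
apply: (segment_unbdd ef _ IH) => t /andP[t0 t1]; apply: Fr.
set y := x * u ^+ j; have yN : N y = N w by rewrite /y NM NX u1 expr1n mulr1.
have -> : y + t%:C * (x * u ^+ j.+1 - y) = y - - (t%:C * y * (u - 1)) by rewrite /y exprSr; ring.
clearbody y; have := N_sub y (- (t%:C * y * (u - 1))); rewrite NN !NM NC ger0_norm // yN => h.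
have h3 : t * N w * N (u - 1) <= 1 * N w * (1 / 4).
  by apply: ler_pM; rewrite ?mulr_ge0 ?N_ge0 //; [rewrite ler_wpM2r ?N_ge0|lra].
lra.
Qed.

(* If J were bounded, then near infinity either all orbits are unbounded, so
   that f omits two points of bounded orbit there, or all are bounded, against
   the growth of the iterates. *)
Lemma julia_unbounded f : entireC f -> ~ ispoly f -> forall B : R, exists2 z, julia f z & B < N z.
Proof.
move=> ef np B; apply: contrapT => /forall2NP H.
pose r := Num.max B 1; have r0 : 0 < r by rewrite lt_max ltr01 orbT.
have Fr z : r < N z -> fatou f z.
  rewrite gt_max => /andP[zB _]; have [h|/negP] := H z; last by rewrite zB.
  by apply: contrapT.
have [[z zr Iz]|NI] := pselect (exists2 z, 2 * r < N z & unbdd f z).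
  have [v [w [vw Kv Kw]]] := two_bddorb ef np.
  have r20 : 0 < 2 * r by lra.
  apply: np; apply: (omit_outside_poly ef vw r20) => y yr.
  have Iy := annulus_unbdd ef r0 Fr zr yr Iz.
  by split; apply/eqP => h; [move: Kv|move: Kw]; rewrite -h bddorb_f => /unbddN.
have [r1 r10 r1H] := iter_growth ef np.
pose rho := Num.max r1 (2 * r + 1).
have rho1 : r1 <= rho by rewrite le_max lexx.
have rho2 : 2 * r < rho by rewrite lt_max; apply/orP; right; lra.
have [n nH] : exists n : nat, forall z, [set z | N (z - 0) = rho] z -> forall j, N (iter j f z) <= n%:R.
  apply: lbdd_compact (@compact_circle _ _ _) _ => z /= zr; rewrite subr0 in zr.
  have Kz : bddorb f z by apply/unbddN => Iz; apply: NI; exists z => //; lra.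
  by apply: (fatou_bdd ef _ Kz); apply: Fr; lra.
have [m mH] : exists m : nat, n%:R < 2 ^+ m * rho.
  exists n; apply: (@lt_le_trans _ _ (2 ^+ n)); first by rewrite -natrX ltr_nat ltn_expl.
  by rewrite ler_peMr ?exprn_ge0 // ; have : 1 <= r by [rewrite le_max lexx orbT]; lra.
have [z zr zm] := r1H m rho rho1.
by have := nH z _ m; rewrite /= subr0 => /(_ zr); lra.
Qed.

Lemma fatou_near f z : fatou f z -> exists2 d, 0 < d & forall w, N (w - z) < d -> fatou f w.
Proof.
move=> [U [oU Uz nU]]; have : nbhs z U by exact: open_nbhs_nbhs.
by move=> /nbhs_N[d d0 dH]; exists d => // w /dH Uw; exists U.
Qed.

Lemma unbdd_julia f : entireC f -> ~ ispoly f -> exists2 z, unbdd f z & julia f z.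
Proof.
move=> ef np; have K2 := two_bddorb ef np; have JU := julia_unbounded ef np.
have step z r (B : R) : julia f z -> 0 < r -> exists y : C * R, [/\ julia f y.1, 0 < y.2 <= r / 2 &
    forall u, N (u - y.1) <= y.2 -> N (u - z) < r /\ exists n, B < N (iter n f u)].
  (* Montel only guarantees that one of two values is attained, so two targets are prepared; their
     moduli make them distinct. *)
  move=> Jz r0; have [v Jv vB] := JU B; have [w Jw] := JU (Num.max B (N v)).
  rewrite gt_max => /andP[wB wv].
  have vw : v != w by apply: contraTneq wv => ->; rewrite ltxx.
  have [n [u [ur nu]]] := julia_blowup ef Jz r0 vw.
  have [Ju Bu] : julia f u /\ B < N (iter n f u).
    by case: nu => nu; rewrite nu -(julia_iter u n ef np K2) nu.
  have e0 : 0 < N (iter n f u) - B by lra.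
  have [d d0 dH] := cdiff_cont (entire_iter n ef (I : setT u)) e0.
  pose s := Num.min (d / 2) ((r - N (u - z)) / 2).
  have s1 : s <= d / 2 by rewrite ge_min lexx.
  have s2 : s <= (r - N (u - z)) / 2 by rewrite ge_min lexx orbT.
  have s0 : 0 < s by rewrite lt_min; apply/andP; split; lra.
  exists (u, s); split => //=; first by rewrite s0 /=; have := N_ge0 (u - z); lra.
  move=> y ys; split; first by have := N_dist y u z; lra.
  exists n; have := dH y (le_lt_trans ys _); have := N_sub (iter n f u) (iter n f y).
  by rewrite (NB (iter n f u)) => h1 h2; have := h2 _; lra.
have /choice[S SH] : forall x : C * R * nat, exists y : C * R, julia f x.1.1 -> 0 < x.1.2 ->
    [/\ julia f y.1, 0 < y.2 <= x.1.2 / 2 &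
    forall u, N (u - y.1) <= y.2 -> N (u - x.1.1) < x.1.2 /\ exists n, x.2%:R < N (iter n f u)].
  move=> [[z r] n]; have [Jz|] := pselect (julia f z); last by exists (z, r).
  have [r0|] := ltP 0 r; last by exists (z, r).
  by have [y yH] := step z r n%:R Jz r0; exists y.
have [z0 Jz0 _] := JU 0.
pose X := fix X n : C * R := if n is m.+1 then S (X m, m) else (z0, 1).
have XH n : julia f (X n).1 /\ 0 < (X n).2.
  elim: n => [|n [h1 h2]]; first by split => //=; lra.
  by have [J1 /andP[J2 _] _] := SH (X n, n) h1 h2.
have XS n : (X n.+1).2 <= (X n).2 / 2 /\ forall u, N (u - (X n.+1).1) <= (X n.+1).2 ->
    N (u - (X n).1) < (X n).2 /\ exists m, n%:R < N (iter m f u).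
  by have [h1 h2] := XH n; have [_ /andP[_ J2] J3] := SH (X n, n) h1 h2.
have nest m n u : N (u - (X (m + n)%N).1) <= (X (m + n)%N).2 -> N (u - (X m).1) <= (X m).2.
  elim: n => [|n IH]; rewrite ?addn0 // addnS => h; apply: IH.
  by have [h1 _] := (XS (m + n)%N).2 u h; exact: ltW.
have X2 n : (X n).2 <= (1 / 2) ^+ n.
  elim: n => [|n IH]; first by rewrite expr0 /=.
  by rewrite exprS; have [h _] := XS n; lra.
have PF : ProperFilter ((X n).1 @[n --> \oo]) by exact: fmap_proper_filter.
have FX : ((X n).1 @[n --> \oo]) (cdisc (X 0%N).1 (X 0%N).2).
  suff : \oo ((fun n => (X n).1) @^-1` cdisc (X 0%N).1 (X 0%N).2) by [].
  exists 0%N => // n _; apply: (nest 0%N n); rewrite add0n subrr N0; exact/ltW/(XH n).2.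
have [x [_ cx]] := @compact_cdisc _ _ _ _ PF FX.
have xX n : N (x - (X n).1) <= (X n).2.
  rewrite leNgt; apply/negP => h.
  have Fn : ((X n).1 @[n --> \oo]) [set y | N (y - (X n).1) <= (X n).2].
    suff : \oo ((fun n => (X n).1) @^-1` [set y | N (y - (X n).1) <= (X n).2]) by [].
    exists n => // m /= nm; apply: (nest n (m - n)%N); rewrite subnKC // subrr N0.
    exact/ltW/(XH m).2.
  have nx : nbhs x [set y | N (y - x) < N (x - (X n).1) - (X n).2].
    by apply/nbhs_N; exists (N (x - (X n).1) - (X n).2) => //; lra.
  have [y [/= y1 y2]] := cx _ _ Fn nx.
  by have := N_dist x y (X n).1; rewrite (NB x y); lra.
exists x.
  move=> B; have [_ h] := XS (Num.truncn B).+1; have [_ [m mH]] := h x (xX _).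
  by exists m; exact: lt_trans (truncnS_gt B) mH.
move=> Fx; have [d d0 dH] := fatou_near Fx.
have [n nd] : exists n : nat, (1 / 2) ^+ n <= d / 2 :> R by apply: exp_small; lra.
have [Jn _] := XH n; apply: Jn; apply: dH; rewrite NB.
by have := xX n; have := X2 n; lra.
Qed.
End JuliaUnbounded.

(** * Components of the closure of the set of unbounded orbits *)

Section Components.
Context {R : realType}.
Notation C := R[i].
Implicit Types (z w a b c u v : C) (r e d t : R) (f g h k : C -> C) (A B D E V W X : set C).
Notation entireC := (holo (@setT C)).
Notation fatou := Defs.fatou.

Lemma closureN A z : closure A z <-> forall e, 0 < e -> exists2 w, A w & N (w - z) < e.
Proof.
split => [cz e e0|H B /nbhs_N[e e0 eB]].
  have nz : nbhs z [set w | N (w - z) < e] by apply/nbhs_N; exists e.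
  have [w [Aw wz]] := cz _ nz.
  by exists w.
by have [w Aw wz] := H e e0; exists w; split => //; exact: eB.
Qed.

Lemma closedN A : closed A <-> forall z, ~ A z -> exists2 d, 0 < d & forall w, N (w - z) < d -> ~ A w.
Proof.
split => [cA z nz|H z cz].
  have : ~ closure A z by move=> /cA.
  move=> /closureN/existsNP[e /not_implyP[e0 /forall2NP eH]]; exists e => // w wz Aw.
  by have [] := eH w.
apply: contrapT => /H[d d0 dH]; have [w Aw wd] := (closureN A z).1 cz d d0; exact: dH Aw.
Qed.

Lemma compact_family X (F : set (set C)) : compact X -> F !=set0 ->
  (forall V W, F V -> F W -> F (V `&` W)) -> (forall V, F V -> closed V) ->
  (forall V, F V -> X `&` V !=set0) -> exists2 x, X x & forall V, F V -> V x.
Proof.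
move=> cX [V0 FV0] FI Fc Fne; pose G := filter_from F (fun V => X `&` V).
have PG : ProperFilter G.
  apply: filter_from_proper; last exact: Fne.
  apply: filter_from_filter; first by exists V0.
  by move=> V W FV FW; exists (V `&` W); [exact: FI|move=> x [Xx [Vx Wx]]].
have GX : G X by exists V0 => // x [].
have [x [Xx cx]] := cX G PG GX.
exists x => // V FV; apply: Fc => // U nU.
have GV : G (X `&` V) by exists V.
have [y [[_ Vy] Uy]] := cx _ U GV nU.
by exists y.
Qed.

Lemma dist_pos E W : compact E -> closed W -> (forall x, E x -> ~ W x) ->
  exists2 d, 0 < d & forall x y, E x -> W y -> d <= N (x - y).
Proof.
move=> cE cW EW.
have [n nH] : exists n : nat, forall x, E x -> forall y, W y -> n.+1%:R^-1 <= N (x - y).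
  apply: compact_unif cE _ => x Ex.
  have [d d0 dH] := (closedN W).1 cW x (EW x Ex).
  exists (d / 2); first by lra.
  exists (Num.truncn (2 / d)).+1 => n nn x' xx y Wy.
  have h : d <= N (y - x) by rewrite leNgt; apply/negP => /dH.
  have n0 : 0 < n.+1%:R :> R by rewrite ltr0n.
  have : n.+1%:R^-1 <= d / 2.
    rewrite -[leRHS]invf_div lef_pV2 ?posrE ?divr_gt0 //.
    apply: ltW; apply: lt_le_trans (truncnS_gt _) _; rewrite ler_nat; exact: leqW.
  have : N (y - x) <= N (x' - y) + N (x' - x) by rewrite (NB x' y); exact: N_dist.
  by move: h xx; move: (n.+1%:R^-1) => k; lra.
by exists n.+1%:R^-1; [rewrite invr_gt0|move=> x y /nH h /h].
Qed.

Lemma out_closure_lbdd f x : entireC f -> (exists w, unbdd f w) -> ~ closure (unbdd f) x -> lbdd f x.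
Proof.
move=> ef Ine nBx; have [s s0 sH] := (closedN _).1 (@closed_closure _ (unbdd f)) x nBx.
have bx w : N (w - x) < s -> bddorb f w.
  by move=> /sH nBw; apply/unbddN => Iw; exact/nBw/subset_closure.
apply: (fatou_bdd ef); first by apply: (ibdd_fatou ef Ine); exists s.
by apply: bx; rewrite subrr N0.
Qed.

(** Quasi-components of a compact set are connected. The intersection [Q] of all relatively clopen
    parts of [T] containing [z] therefore lies in the component of [z] and misses the circle of
    radius [r]. By compactness a single clopen part misses it, and such a part is clopen in all of
    [B]. *)
Lemma separation B z r : closed B -> B z -> N z <= r ->
  (forall w, connected_component B z w -> N w < r) ->
  exists V, [/\ V z, V `<=` B, compact V & closed (B `\` V)].
Proof.
move=> cB Bz zr Cr; pose T := B `&` cdisc 0 r.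
have cdc (s : R) : closed (cdisc (0 : C) s).
  apply/closedN => x /negP; rewrite -ltNge subr0 => xs; exists (N x - s); first by lra.
  by move=> w wx; apply/negP; rewrite -ltNge subr0; have := N_sub x w; rewrite (NB x w); lra.
have cT : compact T by apply: (subclosed_compact _ (@compact_cdisc _ 0 r)); [exact: closedI|move=> x []].
have cTc : closed T by exact: closedI.
have Tz : T z by split => //; rewrite /cdisc /= subr0.
pose F : set (set C) := [set V | [/\ V z, V `<=` T, closed V & closed (T `\` V)]].
have FT : F T by split => //; rewrite setDv; exact: closed0.
have FI V W : F V -> F W -> F (V `&` W).
  move=> [V1 V2 V3 V4] [W1 W2 W3 W4]; split => //; [by move=> x [/V2]|exact: closedI|].
  by rewrite setDIr; exact: closedU.
suff [V [V1 V2 V3 V4] Vr] : exists2 V, F V & forall x, V x -> N x < r.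
  exists V; split => //; first by move=> x /V2[].
    by apply: (subclosed_compact _ cT).
  apply/closedN => x xBV; have [xr|xr] := ltP (N x) r.
    have nx : ~ (T `\` V) x by move=> [[Bx _] nVx]; apply: xBV.
    have [d d0 dH] := (closedN _).1 V4 x nx.
    exists (Num.min d (r - N x)); first by rewrite lt_min d0 subr_gt0.
    move=> w; rewrite lt_min => /andP[wd wr] [Bw nVw]; apply: (dH w wd); split => //; split => //.
    by rewrite /cdisc /= subr0; have := N_sub w x; lra.
  have nVx : ~ V x by move=> /Vr; lra.
  have nBx : ~ B x by move=> Bx; apply: xBV.
  by have [d d0 dH] := (closedN _).1 cB x nBx; exists d => // w /dH nBw [].
apply: contrapT => /forall2NP NF.
pose Q := [set x | forall V, F V -> V x].
have QT : Q `<=` T by move=> x; exact.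
have Qz : Q z by move=> V [].
have cQ : closed Q.
  apply/closedN => x /existsNP[V /not_implyP[FV nVx]].
  have [_ _ Vc _] := FV; have [d d0 dH] := (closedN V).1 Vc x nVx.
  by exists d => // w /dH nVw Qw; exact: nVw (Qw V FV).
have cptQ : compact Q by exact: subclosed_compact cQ cT QT.
(* A splitting Q = E U E' into closed sets, thickened to disjoint open sets,
   splits a whole member of F, so Q lies on the side of z. *)
have split E E' : closed E -> closed E' -> E `|` E' = Q -> (forall x, E x -> ~ E' x) -> E z -> E' = set0.
  move=> cE cE' EE' dis Ez.
  have cptE : compact E by apply: (subclosed_compact cE cptQ); rewrite -EE'; exact: subsetUl.
  have [d d0 dH] := dist_pos cptE cE' dis.
  pose O := [set x | exists2 y, E y & N (x - y) < d / 2].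
  pose O' := [set x | exists2 y, E' y & N (x - y) < d / 2].
  have opO (A : set C) : closed (~` [set x | exists2 y, A y & N (x - y) < d / 2]).
    apply/closedN => x /contrapT [y Ay xy]; exists (d / 2 - N (x - y)); first by lra.
    by move=> w wx; apply; exists y => //; have := N_dist w x y; lra.
  have OO' x : O x -> ~ O' x.
    move=> [y Ey xy] [y' Ey' xy']; have := dH y y' Ey Ey'.
    by have := N_dist y x y'; rewrite (NB y x); lra.
  have [V FV VO] : exists2 V, F V & V `<=` O `|` O'.
    apply: contrapT => /forall2NP NV.
    have cTO : compact (T `&` (~` O `&` ~` O')).
      by apply: (subclosed_compact _ cT); [apply: closedI => //; apply: closedI; exact: opO|move=> x []].
    have [|||V FV|x [Tx [nOx nOx']] Qx] := compact_family cTO (F := F).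
    - by exists T.
    - exact: FI.
    - by move=> V [].
    - have [//|/existsNP[x /not_implyP[Vx /not_orP[h1 h2]]]] := NV V.
      by exists x; split => //; split => //; have [_ VT _ _] := FV; exact: VT.
    have : Q x by exact: Qx.
    rewrite -EE' => -[Ex|Ex]; [apply: nOx|apply: nOx']; exists x => //; rewrite subrr N0; lra.
  have Oz : O z by exists z => //; rewrite subrr N0; lra.
  have FVO : F (V `&` ~` O').
    have [V1 V2 V3 V4] := FV; split.
    - by split => //; exact: OO'.
    - by move=> x [/V2].
    - by apply: closedI => //; exact: opO.
    rewrite (_ : T `\` _ = (T `\` V) `|` (V `&` ~` O)).
      by apply: closedU => //; apply: closedI => //; exact: opO.
    apply/seteqP; split => x.
      move=> [Tx nx]; have [Vx|nVx] := pselect (V x); last by left.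
      right; split => // Ox; apply: nx; split => //; exact: OO'.
    move=> [[Tx nVx]|[Vx nOx]]; first by split => // -[].
    by split; [exact: V2|move=> [_ nOx']; case: (VO x Vx)].
  rewrite -subset0 => x Ex; have Qx : Q x by rewrite -EE'; right.
  have [_ nO] := Qx _ FVO; apply: nO; exists x => //; rewrite subrr N0; lra.
have connQ : connected Q.
  move=> E [w Ew] [U1 oU1 EU1] [K cK EK].
  have cE : closed E by rewrite EK; exact: closedI.
  have cE' : closed (Q `\` E).
    rewrite EU1 (_ : Q `\` (Q `&` U1) = Q `&` ~` U1); first by apply: closedI => //; exact: open_closedC.
    by apply/seteqP; split => x [Qx h]; split => //; [move=> Ux; exact: h|move=> -[]].
  have EQ : E `<=` Q by rewrite EU1 => x [].
  have U : E `|` (Q `\` E) = Q.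
    by apply/seteqP; split => x; [move=> [/EQ|[]]|move=> Qx; have [?|?] := pselect (E x); [left|right]].
  have [Ez|nEz] := pselect (E z).
    have dis x : E x -> ~ (Q `\` E) x by move=> Ex [].
    have E0 := split E (Q `\` E) cE cE' U dis Ez.
    by rewrite -[RHS]U E0 setU0.
  have E0 : E = set0.
    apply: (split (Q `\` E) E cE' cE) => //; first by rewrite setUC.
    by move=> x [].
  by move: Ew; rewrite E0.
have QC : Q `<=` connected_component B z.
  by apply: connected_component_max => // x /QT[].
have [|||V FV|x xr Qx] := compact_family (@compact_circle R 0 r) (F := F).
- by exists T.
- exact: FI.
- by move=> V [].
- have [//|/existsNP[x /not_implyP[Vx /negP]]] := NF V; rewrite -leNgt => rx.
  exists x; split => //=; rewrite subr0; apply/eqP; rewrite eq_le rx andbT.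
  by have [_ VT _ _] := FV; have [_] := VT x Vx; rewrite /cdisc /= subr0.
by have := Cr x (QC x Qx); move: xr; rewrite /= subr0 => ->; rewrite ltxx.
Qed.

(* The component lies in a compact clopen part V of the closure.  Orbits are
   uniformly bounded on the set Y at distance d / 2 from V, hence inside it by
   the maximum principle, yet V is approximated by unbounded orbits. *)
Lemma component_unbounded f z : entireC f -> ~ ispoly f -> closure (unbdd f) z ->
  ~ bounded_set (connected_component (closure (unbdd f)) z).
Proof.
move=> ef np Bz /bounded_setN[M0 M0H].
set B := closure (unbdd f) in Bz M0H.
have [u0 Iu0 _] := unbdd_julia ef np.
have cB : closed B by exact: closed_closure.
have [V [Vz VB cV cBV]] : exists V, [/\ V z, V `<=` B, compact V & closed (B `\` V)].
  apply: (@separation B z (M0 + 1)) => //.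
    by have := M0H z (connected_component_refl Bz); lra.
  by move=> w /M0H; lra.
have [|d d0 dH] := dist_pos cV cBV; first by move=> x Vx [].
pose X := [set x | exists2 v, V v & N (x - v) <= d / 2].
pose Y := [set x | X x /\ forall v, V v -> d / 2 <= N (x - v)].
have cX : closed X.
  apply/closedN => x nX.
  (* A nearest point of [V] is obtained by maximising the inverse of the distance. *)
  have qc v : V v -> rcont (fun v => N ((x - v)^-1)) v.
    move=> Vv; apply: rcont_N; apply: contV.
      by rewrite -N_gt0 ltNge; apply/negP => h; apply: nX; exists v => //; lra.
    by apply: contB; [exact: cont_cst|exact: cont_id].
  have [v Vv vH] := evt_max (ex_intro _ z Vz) cV qc.
  have xd w : V w -> d / 2 < N (x - w) by move=> Vw; rewrite ltNge; apply/negP => h; apply: nX; exists w.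
  exists (N (x - v) - d / 2); first by have := xd v Vv; lra.
  move=> w wx [y Vy wy]; have := vH y Vy; have hx := xd y Vy; have hv := xd v Vv.
  rewrite !NV lef_pV2 ?posrE; [|lra|lra].
  by have := N_dist x w y; rewrite (NB x w); lra.
have [y0 _ MH] := evt_max (ex_intro _ z Vz) cV (fun v _ => rcont_N (@cont_id _ v)); set M := N y0 in MH.
have kX : compact X.
  apply: (subclosed_compact cX (@compact_cdisc R 0 (M + d / 2))).
  by move=> x [v /MH vM xv]; rewrite /cdisc /= subr0; have := N_sub x v; lra.
have cY : closed Y.
  apply/closedN => x nY; have [Xx|nX] := pselect (X x); last first.
    have [s s0 sH] := (closedN X).1 cX x nX; by exists s => // w /sH nXw [].
  have /existsNP[v /not_implyP[Vv /negP]] : ~ forall v, V v -> d / 2 <= N (x - v) by move=> h; apply: nY.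
  rewrite -ltNge => xv; exists (d / 2 - N (x - v)); first by lra.
  by move=> w wx [_ /(_ v Vv)]; have := N_dist w x v; lra.
have kY : compact Y by apply: (subclosed_compact cY kX) => x [].
(* Points of [Y] are at distance [d / 2] from [V], which itself is at distance at least [d] from the
   rest of [B]. *)
have Yb x : Y x -> ~ B x.
  move=> [[v Vv xv] xV] Bx; have [Vx|nVx] := pselect (V x).
    by have := xV x Vx; rewrite subrr N0; lra.
  by have := dH v x Vv (conj Bx nVx); rewrite NB; lra.
have [n nH] : exists n : nat, forall x, Y x -> forall j, N (iter j f x) <= n%:R.
  by apply: (lbdd_compact kY) => x /Yb; apply: (out_closure_lbdd ef); exists u0.
have d2 : 0 < d / 2 by lra.
have [w Iw wz] := (closureN (unbdd f) z).1 Bz _ d2.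
have Xw : X w by exists z => //; exact: ltW.
have [j nj] := Iw n%:R; move: nj; rewrite ltNge => /negP; apply.
apply: (@max_principle R X Y (fun x => iter j f x)) => //.
- by move=> x _; apply: cdiff_cont; exact: (entire_iter j ef).
- move=> x Xx nYx; have /existsNP[v /not_implyP[Vv /negP]] : ~ forall v, V v -> d / 2 <= N (x - v) by move=> h; apply: nYx.
  rewrite -ltNge => xv; exists (d / 2 - N (x - v)); first by lra.
  move=> y yx; split; last by move=> _; exact: (entire_iter j ef).
  by exists v => //; have := N_dist y x v; lra.
- by move=> x _ /nH.
Qed.

End Components.

Local Unset Implicit Arguments.
Local Set Strict Implicit.

Theorem theorem2p1 (R : realType) (f : R[i] -> R[i])
    (hf : transcendental_entire f) :
  [/\ unbounded_orbit_set f !=set0,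
      unbounded_orbit_set f `&` julia f !=set0,
      julia f = closure (unbounded_orbit_set f `&` julia f),
      julia f = boundary (unbounded_orbit_set f)
    & forall z, closure (unbounded_orbit_set f) z ->
        ~ bounded_set (connected_component (closure (unbounded_orbit_set f)) z)].
Proof.
have [df np] := hf; have ef : holo setT f by move=> z _; exact: derivable_cdiff.
have -> : unbounded_orbit_set f = unbdd f by apply/funext => z; apply/propext; exact: unbddE.
have [z0 I0 J0] := unbdd_julia ef np; have K2 := two_bddorb ef np.
split.
- by exists z0.
- by exists z0.
- apply/seteqP; split => z.
    (* The two values are [z0] and [f z0]; by invariance, preimages of either one lie in both
       sets. *)
    move=> Jz; apply/closureN => e e0; have := unbdd_nfix I0; rewrite eq_sym => z0f.
    have [n [u [ue nu]]] := julia_blowup ef Jz e0 z0f.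
    exists u => //; split; case: nu => nu.
    + by rewrite -(unbdd_iter f u n) nu.
    + by rewrite -(unbdd_iter f u n) nu unbdd_f.
    + by rewrite -(julia_iter u n ef np K2) nu.
    + by rewrite -(julia_iter u n ef np K2) nu -[f z0]/(iter 1 f z0) (julia_iter z0 1 ef np K2).
  move=> /closureN cz /fatou_near[d d0 dH].
  by have [w [_ Jw] wz] := cz d d0; apply: Jw; exact: dH.
- apply/seteqP; split => z.
    move=> Jz; split.
      apply/closureN => e e0; apply: contrapT => /forall2NP H; apply: Jz.
      apply: (ibdd_fatou ef); first by exists z0.
      by exists e => // w we; apply/unbddN => Iw; have [] := H w.
    by move=> /nbhs_N[d d0 dH]; apply: Jz; apply: iunb_fatou => //; exists d.
  move=> [cz iz] /(fatouE _ ef K2)[[d d0 [M MH]]|[d d0 dH]].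
    have [w Iw wd] := (closureN (unbdd f) z).1 cz d d0.
    by apply/unbddN: Iw; exists M => n; exact: MH.
  by apply: iz; apply/nbhs_N; exists d.
- by move=> z; exact: component_unbounded.
Qed.
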